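(* Let $E$ be a de Branges function and let $\widetilde\Pi_E$ be the orthogonal projection of $L_2(\mathbb R)$ onto $\mathcal B_E=\{F/E : F\in B(E)\}$. Then the determinantal point process $\mathbb P_{\widetilde\Pi_E}$ on $\mathbb R$ is rigid in the sense of Ghosh and Peres: for every bounded Borel set $B\subset\mathbb R$, the random variable $\#_B$ is $\mathcal F^{\mathbb P_{\widetilde\Pi_E}}_{\mathbb R\setminus B}$-measurable.
   Context: A de Branges function is an entire function $E$ with $|E(z)|>|E^{\#}(z)|$ for all $z$ in the open upper half-plane $\mathbb C_+$, where $E^{\#}(z)=\overline{E(\bar z)}$. The de Branges space $B(E)$ is the Hilbert space of entire functions $f$ such that $f|_{\mathbb R}\in L^2(\mathbb R,|E(\lambda)|^{-2}d\lambda)$ and $f/E$, $f^{\#}/E$ belong to the Hardy space $H_2(\mathbb C_+)$, with norm $\|f\|^2=\int_{\mathbb R}|f(\lambda)|^2|E(\lambda)|^{-2}d\lambda$. The space $\mathcal B_E=\{F/E: F\in B(E)\}$ (restricted to $\mathbb R$) is a closed subspace of $L_2(\mathbb R)$, and the orthogonal projection $\widetilde\Pi_E$ onto it has kernel $\widetilde\Pi_E(x,y)=\dfrac{E(x)\overline{E(y)}-E^{\#}(x)\overline{E^{\#}(y)}}{-2\pi i(x-y)E(x)\overline{E(y)}}$ for real $x\neq y$ (extended continuously to the diagonal). For a locally trace class operator $K$ on $L_2(\mathbb R)$, $\mathbb P_K$ denotes the determinantal point process on the space $\mathrm{Conf}(\mathbb R)$ of locally finite configurations, i.e. the unique Borel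 probability measure with $\mathbb E\prod_{x\in X}g(x)=\det(1+(g-1)K\chi_B)$ for every bounded measurable $g$ with $g-1$ supported in a bounded set $B$. For a bounded Borel $B$, $\#_B(X)$ is the number of points of $X$ in $B$; for Borel $C\subset\mathbb R$, $\mathcal F_C$ is the $\sigma$-algebra generated by $\#_{B}$, $B\subset C$ bounded Borel, and $\mathcal F_C^{\mathbb P}$ is its $\mathbb P$-completion. *)

(* Defs.v *)
From HB Require Import structures.
From mathcomp Require Import all_boot all_order all_algebra.
From mathcomp Require Import all_classical all_reals all_analysis measurable_realfun.
From mathcomp Require Import complex.

Set Implicit Arguments.
Unset Strict Implicit.
Unset Printing Implicit Defensive.

Import Order.TTheory GRing.Theory Num.Theory ComplexField.
Import numFieldNormedType.Exports.
Local Open Scope classical_set_scope.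
Local Open Scope ring_scope.
Local Open Scope complex_scope.

Definition entire (R : realType) (f : R[i] -> R[i]) : Prop :=
  forall z : R[i], derivable (f : R[i]^o -> R[i]^o) z 1.

Definition sharp (R : realType) (E : R[i] -> R[i]) (z : R[i]) : R[i] :=
  conjc (E (conjc z)).

Definition de_branges (R : realType) (E : R[i] -> R[i]) : Prop :=
  entire E /\
  forall z : R[i], 0 < complex.Im z -> `|sharp E z| < `|E z|.

Definition PiE_off (R : realType) (E : R[i] -> R[i]) (x y : R) : R[i] :=
  (E x%:C * conjc (E y%:C) - sharp E x%:C * conjc (sharp E y%:C)) /
  ((- 2%:R * (pi : R)%:C * 'i) * (x - y)%:C * E x%:C * conjc (E y%:C)).

Definition PiE (R : realType) (E : R[i] -> R[i]) (x y : R) : R[i] :=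
  if x != y then PiE_off E x y
  else lim ((PiE_off E x : R -> R[i]^o) @ x^').

Definition locally_finite (R : realType) (X : set R) : Prop :=
  forall B : set R, bounded_set B -> finite_set (X `&` B).

Lemma locally_finite0 (R : realType) : locally_finite (@set0 R).
Proof. by move=> B _; rewrite set0I; exact: finite_set0. Qed.

Definition Conf (R : realType) := {X : set R | locally_finite X}.
Section ConfInstances.
Variable R : realType.
HB.instance Definition _ := gen_eqMixin (Conf R).
HB.instance Definition _ := gen_choiceMixin (Conf R).
HB.instance Definition _ :=
  isPointed.Build (Conf R) (exist _ set0 (@locally_finite0 R)).
End ConfInstances.

Definition conf_set (R : realType) (X : Conf R) : set R := proj1_sig X.

Definition count_in (R : realType) (B : set R) (X : Conf R) : \bar R :=
  counting (conf_set X `&` B).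

Definition gen_F (R : realType) (C : set R) : set (set (Conf R)) :=
  [set S | exists (B : set R) (A : set (\bar R)),
     [/\ measurable B, bounded_set B, B `<=` C, measurable A &
         S = count_in B @^-1` A]].

Definition F_ (R : realType) (C : set R) : set (set (Conf R)) :=
  <<s gen_F C >>.

Notation ConfSpace R := (g_sigma_algebraType (gen_F (@setT R))).

Definition completion_F (R : realType) (P : probability (ConfSpace R) R)
  (C : set R) : set (set (Conf R)) :=
  [set S | exists (A N : set (Conf R)),
     [/\ F_ C A, F_ setT N, P N = 0%E & (S `\` A) `|` (A `\` S) `<=` N]].

Definition cint (R : realType) (f : R -> R[i]) : R[i] :=
  (Rintegral (@lebesgue_measure R) setT (fun x => complex.Re (f x)))%:C +
  'i * (Rintegral (@lebesgue_measure R) setT (fun x => complex.Im (f x)))%:C.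

(* n-fold (iterated) integral over R^n of f, a function of the
   coordinates x 0, ..., x (n-1) *)
Fixpoint iint (R : realType) (n : nat) (f : (nat -> R) -> R[i]) : R[i] :=
  match n with
  | 0 => f (fun _ => 0)
  | n'.+1 => cint (fun t => iint n' (fun x => f (fun i =>
               if i is k.+1 then x k else t)))
  end.

Definition fredholm_term (R : realType) (A : R -> R -> R[i]) (n : nat) : R[i] :=
  iint n (fun x => \det (\matrix_(i < n, j < n) A (x i) (x j))) / (n`!)%:R.

Definition fredholm_det_is (R : realType) (A : R -> R -> R[i]) (d : R[i]) : Prop :=
  (series (fredholm_term A) : nat -> R[i]^o) @ \oo --> (d : R[i]^o).

(* prod_{x in X} g(x), where g = 1 outside B *)
Definition mult_functional (R : realType) (g : R -> R[i]) (B : set R)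
  (X : Conf R) : R[i] :=
  \big[*%R/1%R]_(x \in conf_set X `&` B) g x.

Definition is_DPP (R : realType) (K : R -> R -> R[i])
  (P : probability (ConfSpace R) R) : Prop :=
  forall (g : R -> R[i]) (B : set R),
    measurable B -> bounded_set B ->
    measurable_fun setT (fun x => complex.Re (g x)) ->
    measurable_fun setT (fun x => complex.Im (g x)) ->
    (exists M : R, forall x, `|g x| <= M%:C) ->
    (forall x, ~ B x -> g x = 1) ->
    let Phi := mult_functional g B in
    [/\ P.-integrable setT (fun X => (complex.Re (Phi X))%:E),
        P.-integrable setT (fun X => (complex.Im (Phi X))%:E) &
        fredholm_det_is
          (fun x y => (g x - 1) * K x y * (\1_B y)%:C)
          ((Rintegral P setT (fun X => complex.Re (Phi X)))%:C +
           'i * (Rintegral P setT (fun X => complex.Im (Phi X)))%:C)].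

Definition rigid (R : realType) (P : probability (ConfSpace R) R) : Prop :=
  forall B : set R, measurable B -> bounded_set B ->
    forall A : set (\bar R), measurable A ->
      completion_F P (~` B) (count_in B @^-1` A).

(* Main.v *)
(** A linear statistic of a determinantal process whose kernel reproduces,
    [\int |K x t|^2 dt = K x x], has variance
    [1/2 \iint (f t - f s)^2 |K t s|^2 dt ds]. For the kernel of a de Branges
    space [|K t s|^2 <= (pi (t - s))^-2], so the variance is at most a constant
    times the H^(1/2) energy of [f]. That energy can be made arbitrarily small
    with [f = 1] on a given interval: average [n] tents whose widths grow so fast
    that they hardly interact, which gives an energy of order [1/n]. Hence along a
    suitable sequence of such [f] the number of points in [B] is the almost sure
    limit of statistics that only involve the points outside [B].

    The reproducing property is obtained without Hardy spaces. After normalization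
    at the point [x], the inner function [u = E^# / E] satisfies
    [1 - Re u = const * (t - x)^2 * |K x t|^2] on the real line, and its Poisson
    formula at [x + i e] gives the property as [e -> 0]. Real zeros of [E] only
    form a countable set and are null for the Poisson integral. *)
Require Import Defs.
From HB Require Import structures.
From mathcomp Require Import all_boot all_order all_algebra.
From mathcomp Require Import all_classical all_reals all_analysis measurable_realfun.
From mathcomp Require Import complex.
From mathcomp Require Import ring lra.
Set Implicit Arguments.
Unset Strict Implicit.
Unset Printing Implicit Defensive.
Import Order.TTheory GRing.Theory Num.Theory ComplexField.
Import numFieldNormedType.Exports.
Local Open Scope classical_set_scope.
Local Open Scope ring_scope.
Local Open Scope complex_scope.

Import ComplexField.Normc.
Local Notation Re := complex.Re.
Local Notation Im := complex.Im.

(** * Complex differentiability and Goursat's theorem *)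

Section ComplexModulus.
Context {R : realType}.
Implicit Types (z w : R[i]) (a b : R).

(** The hypothesis [is_DPP] is the only access to the process: it gives means of products and a
    convergent series of iterated integrals whose integrability is a priori unknown. Inserting
    [g = 1 + t * f] turns the series into a power series in [t], and comparison up to order 3 yields
    the first two moments of a linear statistic. Determinants of order 1 and 2 see the kernel only
    through [K x x] and [K x y * K y x], so all information on [E] is condensed into two real
    functions [k] and [kap]. Two points need care. An infinite integral is read as 0 by [Rintegral],
    so local integrability of [k] must be proved; it is drawn from the process itself by truncation.
    At real zeros of [E] the convention [0^-1 = 0] makes the kernel vanish; that each segment
    contains finitely many zeros follows from a crude maximum principle losing a factor 2, since
    every zero gains a factor 1/2 at a fixed point of the upper half-plane. The complex analysis
    thus rests on Goursat's theorem for rectangles, in a form tolerating finitely many points of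
    mere continuity, so that difference quotients can be integrated directly. *)

Lemma normr_normc z : `|z| = (normc z)%:C. Proof. by []. Qed.

Lemma normc_ge0 z : 0 <= normc z.
Proof. by case: z => a b; exact: sqrtr_ge0. Qed.

Lemma normcB w z : normc (z - w) = normc (w - z).
Proof. by rewrite -[in RHS]opprB; exact/esym/(@normcN R). Qed.

Lemma normc_triangle z w : normc (z + w) <= normc z + normc w.
Proof. exact: (@le_normcD R). Qed.

Lemma sqr_normcE z : normc z ^+ 2 = Re z ^+ 2 + Im z ^+ 2.
Proof. by case: z => a b /=; rewrite sqr_sqrtr// addr_ge0 ?sqr_ge0. Qed.

Lemma normc_conjc z : normc (conjc z) = normc z.
Proof. by case: z => a b /=; rewrite sqrrN. Qed.

Lemma normc_real a : normc a%:C = `|a|.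
Proof. by rewrite /= expr0n/= addr0 sqrtr_sqr. Qed.

Lemma normc_eq0 z : (normc z == 0) = (z == 0).
Proof. by apply/eqP/eqP => [/eq0_normc|->]//; exact: normc0. Qed.

Lemma normc_gt0 z : (0 < normc z) = (z != 0).
Proof. by rewrite lt_def normc_ge0 andbT normc_eq0. Qed.

Lemma normc_Re z : `|Re z| <= normc z.
Proof.
rewrite -(@ler_pXn2r _ 2)// ?nnegrE ?normc_ge0//.
by rewrite sqr_normcE real_normK ?num_real// lerDl sqr_ge0.
Qed.

Lemma normc_Im z : `|Im z| <= normc z.
Proof.
rewrite -(@ler_pXn2r _ 2)// ?nnegrE ?normc_ge0//.
by rewrite sqr_normcE real_normK ?num_real// lerDr sqr_ge0.
Qed.

Lemma normc_le_ReIm z : normc z <= `|Re z| + `|Im z|.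
Proof.
rewrite -(@ler_pXn2r _ 2)// ?nnegrE ?normc_ge0 ?addr_ge0//.
rewrite sqr_normcE sqrrD !real_normK ?num_real//.
by rewrite lerD2r lerDl mulrn_wge0// mulr_ge0.
Qed.

(** The norm of [R[i]] takes values in [R[i]]; stating continuity and differentiability through the
    real-valued [normc] keeps every estimate in the ordered field [R]. *)
Definition ccont (f : R[i] -> R[i]) z := forall e, 0 < e ->
  exists2 d, 0 < d & forall w, normc (w - z) < d -> normc (f w - f z) < e.

Definition cderiv (f : R[i] -> R[i]) z l := forall e, 0 < e ->
  exists2 d, 0 < d & forall w, normc (w - z) < d ->
    normc (f w - f z - l * (w - z)) <= e * normc (w - z).

Lemma nbhs_normc z (P : set R[i]) :
  nbhs (z : R[i]^o) P <-> exists2 d, 0 < d & forall w, normc (w - z) < d -> P w.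
Proof.
split.
  move=> /(@nbhs_ballP R[i] R[i]^o)[d/= d0 dP]; exists (Re d).
    by move: d0; rewrite ltcE => /andP[].
  move=> w wz; apply: dP.
  rewrite -ball_normE/=; move: d0; rewrite ltcE => /andP[/= /eqP dI _].
  by rewrite ltcE/= dI eqxx/= (le_lt_trans _ wz)//= normcB.
move=> [d d0 dP]; apply/(@nbhs_ballP R[i] R[i]^o); exists d%:C => /=.
  by rewrite ltcR.
move=> w; rewrite -ball_normE/= => wz; apply: dP.
by rewrite normcB -ltcR.
Qed.

Lemma ccontP f z : ccont f z <-> {for z, continuous (f : R[i]^o -> R[i]^o)}.
Proof.
split=> [fz|fz e e0].
  move=> A /nbhs_normc[e e0 eA]; apply/nbhs_normc.
  have [d d0 dP] := fz _ e0; exists d => // w wz.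
  by apply: eA; exact: dP.
have := fz [set w | normc (w - f z) < e].
have /[swap] /[apply] : nbhs (f z : R[i]^o) [set w | normc (w - f z) < e].
  by apply/nbhs_normc; exists e.
by move=> /nbhs_normc[d d0 dP]; exists d.
Qed.

Lemma derivable_cderiv (f : R[i]^o -> R[i]^o) z :
  derivable f z 1 -> exists l, cderiv f z l.
Proof.
move=> fz; exists ('D_1 f z) => e e0.
move: fz => /cvg_ex[l hl].
have -> : 'D_1 f z = l by rewrite /derive; exact/cvg_lim.
have H : nbhs (l : R[i]^o) [set w | normc (w - l) < e].
  by apply/nbhs_normc; exists e.
have : nbhs (0 : R[i]^o) [set h | h != 0 ->
    normc (h^-1 *: (f (h *: 1 + z) - f z) - l) < e] := hl _ H.
move=> /nbhs_normc[d d0 dP]; exists d => // w wz.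
have [->|wz0] := eqVneq w z; first by rewrite !subrr mulr0 subr0 normc0 mulr0.
have wz1 : w - z != 0 by rewrite subr_eq0.
have := dP (w - z); rewrite subr0 => /(_ wz wz1)/= /ltW.
rewrite /GRing.scale/= mulr1 subrK => H3.
have nwz : 0 < normc (w - z) by rewrite normc_gt0.
rewrite -(ler_pM2r nwz) -normcM in H3; apply: le_trans H3.
rewrite le_eqVlt; apply/orP; left; apply/eqP; congr normc.
by field.
Qed.

Lemma cderiv_derivable (f : R[i]^o -> R[i]^o) z l :
  cderiv f z l -> derivable f z 1.
Proof.
move=> fz; apply/cvg_ex; exists l => A /nbhs_normc[e e0 eA].
have [|d d0 dP] := fz (e / 2); first by rewrite divr_gt0.
suff : nbhs (0 : R[i]^o) [set h | h != 0 ->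
    A (h^-1 *: (f (h *: 1 + z) - f z))] by [].
apply/nbhs_normc; exists d => // h; rewrite subr0 => hd h0 /=.
apply: eA; rewrite /GRing.scale/= mulr1.
have := dP (h + z); rewrite addrK => /(_ hd) H.
have nh : 0 < normc h by rewrite normc_gt0.
rewrite -(ltr_pM2r nh) -normcM.
have -> : (h^-1 * (f (h + z) - f z) - l) * h = f (h + z) - f z - l * h by field.
by rewrite (le_lt_trans H)// ltr_pM2r//; lra.
Qed.

Lemma cderiv_ccont f z l : cderiv f z l -> ccont f z.
Proof.
move=> fz e e0; have [|d d0 dP] := fz 1; first by [].
have n0 := normc_ge0 l.
exists (Num.min d (e / (normc l + 2))).
  by rewrite lt_min d0 divr_gt0// ltr_wpDl.
move=> w; rewrite lt_min => /andP[wd]; rewrite ltr_pdivlMr ?ltr_wpDl// => we.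
have := dP _ wd; set t := f w - f z => H.
have -> : t = t - l * (w - z) + l * (w - z) by rewrite subrK.
rewrite (le_lt_trans (normc_triangle _ _))// normcM.
have := normc_ge0 (w - z); nra.
Qed.

End ComplexModulus.

(** * Integrals of continuous functions over segments *)

Section SegmentIntegral.
Context {R : realType}.
Notation mu := (@lebesgue_measure R).
Implicit Types (a b c k m : R) (f g : R -> R).

Definition sint f a b : R := \int[mu]_(x in `[a, b]) f x.

Definition contin f a b := forall x, a <= x <= b -> {for x, continuous f}.

Lemma contin_integrable f a b : contin f a b -> mu.-integrable `[a, b] (EFin \o f).
Proof.
move=> cf; apply: continuous_compact_integrable; first exact: segment_compact.
apply: continuous_in_subspaceT => x; rewrite inE/= in_itv/= => xab.
exact: cf.
Qed.

Lemma sint_split f a m b : a <= m <= b -> contin f a b ->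
  sint f a b = sint f a m + sint f m b.
Proof.
move=> /andP[am mb] cf; have fi := contin_integrable cf.
have := @Rintegral_itvB R f (BLeft a) (BRight b) m fi.
rewrite !bnd_simp => /(_ am mb) H.
rewrite /sint -[RHS]addrC; apply/eqP; rewrite -subr_eq H; apply/eqP.
apply: Rintegral_itv_obnd_cbnd.
by apply: integrableS fi => //; apply: subset_itvr; rewrite bnd_simp.
Qed.

Lemma lebesgue_itv_cc a b : a <= b -> fine (mu `[a, b]) = b - a.
Proof.
move=> ab; rewrite lebesgue_measure_itv/= lte_fin.
by case: ltgtP ab => // -> _; rewrite subrr.
Qed.

(** Meant for [f] and [g] on opposite sides of a rectangle: for an affine function their difference
    is a constant [k], and [m] measures the deviation from it. *)
Lemma sintB_le f g a b k m : a <= b -> contin f a b -> contin g a b ->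
  (forall x, a <= x <= b -> `|f x - g x - k| <= m) ->
  `|sint f a b - sint g a b - k * (b - a)| <= m * (b - a).
Proof.
move=> ab cf cg H.
have fi := contin_integrable cf; have gi := contin_integrable cg.
have ci : mu.-integrable `[a, b] (EFin \o (fun=> k)).
  by apply: contin_integrable => x _; exact: cst_continuous.
have fgi : mu.-integrable `[a, b] (EFin \o (f \- g)).
  exact: integrableB fi gi.
have mi : mu.-integrable `[a, b] (EFin \o (fun=> m)).
  by apply: contin_integrable => x _; exact: cst_continuous.
have fgki : mu.-integrable `[a, b] (EFin \o ((f \- g) \- (fun=> k))).
  exact: integrableB fgi ci.
have -> : sint f a b - sint g a b - k * (b - a) =
    \int[mu]_(x in `[a, b]) ((f \- g) \- (fun=> k)) x.
  by rewrite RintegralB// RintegralB// Rintegral_cst// lebesgue_itv_cc.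
rewrite (le_trans (le_normr_Rintegral _ fgki))//.
rewrite -(lebesgue_itv_cc ab) -Rintegral_cst//; apply: le_Rintegral => //.
exact: (integrable_norm fgki).
Qed.

End SegmentIntegral.

(** * Boundary integrals over rectangles and their subdivision *)

Section Goursat.
Context {R : realType}.
Implicit Types (f : R[i] -> R[i]) (z p : R[i]) (a b c d : R).

Definition inrect a b c d z := (a <= Re z <= b) && (c <= Im z <= d).

(** The real part of the counterclockwise contour integral of [f]. The imaginary part is the real
    part for [- 'i * f], so a real-valued quantity loses nothing. *)
Definition bdry f a b c d : R :=
  sint (fun t => Re (f (t +i* c))) a b - sint (fun t => Re (f (t +i* d))) a b +
  (sint (fun s => Im (f (a +i* s))) c d - sint (fun s => Im (f (b +i* s))) c d).

Lemma ccont_re_hor f t c : ccont f (t +i* c) ->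
  {for t, continuous (fun t => Re (f (t +i* c)))}.
Proof.
move=> cf; apply/cvgrPdist_lt => e e0; have [d d0 dP] := cf _ e0.
near=> s; rewrite -raddfB; apply: le_lt_trans (normc_Re _) _.
rewrite normcB; apply: dP.
rewrite (_ : _ - _ = (s - t)%:C); last first.
  by apply/eqP; rewrite eq_complex/= subrr !eqxx.
rewrite normc_real distrC; near: s.
by apply: (@cvgr_dist_lt _ _ _ _ _ id) => //; exact: cvg_id.
Unshelve. all: by end_near. Qed.

Lemma ccont_im_ver f t c : ccont f (c +i* t) ->
  {for t, continuous (fun t => Im (f (c +i* t)))}.
Proof.
move=> cf; apply/cvgrPdist_lt => e e0; have [d d0 dP] := cf _ e0.
near=> s; rewrite -raddfB; apply: le_lt_trans (normc_Im _) _.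
rewrite normcB; apply: dP.
rewrite (_ : _ - _ = (s - t)%:C * 'i); last first.
  by apply/eqP; rewrite eq_complex/=; apply/andP; split; apply/eqP; ring.
rewrite normcM normc_real/= expr0n/= add0r expr1n sqrtr1 mulr1 distrC; near: s.
by apply: (@cvgr_dist_lt _ _ _ _ _ id) => //; exact: cvg_id.
Unshelve. all: by end_near. Qed.

Definition ccont_rect f a b c d :=
  forall z, inrect a b c d z -> ccont f z.

Lemma rect_hor f a b c d y : ccont_rect f a b c d -> c <= y <= d ->
  contin (fun t => Re (f (t +i* y))) a b.
Proof.
move=> cf yd x xab; apply: ccont_re_hor; apply: cf.
by rewrite /inrect/= xab yd.
Qed.

Lemma rect_ver f a b c d x : ccont_rect f a b c d -> a <= x <= b ->
  contin (fun t => Im (f (x +i* t))) c d.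
Proof.
move=> cf xd y yab; apply: ccont_im_ver; apply: cf.
by rewrite /inrect/= xd yab.
Qed.

Lemma bdry_splitx f a m b c d : a <= m <= b -> c <= d ->
  ccont_rect f a b c d ->
  bdry f a b c d = bdry f a m c d + bdry f m b c d.
Proof.
move=> amb cd cf; rewrite /bdry.
rewrite (@sint_split _ (fun t => Re (f (t +i* c))) a m b)//; last first.
  by apply: (rect_hor cf); rewrite lexx.
rewrite (@sint_split _ (fun t => Re (f (t +i* d))) a m b)//; last first.
  by apply: (rect_hor cf); rewrite lexx cd.
ring.
Qed.

Lemma bdry_splity f a b c m d : c <= m <= d -> a <= b ->
  ccont_rect f a b c d ->
  bdry f a b c d = bdry f a b c m + bdry f a b m d.
Proof.
move=> amb cd cf; rewrite /bdry.
rewrite (@sint_split _ (fun t => Im (f (a +i* t))) c m d)//; last first.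
  by apply: (rect_ver cf); rewrite lexx.
rewrite (@sint_split _ (fun t => Im (f (b +i* t))) c m d)//; last first.
  by apply: (rect_ver cf); rewrite lexx cd.
ring.
Qed.

(* The affine part contributes nothing to the boundary integral. *)
Lemma bdry_affine_approx f a b c d u v p m : a <= b -> c <= d ->
  ccont_rect f a b c d ->
  (forall z, inrect a b c d z -> normc (f z - u - v * (z - p)) <= m) ->
  `|bdry f a b c d| <= 2 * m * ((b - a) + (d - c)).
Proof.
move=> ab cd cf H; rewrite /bdry.
have H1 : `|sint (fun t => Re (f (t +i* c))) a b -
    sint (fun t => Re (f (t +i* d))) a b - Im v * (d - c) * (b - a)| <=
    2 * m * (b - a).
  apply: sintB_le => //.
  - by apply: (rect_hor cf); rewrite lexx.
  - by apply: (rect_hor cf); rewrite lexx cd.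
  move=> x xab.
  have := H (x +i* c); rewrite /inrect/= xab lexx cd => /(_ isT) H1.
  have := H (x +i* d); rewrite /inrect/= xab lexx cd => /(_ isT) H2.
  have {}H1 := le_trans (normc_Re _) H1.
  have {}H2 := le_trans (normc_Re _) H2.
  set A := f _ in H1 *; set B := f _ in H2 *.
  move: A B u v p H1 H2 {H} => [A1 A2] [B1 B2] [u1 u2] [v1 v2] [p1 p2] /=.
  rewrite !ler_norml => /andP[H1 H2] /andP[H3 H4]; apply/andP; split; lra.
have H2 : `|sint (fun t => Im (f (a +i* t))) c d -
    sint (fun t => Im (f (b +i* t))) c d - Im v * (a - b) * (d - c)| <=
    2 * m * (d - c).
  apply: sintB_le => //.
  - by apply: (rect_ver cf); rewrite lexx.
  - by apply: (rect_ver cf); rewrite lexx ab.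
  move=> x xab.
  have := H (a +i* x); rewrite /inrect/= xab lexx ab => /(_ isT) H2.
  have := H (b +i* x); rewrite /inrect/= xab lexx ab => /(_ isT) H3.
  have {}H2 := le_trans (normc_Im _) H2.
  have {}H3 := le_trans (normc_Im _) H3.
  set A := f _ in H2 *; set B := f _ in H3 *.
  move: A B u v p H2 H3 {H H1} => [A1 A2] [B1 B2] [u1 u2] [v1 v2] [p1 p2] /=.
  rewrite !ler_norml => /andP[H1 H2] /andP[H3 H4]; apply/andP; split; lra.
move: H1 H2; rewrite !ler_norml => /andP[H1 H2] /andP[H3 H4].
by apply/andP; split; lra.
Qed.

Lemma nested_segments (a b : nat -> R) :
  (forall n, a n <= a n.+1) -> (forall n, b n.+1 <= b n) ->
  (forall n, a n <= b n) -> exists x, forall n, a n <= x <= b n.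
Proof.
move=> aS bS ab.
have ah : {homo a : n m / (n <= m)%N >-> n <= m} by apply: homo_leq => //; exact: le_trans.
have bh : {homo b : n m / (n <= m)%N >-> m <= n}.
  apply: (@homo_leq _ b (fun x y => y <= x)) => // y x z yx zy.
  exact: le_trans zy yx.
have aub m : ubound (range a) (b m).
  move=> _ [n _ <-]; have [nm|/ltnW mn] := leqP n m.
    by rewrite (le_trans (ah _ _ nm)).
  by rewrite (le_trans (ab n))// bh.
exists (sup (range a)) => n; apply/andP; split.
  by apply: ub_le_sup; [exists (b 0%N); exact: aub|exists n].
by apply: ge_sup; [exists (a 0%N), 0%N|exact: aub].
Qed.

(* Area, plus one unit at least for every point of S in the closed rectangle;
   unlike the counting measure this is exactly additive under subdivision. *)
Definition rect_weight (S : seq R[i]) a b c d : R :=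
  (b - a) * (d - c) + \sum_(p <- S)
    (Num.sg (b - Re p) - Num.sg (a - Re p)) *
    (Num.sg (d - Im p) - Num.sg (c - Im p)).

Lemma rect_weight_splitx S a m b c d :
  rect_weight S a b c d = rect_weight S a m c d + rect_weight S m b c d.
Proof.
rewrite /rect_weight addrACA -big_split/=; congr (_ + _); first by ring.
by apply: eq_bigr => p _; ring.
Qed.

Lemma rect_weight_splity S a b c m d :
  rect_weight S a b c d = rect_weight S a b c m + rect_weight S a b m d.
Proof.
rewrite /rect_weight addrACA -big_split/=; congr (_ + _); first by ring.
by apply: eq_bigr => p _; ring.
Qed.

Lemma sg_jump_ge0 (a b x : R) : a <= b -> 0 <= Num.sg (b - x) - Num.sg (a - x).
Proof.
move=> ab; rewrite subr_ge0.
case: (sgrP (a - x)); case: (sgrP (b - x)); lra.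
Qed.

(** The jump is 2 at an interior point and 1 at an endpoint, because [Num.sg 0 = 0]; a point on a
    cut is thus shared equally by the two halves. *)
Lemma sg_jump_ge1 (a b x : R) : a < b -> a <= x <= b ->
  1 <= Num.sg (b - x) - Num.sg (a - x).
Proof.
by move=> ab /andP[ax xb]; case: (sgrP (a - x)); case: (sgrP (b - x)); lra.
Qed.

Lemma rect_weight_ge_area S a b c d : a <= b -> c <= d ->
  (b - a) * (d - c) <= rect_weight S a b c d.
Proof.
move=> ab cd; rewrite lerDl; apply: sumr_ge0 => p _.
by rewrite mulr_ge0// sg_jump_ge0.
Qed.

Lemma rect_weight_ge1 (S : seq R[i]) a b c d p : a < b -> c < d -> p \in S ->
  inrect a b c d p -> 1 <= rect_weight S a b c d.
Proof.
move=> ab cd pS /andP[pab pcd]; rewrite /rect_weight (big_rem p)//=.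
have H1 := sg_jump_ge1 ab pab; have H2 := sg_jump_ge1 cd pcd.
have : 0 <= \sum_(y <- rem p S) (Num.sg (b - Re y) - Num.sg (a - Re y)) *
    (Num.sg (d - Im y) - Num.sg (c - Im y)).
  by apply: sumr_ge0 => q _; rewrite mulr_ge0// sg_jump_ge0// ltW.
by nra.
Qed.

End Goursat.

(** * Goursat's theorem by bisection *)

Section GoursatTheorem.
Context {R : realType}.
Implicit Types (f : R[i] -> R[i]) (z p : R[i]) (a b c d : R).

(** The predicate is abstract because the bisection is run twice: on too large boundary integrals in
    [goursat] and on unboundedness in [rect_bounded]. Cutting one side at a time leaves only two
    halves to choose from. *)
Lemma rect_bisection (bad : R -> R -> R -> R -> Prop) a b c d :
  (forall a b c d, a < b -> c < d -> bad a b c d ->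
     bad a ((a + b) / 2) c d \/ bad ((a + b) / 2) b c d) ->
  (forall a b c d, a < b -> c < d -> bad a b c d ->
     bad a b c ((c + d) / 2) \/ bad a b ((c + d) / 2) d) ->
  a < b -> c < d -> bad a b c d ->
  exists p, forall n, exists a' b' c' d',
    [/\ bad a' b' c' d', inrect a' b' c' d' p,
        b' - a' = (b - a) / 2 ^+ n, d' - c' = (d - c) / 2 ^+ n &
        (forall z, inrect a' b' c' d' z -> inrect a b c d z)].
Proof.
move=> badx bady ab cd badq.
(* Nondegeneracy and badness are packed into the type, so that the choice function can be
   iterated. *)
pose T := {q : R * R * R * R |
  [/\ q.1.1.1 < q.1.1.2, q.1.2 < q.2 & bad q.1.1.1 q.1.1.2 q.1.2 q.2]}.
pose half (q q' : T) := [/\ (sval q).1.1.1 <= (sval q').1.1.1,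
  (sval q').1.1.2 <= (sval q).1.1.2, (sval q).1.2 <= (sval q').1.2,
  (sval q').2 <= (sval q).2 &
  (sval q').1.1.2 - (sval q').1.1.1 = ((sval q).1.1.2 - (sval q).1.1.1) / 2 /\
  (sval q').2 - (sval q').1.2 = ((sval q).2 - (sval q).1.2) / 2].
have step q : exists q', half q q'.
  case: q => -[[[a1 b1] c1] d1] /= [ab1 cd1 bad1].
  have [a2 [b2 [ab2 bad2 le1 le2 w]]] : exists a2 b2, [/\ a2 < b2,
      bad a2 b2 c1 d1, a1 <= a2, b2 <= b1 & b2 - a2 = (b1 - a1) / 2].
    case: (badx _ _ _ _ ab1 cd1 bad1) => H.
      by exists a1, ((a1 + b1) / 2); split => //; lra.
    by exists ((a1 + b1) / 2), b1; split => //; lra.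
  have [c2 [d2 [cd2 bad3 le3 le4 w']]] : exists c2 d2, [/\ c2 < d2,
      bad a2 b2 c2 d2, c1 <= c2, d2 <= d1 & d2 - c2 = (d1 - c1) / 2].
    case: (bady _ _ _ _ ab2 cd1 bad2) => H.
      by exists c1, ((c1 + d1) / 2); split => //; lra.
    by exists ((c1 + d1) / 2), d1; split => //; lra.
  have H : [/\ (a2, b2, c2, d2).1.1.1 < (a2, b2, c2, d2).1.1.2,
    (a2, b2, c2, d2).1.2 < (a2, b2, c2, d2).2 &
    bad (a2, b2, c2, d2).1.1.1 (a2, b2, c2, d2).1.1.2 (a2, b2, c2, d2).1.2
      (a2, b2, c2, d2).2] by [].
  by exists (exist _ (a2, b2, c2, d2) H).
have [F hF] := choice step.
have H0 : [/\ (a, b, c, d).1.1.1 < (a, b, c, d).1.1.2,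
    (a, b, c, d).1.2 < (a, b, c, d).2 &
    bad (a, b, c, d).1.1.1 (a, b, c, d).1.1.2 (a, b, c, d).1.2 (a, b, c, d).2].
  by [].
pose q0 : T := exist _ (a, b, c, d) H0.
pose q n := iter n F q0.
pose A n := (sval (q n)).1.1.1; pose B n := (sval (q n)).1.1.2.
pose C n := (sval (q n)).1.2; pose D n := (sval (q n)).2.
have hq n : [/\ A n <= A n.+1, B n.+1 <= B n, C n <= C n.+1, D n.+1 <= D n &
    B n.+1 - A n.+1 = (B n - A n) / 2 /\ D n.+1 - C n.+1 = (D n - C n) / 2].
  exact: (hF (q n)).
have hp n : [/\ A n < B n, C n < D n & bad (A n) (B n) (C n) (D n)].
  exact: (svalP (q n)).
have [x hx] := @nested_segments R A B (fun n => (let: And5 h _ _ _ _ := hq n in h))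
  (fun n => (let: And5 _ h _ _ _ := hq n in h))
  (fun n => (let: And3 h _ _ := hp n in ltW h)).
have [y hy] := @nested_segments R C D (fun n => (let: And5 _ _ h _ _ := hq n in h))
  (fun n => (let: And5 _ _ _ h _ := hq n in h))
  (fun n => (let: And3 _ h _ := hp n in ltW h)).
exists (x +i* y) => n; exists (A n), (B n), (C n), (D n).
have [_ _ hbad] := hp n.
split=> //.
- by rewrite /inrect/= hx hy.
- elim: n {hbad} => [|n IH]; first by rewrite expr0 divr1.
  have [_ _ _ _ [-> _]] := hq n; rewrite IH exprS invfM mulrA.
  by rewrite mulrAC.
- elim: n {hbad} => [|n IH]; first by rewrite expr0 divr1.
  have [_ _ _ _ [_ ->]] := hq n; rewrite IH exprS invfM mulrA.
  by rewrite mulrAC.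
- elim: n {hbad} => [|n IH] z; first by [].
  move=> /andP[/andP[H1 H2] /andP[H3 H4]]; apply: IH.
  have [H5 H6 H7 H8 _] := hq n.
  by rewrite /inrect (le_trans H5)// (le_trans H2)// (le_trans H7)// (le_trans H4).
Qed.

Lemma half_pow_lt (k e : R) : 0 < e -> exists n, k / 2 ^+ n < e.
Proof.
move=> e0; have [n hn] : exists n : nat, k / e < n%:R.
  exists (Num.truncn (k / e)).+1; exact: truncnS_gt.
exists n; rewrite ltr_pdivrMr ?exprn_gt0//.
move: hn; rewrite ltr_pdivrMr// => /lt_le_trans; apply.
rewrite mulrC ler_pM2l// -natrX ler_nat; exact/ltnW/ltn_expl.
Qed.

(** If the integral is nonzero, it exceeds [eta] times the weight of the rectangle. The integral and
    the weight are both additive, so one half inherits this, and so do arbitrarily small rectangles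
    around some point [p]. There the integral is too small: compared with the area when [f] is
    differentiable at [p], compared with the weight 1 of the point when [p] is in [S]. *)
Theorem goursat (S : seq R[i]) f a b c d : a < b -> c < d ->
  ccont_rect f a b c d ->
  (forall z, inrect a b c d z -> z \notin S -> exists l, cderiv f z l) ->
  bdry f a b c d = 0.
Proof.
move=> ab0 cd0 cf0 df0; apply/eqP; rewrite -normr_eq0 eq_le normr_ge0 andbT.
rewrite leNgt; apply/negP => I0.
have W0 : 0 < rect_weight S a b c d.
  rewrite (lt_le_trans _ (rect_weight_ge_area S (ltW ab0) (ltW cd0)))//.
  by rewrite mulr_gt0// subr_gt0.
(* The factor 1/2 makes the inequality [HI] strict. *)
pose eta := `|bdry f a b c d| / rect_weight S a b c d / 2.
have eta0 : 0 < eta by rewrite !divr_gt0.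
have HI : eta * rect_weight S a b c d < `|bdry f a b c d|.
  have -> : eta * rect_weight S a b c d = `|bdry f a b c d| / 2.
    by rewrite /eta; field; rewrite gt_eqF.
  by lra.
clearbody eta.
pose bad a b c d := ccont_rect f a b c d /\
  eta * rect_weight S a b c d < `|bdry f a b c d|.
have := @rect_bisection bad a b c d; case=> //.
- move=> {a b c d ab0 cd0 cf0 df0 I0 W0 HI} a b c d ab cd [cf H].
  set m := (a + b) / 2.
  have am : a <= m <= b by rewrite /m; lra.
  have cf1 : ccont_rect f a m c d.
    move=> z /andP[/andP[z1 z2] z3]; apply: cf; rewrite /inrect z1 z3 andbT/=.
    by rewrite (le_trans z2)//; lra.
  have cf2 : ccont_rect f m b c d.
    move=> z /andP[/andP[z1 z2] z3]; apply: cf; rewrite /inrect z2 z3 !andbT/=.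
    by rewrite (le_trans _ z1)//; lra.
  have [H1|H1] := ltP (eta * rect_weight S a m c d) `|bdry f a m c d|.
    by left.
  right; split => //; rewrite ltNge; apply/negP => H2.
  move: H; apply/negP; rewrite -leNgt.
  rewrite (rect_weight_splitx S a m b) (bdry_splitx am)// ?(ltW cd)//.
  by rewrite (le_trans (ler_normD _ _))// mulrDr lerD.
- move=> {a b c d ab0 cd0 cf0 df0 I0 W0 HI} a b c d ab cd [cf H].
  set m := (c + d) / 2.
  have am : c <= m <= d by rewrite /m; lra.
  have cf1 : ccont_rect f a b c m.
    move=> z /andP[z3 /andP[z1 z2]]; apply: cf; rewrite /inrect z1 z3/=.
    by rewrite (le_trans z2)//; lra.
  have cf2 : ccont_rect f a b m d.
    move=> z /andP[z3 /andP[z1 z2]]; apply: cf; rewrite /inrect z2 z3 !andbT/=.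
    by rewrite (le_trans _ z1)//; lra.
  have [H1|H1] := ltP (eta * rect_weight S a b c m) `|bdry f a b c m|.
    by left.
  right; split => //; rewrite ltNge; apply/negP => H2.
  move: H; apply/negP; rewrite -leNgt.
  rewrite (rect_weight_splity S a b c m) (bdry_splity am)// ?(ltW ab)//.
  by rewrite (le_trans (ler_normD _ _))// mulrDr lerD.
move=> p hp.
have [a1 [b1 [c1 [d1 [_ pr1 _ _ sub1]]]]] := hp 0%N.
have {sub1 pr1} pr := sub1 _ pr1.
pose L := (b - a) + (d - c).
have L0 : 0 < L by rewrite /L; lra.
have dist n a' b' c' d' z : inrect a' b' c' d' p -> inrect a' b' c' d' z ->
    b' - a' = (b - a) / 2 ^+ n -> d' - c' = (d - c) / 2 ^+ n ->
    normc (z - p) <= L / 2 ^+ n.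
  move=> /andP[/andP[p1 p2] /andP[p3 p4]] /andP[/andP[z1 z2] /andP[z3 z4]] e1 e2.
  rewrite /L mulrDl -e1 -e2 (le_trans (normc_le_ReIm _))//.
  case: z z1 z2 z3 z4 => z' z''; case: p p1 p2 p3 p4 {pr hp} => p' p'' /=.
  by move=> *; apply: lerD; rewrite ler_norml; apply/andP; split; lra.
(* At an exceptional point the weight stays at least 1, while continuity alone bounds the integral
   by twice the half perimeter, which tends to 0. *)
have [pS|pS] := boolP (p \in S).
  have [|del del0 hdel] := cf0 _ pr 1; first by [].
  pose m := Num.min del (eta / 4).
  have m0 : 0 < m by rewrite lt_min del0 divr_gt0.
  have [n hn] := half_pow_lt L m0.
  have [a' [b' [c' [d' [[cf' H] pr' e1 e2 sub]]]]] := hp n.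
  have ab' : a' < b' by rewrite -subr_gt0 e1 divr_gt0 ?exprn_gt0 ?subr_gt0.
  have cd' : c' < d' by rewrite -subr_gt0 e2 divr_gt0 ?exprn_gt0 ?subr_gt0.
  have := @bdry_affine_approx _ f a' b' c' d' (f p) 0 p 1 (ltW ab') (ltW cd') cf'.
  have hyp : forall z, inrect a' b' c' d' z -> normc (f z - f p - 0 * (z - p)) <= 1.
    move=> z zr; rewrite mul0r subr0; apply/ltW/hdel.
    rewrite (le_lt_trans (dist n _ _ _ _ _ pr' zr e1 e2))//.
    by move: hn; rewrite lt_min => /andP[].
  move=> /(_ hyp); rewrite e1 e2 -mulrDl -/L.
  have := rect_weight_ge1 ab' cd' pS pr'.
  move: hn; rewrite lt_min => /andP[_ hn] H1 H2.
  have : eta * 1 <= eta * rect_weight S a' b' c' d' by rewrite ler_pM2l.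
  by lra.
have [l hl] := df0 _ pr pS.
pose A := (b - a) * (d - c).
have A0 : 0 < A by rewrite /A mulr_gt0// subr_gt0.
(* Chosen so that the bound [2 * (e * l) * l] of [bdry_affine_approx], with [l = L / 2 ^+ n], is
   exactly [eta] times the area of the [n]-th rectangle. *)
pose e := eta * A / (2 * L ^+ 2).
have L20 : 0 < L ^+ 2 by exact: exprn_gt0.
have e0 : 0 < e by apply: divr_gt0; apply: mulr_gt0.
have [del del0 hdel] := hl _ e0.
have [n hn] := half_pow_lt L del0.
have [a' [b' [c' [d' [[cf' H] pr' e1 e2 sub]]]]] := hp n.
have ab' : a' < b' by rewrite -subr_gt0 e1 divr_gt0 ?exprn_gt0 ?subr_gt0.
have cd' : c' < d' by rewrite -subr_gt0 e2 divr_gt0 ?exprn_gt0 ?subr_gt0.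
have := @bdry_affine_approx _ f a' b' c' d' (f p) l p (e * (L / 2 ^+ n))
  (ltW ab') (ltW cd') cf'.
have hyp : forall z, inrect a' b' c' d' z ->
    normc (f z - f p - l * (z - p)) <= e * (L / 2 ^+ n).
  move=> z zr; have zd := dist n _ _ _ _ _ pr' zr e1 e2.
  rewrite (le_trans (hdel _ (le_lt_trans zd hn)))//.
  by rewrite ler_pM2l.
move=> /(_ hyp); rewrite e1 e2 -mulrDl -/L => H1.
have H2 := rect_weight_ge_area S (ltW ab') (ltW cd').
rewrite e1 e2 in H2.
have : eta * ((b - a) / 2 ^+ n * ((d - c) / 2 ^+ n)) <=
  eta * rect_weight S a' b' c' d' by rewrite ler_pM2l.
have -> : eta * ((b - a) / 2 ^+ n * ((d - c) / 2 ^+ n)) =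
    2 * (e * (L / 2 ^+ n)) * (L / 2 ^+ n).
  rewrite /e /A; field; rewrite ?expf_neq0 ?gt_eqF//.
by lra.
Qed.

End GoursatTheorem.

(** * Difference quotients and a weak maximum principle *)

Section ComplexDerivability.
Context {R : realType}.
Implicit Types (f g : R[i] -> R[i]) (z a : R[i]).

Definition cderivable f z := exists l, cderiv f z l.

Lemma cderivableP f z :
  cderivable f z <-> derivable (f : R[i]^o -> R[i]^o) z 1.
Proof.
split; first by move=> [l]; exact: cderiv_derivable.
exact: derivable_cderiv.
Qed.

Lemma cderivable_ccont f z : cderivable f z -> ccont f z.
Proof. by move=> [l]; exact: cderiv_ccont. Qed.

Lemma cderivable_cst c z : cderivable (fun=> c) z.
Proof. by apply/cderivableP; exact: derivable_cst. Qed.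

Lemma cderivable_id z : cderivable id z.
Proof. by apply/cderivableP; exact: derivable_id. Qed.

Lemma cderivableB f g z : cderivable f z -> cderivable g z ->
  cderivable (fun w => f w - g w) z.
Proof.
move=> /cderivableP hf /cderivableP hg; apply/cderivableP.
exact: (@derivableB R[i] R[i]^o R[i]^o f g z 1 hf hg).
Qed.

Lemma cderivableM f g z : cderivable f z -> cderivable g z ->
  cderivable (fun w => f w * g w) z.
Proof.
move=> /cderivableP hf /cderivableP hg; apply/cderivableP.
exact: (@derivableM R[i] R[i]^o f g z 1 hf hg).
Qed.

Lemma cderivableV f z : f z != 0 -> cderivable f z ->
  cderivable (fun w => (f w)^-1) z.
Proof.
move=> fz /cderivableP hf; apply/cderivableP.
exact: (@derivableV R[i] R[i]^o f z 1 fz hf).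
Qed.

Lemma ccontB f g z : ccont f z -> ccont g z -> ccont (fun w => f w - g w) z.
Proof.
move=> /ccontP cf /ccontP cg; apply/ccontP.
exact: (@continuousB R[i] R[i]^o R[i]^o f g z cf cg).
Qed.

Lemma ccontM f g z : ccont f z -> ccont g z -> ccont (fun w => f w * g w) z.
Proof.
move=> /ccontP cf /ccontP cg; apply/ccontP.
exact: (@continuousM R[i] R[i]^o f g z cf cg).
Qed.

Lemma ccont_near f g z (d : R) : 0 < d ->
  (forall w, normc (w - z) < d -> f w = g w) -> ccont f z -> ccont g z.
Proof.
move=> d0 fg cf e e0; have [d' d'0 H] := cf _ e0.
exists (Num.min d d'); first by rewrite lt_min d0.
move=> w; rewrite lt_min => /andP[wd wd'].
by rewrite -fg// -(fg z) ?subrr ?normc0//; exact: H.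
Qed.

Lemma cderivable_near f g z (d : R) : 0 < d ->
  (forall w, normc (w - z) < d -> f w = g w) -> cderivable f z -> cderivable g z.
Proof.
move=> d0 fg [l cf]; exists l => e e0; have [d' d'0 H] := cf _ e0.
exists (Num.min d d'); first by rewrite lt_min d0.
move=> w; rewrite lt_min => /andP[wd wd'].
by rewrite -fg// -(fg z) ?subrr ?normc0//; exact: H.
Qed.

(** With [l] the derivative of [f] at [a], the quotient is continuous at [a] and inherits
    differentiability elsewhere: exactly what [goursat] asks for when [a] is put into the
    exceptional set. *)
Definition diffquot f a l z := if z == a then l else (f z - f a) / (z - a).

Lemma diffquot_near f a l z : z != a -> exists2 d, 0 < d &
  forall w, normc (w - z) < d -> (f w - f a) * (w - a)^-1 = diffquot f a l w.
Proof.
move=> za; exists (normc (z - a)); first by rewrite normc_gt0 subr_eq0.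
move=> w wz; rewrite /diffquot; case: eqP => // wa; move: wz.
by rewrite wa normcB ltxx.
Qed.

Lemma diffquot_cderivable f a l z : z != a -> cderivable f z ->
  cderivable (diffquot f a l) z.
Proof.
move=> za df; have [d d0 H] := diffquot_near f l za.
apply: (cderivable_near d0 H); apply: cderivableM.
  by apply: cderivableB => //; exact: cderivable_cst.
apply: cderivableV; first by rewrite subr_eq0.
by apply: cderivableB; [exact: cderivable_id|exact: cderivable_cst].
Qed.

Lemma diffquot_ccont_off f a l z : z != a -> ccont f z ->
  ccont (diffquot f a l) z.
Proof.
move=> za df; have [d d0 H] := diffquot_near f l za.
apply: (ccont_near d0 H); apply: ccontM.
  apply: ccontB => //; apply: cderivable_ccont; exact: cderivable_cst.
apply: cderivable_ccont; apply: cderivableV; first by rewrite subr_eq0.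
by apply: cderivableB; [exact: cderivable_id|exact: cderivable_cst].
Qed.

Lemma diffquot_ccont_at f a l : cderiv f a l -> ccont (diffquot f a l) a.
Proof.
move=> df e e0; have [|d d0 H] := df (e / 2); first by rewrite divr_gt0.
exists d => // w wd; rewrite /diffquot eqxx.
case: eqVneq => [_|wa]; first by rewrite subrr normc0.
have := H _ wd.
have nw : 0 < normc (w - a) by rewrite normc_gt0 subr_eq0.
have -> : f w - f a - l * (w - a) = ((f w - f a) / (w - a) - l) * (w - a).
  by field; rewrite subr_eq0.
by rewrite normcM ler_pM2r// => /le_lt_trans; apply; lra.
Qed.

Lemma diffquot_ccont f a l z : cderiv f a l -> ccont f z ->
  ccont (diffquot f a l) z.
Proof.
have [->|za] := eqVneq z a; first by move=> + _; exact: diffquot_ccont_at.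
by move=> _; exact: diffquot_ccont_off.
Qed.

Lemma sintB_le_cst (f g : R -> R) (a b k : R) : a <= b ->
  contin f a b -> contin g a b ->
  (forall x, a <= x <= b -> f x - g x <= k) ->
  sint f a b - sint g a b <= k * (b - a).
Proof.
move=> ab cf cg H.
have fi := contin_integrable cf; have gi := contin_integrable cg.
rewrite -RintegralB// -(lebesgue_itv_cc ab) -Rintegral_cst//.
apply: le_Rintegral => //.
- exact: (integrableB _ fi gi).
- by apply: contin_integrable => x _; exact: cst_continuous.
Qed.

Lemma i_div (x y : R) : x +i* y != 0 ->
  'i / (x +i* y) = (y / (x ^+ 2 + y ^+ 2)) +i* (x / (x ^+ 2 + y ^+ 2)).
Proof.
move=> xy0; apply/eqP; rewrite eq_complex/=; apply/andP; split; apply/eqP; ring.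
Qed.

Lemma frac_ge_half (T s : R) : 0 < T -> - T <= s <= T ->
  (2 * T)^-1 <= T / (s ^+ 2 + T ^+ 2).
Proof.
move=> T0 /andP[sT Ts].
have : s ^+ 2 <= T ^+ 2 by nra.
have T20 : 0 < T ^+ 2 by rewrite exprn_gt0.
have s20 : 0 <= s ^+ 2 by rewrite sqr_ge0.
move=> H; rewrite ler_pdivlMr; last by lra.
rewrite mulrC ler_pdivrMr; nra.
Qed.

(* Integrate [- 'i * conj (g z0) * (g z - g z0) / (z - z0)] over the boundary:
   when [|g| < |g z0| / 2] there, all four contributions are negative. *)
Lemma square_max_principle (S : seq R[i]) g (x0 y0 T m : R) : 0 < T ->
  (forall z, ccont g z) -> (forall z, z \notin S -> cderivable g z) ->
  (x0 +i* y0) \notin S ->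
  (forall z, T <= `|Re z - x0| \/ T <= `|Im z - y0| ->
     inrect (x0 - T) (x0 + T) (y0 - T) (y0 + T) z -> normc (g z) <= m) ->
  normc (g (x0 +i* y0)) <= 2 * m.
Proof.
move=> T0 cg dg z0S gm; set z0 := x0 +i* y0 in z0S *.
rewrite leNgt; apply/negP => gz0.
have m0 : 0 <= m.
  rewrite (le_trans (normc_ge0 (g ((x0 + T) +i* y0))))// gm//=.
    by left; rewrite addrC addKr ger0_norm// ltW.
  by rewrite /inrect/=; lra.
set G := normc (g z0) in gz0.
have [l hl] := dg _ z0S.
pose F z := - 'i * conjc (g z0) * diffquot g z0 l z.
have cF z : ccont F z.
  apply: ccontM; first by apply: cderivable_ccont; exact: cderivable_cst.
  exact: diffquot_ccont.
have dF z : z \notin z0 :: S -> cderivable F z.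
  rewrite inE negb_or => /andP[zz0 zS].
  apply: cderivableM; first exact: cderivable_cst.
  by apply: diffquot_cderivable => //; exact: dg.
(* The main term is at least [G ^+ 2 / (2 * T)] on each side and the error at most [G * m / T]; [k]
   is their difference, positive precisely because [2 * m < G]. *)
pose k := G * (G - 2 * m) / (2 * T).
have G0 : 0 < G by lra.
have k0 : 0 < k by apply: divr_gt0; apply: mulr_gt0; lra.
have nz z : T <= `|Re z - x0| \/ T <= `|Im z - y0| -> T <= normc (z - z0).
  case: z => x y /= [|] H; apply: le_trans H _.
    exact: (normc_Re ((x +i* y) - z0)).
  exact: (normc_Im ((x +i* y) - z0)).
have FE z : T <= normc (z - z0) -> normc (g z) <= m ->
    normc (F z - (G ^+ 2)%:C * ('i / (z - z0))) <= G * m / T.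
  move=> Tz gzm.
  have zz0 : z - z0 != 0 by rewrite -normc_gt0 (lt_le_trans T0).
  rewrite /F /diffquot -subr_eq0 (negbTE zz0).
  have -> : (G ^+ 2)%:C = g z0 * conjc (g z0).
    by rewrite -sqr_normc normr_normc rmorphXn.
  have -> : - 'i * (g z0)^* * ((g z - g z0) / (z - z0)) -
      g z0 * (g z0)^* * ('i / (z - z0)) =
      - 'i * (g z0)^* * (g z / (z - z0)).
    move: (g z0) (g z) (z - z0) ('i : R[i]) (conjc (g z0)) zz0 => u2 u3 u4 u5 u1 u40.
    by field.
  rewrite !normcM normcN normcV normc_conjc.
  rewrite (_ : normc 'i = 1) ?mul1r; last by rewrite /= expr0n/= add0r expr1n sqrtr1.
  rewrite -/G -mulrA ler_pM2l// ler_pM ?normc_ge0 ?invr_ge0 ?normc_ge0//.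
  by rewrite lef_pV2// posrE (lt_le_trans T0).
have FB x y : T <= `|x - x0| \/ T <= `|y - y0| ->
    inrect (x0 - T) (x0 + T) (y0 - T) (y0 + T) (x +i* y) ->
    `|Re (F (x +i* y)) - G ^+ 2 * ((y - y0) / ((x - x0) ^+ 2 + (y - y0) ^+ 2))|
      <= G * m / T /\
    `|Im (F (x +i* y)) - G ^+ 2 * ((x - x0) / ((x - x0) ^+ 2 + (y - y0) ^+ 2))|
      <= G * m / T.
  move=> xy inr; have Tz := nz (x +i* y) xy.
  have := FE _ Tz (gm (x +i* y) xy inr).
  have zz0 : (x +i* y) - z0 != 0 by rewrite -normc_gt0 (lt_le_trans T0).
  rewrite (_ : _ - z0 = (x - x0) +i* (y - y0)) in zz0 *; last by [].
  rewrite i_div// => H.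
  have := le_trans (normc_Re _) H; have := le_trans (normc_Im _) H.
  move: (F _) => [F1 F2] /= H1 H2; split.
    by move: H2; rewrite [in X in X -> _]mul0r subr0.
  by move: H1; rewrite [in X in X -> _]mul0r addr0.
have ge_half s : - T <= s <= T -> G ^+ 2 / (2 * T) <= G ^+ 2 * (T / (s ^+ 2 + T ^+ 2)).
  by move=> sT; rewrite ler_pM2l ?exprn_gt0// frac_ge_half.
have kE : k = G ^+ 2 / (2 * T) - G * m / T by rewrite /k; field; rewrite gt_eqF.
have H0 : bdry F (x0 - T) (x0 + T) (y0 - T) (y0 + T) = 0.
  by apply: (@goursat _ (z0 :: S)); [lra|lra|by move=> z _; exact: cF|
    by move=> z _; exact: dF].
have cr : ccont_rect F (x0 - T) (x0 + T) (y0 - T) (y0 + T) by move=> z _; exact: cF.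
have H1 : sint (fun t => Re (F (t +i* (y0 - T)))) (x0 - T) (x0 + T) -
    sint (fun t => Re (F (t +i* (y0 + T)))) (x0 - T) (x0 + T) <=
    - (2 * k) * ((x0 + T) - (x0 - T)).
  apply: sintB_le_cst; first by lra.
  - by apply: (rect_hor cr); lra.
  - by apply: (rect_hor cr); lra.
  move=> x xT.
  have e1 : y0 - T - y0 = - T by ring.
  have e2 : y0 + T - y0 = T by ring.
  have [||+ _] := FB x (y0 - T).
  - by right; rewrite e1 normrN ger0_norm// ltW.
  - by rewrite /inrect/= xT; lra.
  have [||+ _] := FB x (y0 + T).
  - by right; rewrite e2 ger0_norm// ltW.
  - by rewrite /inrect/= xT; lra.
  rewrite e1 e2 sqrrN mulNr mulrN opprK !ler_norml => /andP[h1 h2] /andP[h3 h4].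
  have /ge_half : - T <= x - x0 <= T by lra.
  lra.
have H2 : sint (fun t => Im (F ((x0 - T) +i* t))) (y0 - T) (y0 + T) -
    sint (fun t => Im (F ((x0 + T) +i* t))) (y0 - T) (y0 + T) <=
    - (2 * k) * ((y0 + T) - (y0 - T)).
  apply: sintB_le_cst; first by lra.
  - by apply: (rect_ver cr); lra.
  - by apply: (rect_ver cr); lra.
  move=> x xT.
  have e1 : x0 - T - x0 = - T by ring.
  have e2 : x0 + T - x0 = T by ring.
  have [||_ +] := FB (x0 - T) x.
  - by left; rewrite e1 normrN ger0_norm// ltW.
  - by rewrite /inrect/= xT andbT; lra.
  have [||_ +] := FB (x0 + T) x.
  - by left; rewrite e2 ger0_norm// ltW.
  - by rewrite /inrect/= xT andbT; lra.
  rewrite e1 e2 sqrrN mulNr mulrN opprK !ler_norml => /andP[h1 h2] /andP[h3 h4].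
  have /ge_half : - T <= x - y0 <= T by lra.
  rewrite [_ + T ^+ 2]addrC; lra.
have : 0 < k * T by exact: mulr_gt0.
move: H0; rewrite /bdry; lra.
Qed.

End ComplexDerivability.

(** * Real zeros of entire functions *)

Section RealZeros.
Context {R : realType}.
Implicit Types (f g : R[i] -> R[i]) (z : R[i]).

(** Bisection plays the role of compactness: unboundedness passes to one half, hence to small
    rectangles around a point, where continuity contradicts it. *)
Lemma rect_bounded f (a b c d : R) : a < b -> c < d -> (forall z, ccont f z) ->
  exists M, forall z, inrect a b c d z -> normc (f z) <= M.
Proof.
move=> ab cd cf; apply: contrapT => nb.
pose bad a b c d := forall M, exists2 z, inrect a b c d z & M < normc (f z).
have H : bad a b c d.
  move=> M; apply: contrapT => H; apply: nb; exists M => z zr.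
  by rewrite leNgt; apply/negP => Mz; apply: H; exists z.
have [| |p hp] := rect_bisection _ _ ab cd H.
- move=> {a b c d ab cd nb H} a b c d ab cd H; apply: contrapT.
  move=> /not_orP[/existsNP[M1 H1] /existsNP[M2 H2]].
  have [z /andP[zr1 zr2] Mz] := H (Num.max M1 M2).
  have [h|/ltW h] := leP (Re z) ((a + b) / 2).
    apply: H1; exists z; last by rewrite (le_lt_trans _ Mz)// le_max lexx.
    by move/andP: zr1 => [zr1 _]; rewrite /inrect zr2 zr1 h.
  apply: H2; exists z; last by rewrite (le_lt_trans _ Mz)// le_max lexx orbT.
  by move/andP: zr1 => [_ zr1]; rewrite /inrect zr2 zr1 h.
- move=> {a b c d ab cd nb H} a b c d ab cd H; apply: contrapT.
  move=> /not_orP[/existsNP[M1 H1] /existsNP[M2 H2]].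
  have [z /andP[zr1 zr2] Mz] := H (Num.max M1 M2).
  have [h|/ltW h] := leP (Im z) ((c + d) / 2).
    apply: H1; exists z; last by rewrite (le_lt_trans _ Mz)// le_max lexx.
    by move/andP: zr2 => [zr2 _]; rewrite /inrect zr2 zr1 h.
  apply: H2; exists z; last by rewrite (le_lt_trans _ Mz)// le_max lexx orbT.
  by move/andP: zr2 => [_ zr2]; rewrite /inrect zr2 zr1 h.
have [|del del0 hdel] := cf p 1; first by [].
have [n hn] := half_pow_lt ((b - a) + (d - c)) del0.
have [a' [b' [c' [d' [bd pr e1 e2 _]]]]] := hp n.
have [z zr] := bd (normc (f p) + 1).
apply/negP; rewrite -leNgt.
have -> : f z = f p + (f z - f p) by ring.
rewrite (le_trans (normc_triangle _ _))// lerD2l; apply/ltW/hdel.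
apply: le_lt_trans hn; rewrite mulrDl -e1 -e2 (le_trans (normc_le_ReIm _))//.
move: pr zr => /andP[/andP[p1 p2] /andP[p3 p4]] /andP[/andP[z1 z2] /andP[z3 z4]].
case: z z1 z2 z3 z4 => z' z''; case: p p1 p2 p3 p4 {hp hdel} => p' p'' /=.
by move=> *; apply: lerD; rewrite ler_norml; apply/andP; split; lra.
Qed.

(** One factor is split off at a time by a difference quotient. Since [s] has no repetition, the
    factors already removed do not vanish at the next point, which is therefore a zero of the
    quotient. *)
Lemma divide_zeros f (s : seq R[i]) : (forall z, cderivable f z) -> uniq s ->
  (forall a, a \in s -> f a = 0) ->
  exists g, [/\ forall z, ccont g z, forall z, z \notin s -> cderivable g z &
    forall z, f z = g z * \prod_(a <- s) (z - a)].
Proof.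
move=> df; elim: s => [|a s IH] /=.
  move=> _ _; exists f; split => // z; last by rewrite big_nil mulr1.
  exact/cderivable_ccont/df.
move=> /andP[as_ us] fs.
have [|g [cg dg fg]] := IH us; first by move=> x xs; apply: fs; rewrite inE xs orbT.
have ga : g a = 0.
  have := fs a (mem_head _ _); rewrite fg => /eqP; rewrite mulf_eq0.
  move=> /orP[/eqP//|]; rewrite prodf_seq_eq0 => /hasP[b bs /=].
  by rewrite subr_eq0 => /eqP ab; rewrite ab bs in as_.
have [l hl] := dg _ as_; exists (diffquot g a l); split => z.
- exact: diffquot_ccont.
- rewrite inE negb_or => /andP[za zs]; apply: diffquot_cderivable => //.
  exact: dg.
rewrite fg big_cons mulrA; congr (_ * _).
rewrite /diffquot ga subr0; case: eqVneq => [->|za].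
  by rewrite subrr mulr0.
by rewrite divfK// subr_eq0.
Qed.

(* Divide by the factors [z - a]: each has modulus at least [4 L] on the boundary
   of the square, and at most [2 L] at [L i]. *)
Lemma entire_real_zeros_bound f (L : R) (s : seq R) : 0 < L ->
  (forall z, cderivable f z) -> uniq s ->
  (forall a, a \in s -> - L <= a <= L /\ f a%:C = 0) ->
  forall M, (forall z, inrect (0 - 5 * L) (0 + 5 * L) (L - 5 * L) (L + 5 * L) z ->
    normc (f z) <= M) ->
  normc (f (0 +i* L)) <= 2 * M / 2 ^+ size s.
Proof.
move=> L0 df us sz M fM.
have us' : uniq [seq a%:C | a <- s] by rewrite map_inj_uniq//; exact: complexI.
have [|g [cg dg fg]] := divide_zeros df us'.
  by move=> _ /mapP[a /sz[_ H] ->].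
have LT : 0 < 5 * L by rewrite mulr_gt0.
have M0 : 0 <= M.
  rewrite (le_trans (normc_ge0 (f (0 +i* L))))// fM// /inrect/=.
  by apply/andP; split; apply/andP; split; lra.
have prodE z : normc (\prod_(a <- [seq a%:C | a <- s]) (z - a)) =
    \prod_(a <- s) normc (z - a%:C).
  rewrite big_map; elim: s {sz us us' cg dg fg} => [|a s IH].
    by rewrite !big_nil normc1.
  by rewrite !big_cons normcM IH.
have szE (k : R) : \prod_(a <- s) k = k ^+ size s.
  by rewrite big_const_seq count_predT -Monoid.iteropE.
have L4 : 0 < (4 * L) ^+ size s by rewrite exprn_gt0// mulr_gt0.
have H : normc (g (0 +i* L)) <= 2 * (M / (4 * L) ^+ size s).
  apply: (@square_max_principle _ _ g 0 L (5 * L) _ LT cg dg).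
    apply/negP => /mapP[a _ /eqP]; rewrite eq_complex/= => /andP[_ /eqP].
    by move=> L00; move: L0; rewrite L00 ltxx.
  move=> z Tz inz; rewrite ler_pdivlMr//.
  rewrite (le_trans _ (fM _ inz))// fg normcM ler_wpM2l ?normc_ge0//.
  rewrite prodE -szE big_seq [leRHS]big_seq; apply: ler_prod => a /sz[ab _].
  rewrite mulr_ge0 ?(ltW L0)//=.
  have [h|h] : 4 * L <= `|Re (z - a%:C)| \/ 4 * L <= `|Im (z - a%:C)|.
    case: z Tz inz => x y /= [Tz _|Tz _].
      left; rewrite subr0 in Tz.
      have : `|x| <= `|x - a| + `|a| by rewrite -{1}(subrK a x) ler_normD.
      have : `|a| <= L by rewrite ler_norml.
      lra.
    right; rewrite oppr0 addr0.
    have : `|y - L| <= `|y| + `|L| by rewrite ler_normB.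
    rewrite (ger0_norm (ltW L0)); lra.
  - exact: le_trans h (normc_Re _).
  - exact: le_trans h (normc_Im _).
rewrite fg normcM prodE.
have H2 : \prod_(a <- s) normc ((0 +i* L) - a%:C) <= (2 * L) ^+ size s.
  rewrite -szE big_seq [leRHS]big_seq; apply: ler_prod => a /sz[ab _].
  apply/andP; split; first exact: normc_ge0.
  apply: le_trans (normc_le_ReIm _) _.
  rewrite /= sub0r normrN oppr0 addr0.
  have : `|a| <= L by rewrite ler_norml.
  rewrite (ger0_norm (ltW L0)); lra.
have pos : 0 <= \prod_(a <- s) normc ((0 +i* L) - a%:C).
  by apply: prodr_ge0 => a _; exact: normc_ge0.
apply: le_trans (ler_pM (normc_ge0 _) pos H H2) _.
have -> : (4 * L) ^+ size s = 2 ^+ size s * (2 * L) ^+ size s.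
  by rewrite -exprMn; congr (_ ^+ _); ring.
rewrite le_eqVlt; apply/orP; left; apply/eqP; field.
by rewrite !expf_neq0// ?mulf_neq0// gt_eqF.
Qed.

(** Infinitely many zeros in [[-L, L]] would give [normc (f (L i)) <= 2 * M / 2 ^+ k] for every [k],
    hence a zero at [L i], in the upper half-plane. *)
Lemma entire_real_zeros_countable f : (forall z, cderivable f z) ->
  (forall z, 0 < Im z -> f z != 0) -> countable [set x : R | f x%:C = 0].
Proof.
move=> df fz.
have fin (n : nat) : finite_set ([set x : R | f x%:C = 0] `&` `[- n.+1%:R, n.+1%:R]).
  apply: contrapT => inf.
  have L0 : 0 < n.+1%:R :> R by rewrite ltr0n.
  set L : R := n.+1%:R in inf L0.
  have [|||M hM] := @rect_bounded f (0 - 5 * L) (0 + 5 * L) (L - 5 * L) (L + 5 * L).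
  - by lra.
  - by lra.
  - by move=> z; exact/cderivable_ccont/df.
  have nz : 0 < normc (f (0 +i* L)) by rewrite normc_gt0; exact: fz.
  have [k hk] := half_pow_lt (2 * M) nz.
  have [B /= BA kB] := infinite_set_fset k inf.
  have : normc (f (0 +i* L)) <= 2 * M / 2 ^+ size (finmap.enum_fset B).
    apply: entire_real_zeros_bound => //; first exact: finmap.fset_uniq.
    move=> a aB.
    by have [/= h1] := BA a aB; rewrite in_itv/=.
  apply/negP; rewrite -ltNge; apply: le_lt_trans hk.
  have M0 : 0 <= M.
    rewrite (le_trans (normc_ge0 (f (0 +i* L))))// hM// /inrect/=.
    by apply/andP; split; apply/andP; split; lra.
  rewrite ler_wpM2l ?mulr_ge0// lef_pV2 ?posrE ?exprn_gt0//.
  by rewrite ler_eXn2l// ltr1n.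
rewrite (_ : [set x | _] = \bigcup_n ([set x : R | f x%:C = 0] `&`
    `[- n.+1%:R, n.+1%:R])).
  by apply: bigcup_countable => // n _; exact: finite_set_countable.
apply/seteqP; split => [x /= fx|x [n _ []]//].
exists (Num.truncn `|x|) => //; split => //=.
by rewrite in_itv/= -ler_norml; apply/ltW/truncnS_gt.
Qed.

End RealZeros.

(** * The Poisson formula in the half-plane *)

Section CauchyKernel.
Context {R : realType}.
Notation mu := (@lebesgue_measure R).

Lemma integralT_oneDsqr : (\int[mu]_t ((oneDsqr t)^-1)%:E = (pi : R)%:E)%E.
Proof.
rewrite ge0_symfun_integralT//.
- by rewrite -set_itvcy integral0y_oneDsqr -EFinM mulrC divfK.
- exact: continuous_oneDsqrV.
- by move=> t; rewrite /= /oneDsqr sqrrN.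
Qed.

Lemma integral_cauchy (x e : R) : 0 < e ->
  (\int[mu]_t (((t - x) ^+ 2 + e ^+ 2)^-1)%:E = (pi / e)%:E)%E.
Proof.
move=> e0.
pose F : R -> R := fun t => (t - x) / e.
have dF (t : R) : is_derive t (1 : R) F e^-1.
  rewrite /F; apply: is_derive_eq; rewrite /GRing.scale/=; ring.
have F'E : derive1 F = cst e^-1.
  by apply/funext => t; rewrite derive1E derive_val.
have := @increasing_ge0_integration_by_substitutionT R F (fun t => (oneDsqr t)^-1).
rewrite integralT_oneDsqr => H.
have {}H : (pi%:E = \int[mu]_t (e%:E * (((t - x) ^+ 2 + e ^+ 2)^-1)%:E))%E.
  rewrite H.
  - apply: eq_integral => t _; rewrite -EFinM; congr EFin; rewrite fctE F'E /F /oneDsqr/=.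
    field; rewrite !gt_eqF//.
    by rewrite ltr_wpDl ?sqr_ge0// exprn_gt0.
  - by move=> s t st; rewrite /F ltr_pM2r ?invr_gt0// ltrD2r.
  - by rewrite F'E; move=> ?; exact: cst_continuous.
  - by rewrite F'E; exact: is_cvg_cst.
  - by rewrite F'E; exact: is_cvg_cst.
  - by move=> t; exact: ex_derive.
  - by apply: gt0_cvgMlNy; rewrite ?invr_gt0//; exact: cvg_addrr_Ny.
  - by apply: gt0_cvgMly; rewrite ?invr_gt0//; exact: cvg_addrr.
  - exact: continuous_oneDsqrV.
  - by move=> t; rewrite invr_ge0.
have mq : measurable_fun setT (fun t : R => (((t - x) ^+ 2 + e ^+ 2)^-1)%:E).
  apply/measurable_EFinP; apply: continuous_measurable_fun => t.
  apply: cvgV; first by rewrite gt_eqF// ltr_wpDl ?sqr_ge0// exprn_gt0.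
  apply: cvgD; last exact: cvg_cst.
  apply: (@continuous_comp _ _ _ (fun t => t - x) (fun t => t ^+ 2)).
    by apply: cvgD; [exact: cvg_id|exact: cvg_cst].
  exact: exprn_continuous.
rewrite ge0_integralZl// in H.
  rewrite mulrC EFinM H muleA -EFinM mulVf ?gt_eqF// mul1e//.
- by move=> t _; rewrite lee_fin invr_ge0 addr_ge0 ?sqr_ge0.
- by rewrite lee_fin ltW.
Qed.

End CauchyKernel.

Section Poisson.
Context {R : realType}.
Notation mu := (@lebesgue_measure R).

Lemma sint_le (f : R -> R) (a b m : R) : a <= b -> contin f a b ->
  (forall x, a <= x <= b -> `|f x| <= m) -> `|sint f a b| <= m * (b - a).
Proof.
move=> ab cf H.
have c0 : contin (fun=> 0 : R) a b by move=> x _; exact: cst_continuous.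
have := @sintB_le R f (fun=> 0) a b 0 m ab cf c0.
rewrite [sint (fun=> 0) _ _]/sint Rintegral_cst// !mul0r !subr0; apply.
by move=> x /H; rewrite !subr0.
Qed.

Lemma measurable_cauchy (x e : R) : 0 < e ->
  measurable_fun setT (fun t : R => ((t - x) ^+ 2 + e ^+ 2)^-1).
Proof.
move=> e0; apply: continuous_measurable_fun => t.
apply: cvgV; first by rewrite gt_eqF// ltr_wpDl ?sqr_ge0// exprn_gt0.
apply: cvgD; last exact: cvg_cst.
apply: (@continuous_comp _ _ _ (fun t => t - x) (fun t => t ^+ 2)).
  by apply: cvgD; [exact: cvg_id|exact: cvg_cst].
exact: exprn_continuous.
Qed.

Lemma integrable_cauchy (x e : R) : 0 < e ->
  mu.-integrable setT (fun t : R => (((t - x) ^+ 2 + e ^+ 2)^-1)%:E).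
Proof.
move=> e0; apply/integrableP; split.
  by apply/measurable_EFinP; exact: measurable_cauchy.
under eq_integral => t _.
  rewrite gee0_abs; last by rewrite lee_fin invr_ge0 addr_ge0// sqr_ge0.
  over.
by rewrite integral_cauchy// ltry.
Qed.

Variables (u : R[i] -> R[i]) (x e : R).
Hypothesis e0 : 0 < e.
Hypothesis du : forall z, 0 < Im z -> cderivable u z.
Hypothesis u1 : forall z, 0 < Im z -> normc (u z) <= 1.

Let z0 : R[i] := x +i* e.
Let z0' : R[i] := x +i* - e.

Let F l (z : R[i]) : R[i] := diffquot u z0 l z * (z - z0')^-1.

Let z0'_neq (z : R[i]) : 0 <= Im z -> z != z0'.
Proof.
move=> z0I; apply/negP => /eqP zE; move: z0I e0; rewrite zE /z0' /=; lra.
Qed.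

Let F_ccont l (z : R[i]) : cderiv u z0 l -> 0 <= Im z -> ccont u z ->
  ccont (F l) z.
Proof.
move=> hl Iz uz; apply: ccontM; first exact: diffquot_ccont.
apply: cderivable_ccont; apply: cderivableV.
  by rewrite subr_eq0 z0'_neq.
by apply: cderivableB; [exact: cderivable_id|exact: cderivable_cst].
Qed.

Let F_cderivable l (z : R[i]) : 0 < Im z -> z != z0 -> cderivable (F l) z.
Proof.
move=> Iz zz0; apply: cderivableM; first by apply: diffquot_cderivable => //; exact: du.
apply: cderivableV; first by rewrite subr_eq0 z0'_neq// ltW.
by apply: cderivableB; [exact: cderivable_id|exact: cderivable_cst].
Qed.

(** The numerator is at most 2 since [u] is bounded by 1. As [k] bounds both squared distances from
    below, it also bounds the product of the two distances. *)
Let F_bound l (z : R[i]) (k : R) : 0 < Im z -> 0 < k ->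
  k <= normc (z - z0) ^+ 2 -> k <= normc (z - z0') ^+ 2 ->
  normc (F l z) <= 2 / k.
Proof.
move=> Iz k0 k1 k2.
have zz0 : z - z0 != 0.
  by apply/eqP => zz0; move: k1; rewrite zz0 normc0 expr0n/= leNgt k0.
have n0 : 0 < normc (z - z0) by rewrite normc_gt0.
have n0' : 0 < normc (z - z0') by rewrite normc_gt0 subr_eq0 z0'_neq// ltW.
rewrite /F /diffquot -subr_eq0 (negbTE zz0) !normcM !normcV.
have H : normc (u z - u z0) <= 2.
  rewrite (le_trans (normc_triangle _ _))//.
  have := u1 Iz; have := u1 (e0 : 0 < Im z0).
  by rewrite (_ : normc (- u z0) = normc (u z0)); [lra|exact: normcN].
rewrite -mulrA -invfM; apply: ler_pM => //.
- exact: normc_ge0.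
- by rewrite invr_ge0 mulr_ge0 ?normc_ge0.
rewrite lef_pV2 ?posrE ?mulr_gt0//.
rewrite -(@ler_pXn2r _ 2)// ?nnegrE ?(ltW k0)//; last by rewrite mulr_ge0 ?normc_ge0.
by rewrite exprMn expr2 ler_pM// ltW.
Qed.

Let F_real l (t : R) : Re (F l t%:C) = (Re (u t%:C) - Re (u z0)) *
  ((t - x) ^+ 2 + e ^+ 2)^-1.
Proof.
have tz0 : t%:C - z0 != 0.
  by rewrite subr_eq0; apply/eqP => -[_ /esym]; move: e0; lra.
rewrite /F /diffquot -subr_eq0 (negbTE tz0) -mulrA -invfM.
have -> : (t%:C - z0) * (t%:C - z0') = ((t - x) ^+ 2 + e ^+ 2)%:C.
  apply/eqP; rewrite eq_complex/=; apply/andP; split; apply/eqP; ring.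
rewrite -fmorphV; case: (u t%:C) (u z0) => [a b] [c d] /=.
by rewrite mulr0 subr0.
Qed.

(* [F], holomorphic off [z0], is the integrand [(u z - u z0) / ((z - z0) (z - z0'))]:
   on the real line the denominator becomes the Cauchy density, and [F] is
   [O(|z|^-2)] at infinity. *)
Lemma poisson (v : R -> R) (Z : set R) : measurable_fun setT v -> countable Z ->
  (forall t, ~ Z t -> ccont u t%:C /\ Re (u t%:C) = v t) ->
  mu.-integrable setT
    (fun t => ((v t - Re (u z0)) * ((t - x) ^+ 2 + e ^+ 2)^-1)%:E) /\
  (\int[mu]_t ((v t - Re (u z0)) * ((t - x) ^+ 2 + e ^+ 2)^-1)%:E = 0)%E.
Proof.
move=> mv cZ hv; have e0' := e0.
have [l hl] := du (e0 : 0 < Im z0).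
(* Since [2 * e <= T n], the top side is at distance at least [T n / 2] from [z0]. The bottom side,
   at height [del n <= e / 2], descends to the real line and stays at distance [e / 2] from the
   pole, so the dominating function is uniform in [n]. *)
pose T (n : nat) : R := 2 * e + 2 + n%:R.
pose del (n : nat) : R := e / n.+2%:R.
have n0 n : 0 <= n%:R :> R by [].
have Tpos n : 0 < T n by rewrite /T; have := n0 n; move: e0; lra.
have delpos n : 0 < del n by rewrite /del divr_gt0.
have dele n : del n <= e / 2.
  by rewrite /del ler_pM2l// lef_pV2 ?posrE// ler_nat.
have delT n : del n < T n.
  by have := dele n; have := n0 n; rewrite /T; move: e0; lra.
have cF z : 0 < Im z -> ccont (F l) z.
  by move=> Iz; apply: F_ccont; rewrite ?ltW//; exact/cderivable_ccont/du.
pose G n (t : R) := Re (F l (t +i* del n)).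
have cG n (t : R) : {for t, continuous (G n)}.
  by apply: ccont_re_hor; apply: cF => /=.
pose I n : set R := [set` `[x - T n, x + T n]].
pose f_ n t : \bar R := (G n \_ (I n) t)%:E.
pose q (t : R) := ((t - x) ^+ 2 + e ^+ 2)^-1.
have q0 (t : R) : 0 < (t - x) ^+ 2 + e ^+ 2.
  by rewrite ltr_wpDl ?sqr_ge0// exprn_gt0.
have sumI n : (\int[mu]_t f_ n t = (sint (G n) (x - T n) (x + T n))%:E)%E.
  have Gi : mu.-integrable (I n) (EFin \o G n) by apply: contin_integrable => t _; exact: cG.
  rewrite /sint /Rintegral fineK; last exact: integrable_fin_num.
  rewrite [RHS]integral_mkcond; apply: eq_integral => t _.
  by rewrite /f_ /patch; case: ifP.
have bndI n : `|sint (G n) (x - T n) (x + T n)| <= 32 / T n.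
  have Tn := Tpos n; have dT := delT n; have dp := delpos n.
  have T2 : 0 < T n ^+ 2 / 4 by rewrite divr_gt0// exprn_gt0.
  have Te : 2 * e <= T n by rewrite /T; have := n0 n; lra.
  have far z : 0 < Im z -> T n <= `|Re z - x| \/ T n <= Im z ->
      normc (F l z) <= 8 / T n ^+ 2.
    move=> Iz Tz.
    have -> : 8 / T n ^+ 2 = 2 / (T n ^+ 2 / 4) by field; rewrite gt_eqF.
    have Hx (r : R) : T n <= `|r| -> T n ^+ 2 <= r ^+ 2.
      move=> H; rewrite -[leRHS]real_normK ?num_real//.
      by rewrite ler_pXn2r ?nnegrE// ltW.
    apply: F_bound => //; rewrite sqr_normcE; case: z Iz Tz => a b /= b0.
    - case=> [/Hx H|H].
        by have := sqr_ge0 (b + - e); have := exprn_gt0 2 Tn; lra.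
      have := sqr_ge0 (a + - x) => ?.
      have : (T n / 2) ^+ 2 <= (b + - e) ^+ 2.
        by rewrite ler_pXn2r ?nnegrE//; lra.
      by rewrite expr_div_n; lra.
    - case=> [/Hx H|H].
        by have := sqr_ge0 (b + - - e); have := exprn_gt0 2 Tn; lra.
      have := sqr_ge0 (a + - x) => ?.
      have : (T n / 2) ^+ 2 <= (b + - - e) ^+ 2.
        by rewrite ler_pXn2r ?nnegrE//; lra.
      by rewrite expr_div_n; lra.
  have crF : ccont_rect (F l) (x - T n) (x + T n) (del n) (T n).
    move=> z /andP[_ /andP[Iz _]]; apply: cF; exact: lt_le_trans Iz.
  have := @goursat R [:: z0] (F l) (x - T n) (x + T n) (del n) (T n).
  have ab : x - T n < x + T n by lra.
  move=> /(_ ab dT crF) H.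
  have {H} : bdry (F l) (x - T n) (x + T n) (del n) (T n) = 0.
    apply: H => z /andP[_ /andP[Iz _]]; rewrite inE => zz0.
    by apply: F_cderivable => //; exact: lt_le_trans Iz.
  rewrite /bdry -/(G n).
  have top : `|sint (fun t => Re (F l (t +i* T n))) (x - T n) (x + T n)| <=
      8 / T n ^+ 2 * ((x + T n) - (x - T n)).
    apply: sint_le; [lra|by apply: (rect_hor crF); rewrite lexx ltW|].
    move=> t _; rewrite (le_trans (normc_Re _))// far//; right => //=.
  have lft : `|sint (fun t => Im (F l ((x - T n) +i* t))) (del n) (T n)| <=
      8 / T n ^+ 2 * (T n - del n).
    apply: sint_le; [lra|by apply: (rect_ver crF); rewrite lexx ltW|].
    move=> t /andP[dt _]; rewrite (le_trans (normc_Im _))// far//=.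
      exact: lt_le_trans dt.
    by left; rewrite addrAC subrr sub0r normrN ger0_norm// ltW.
  have rgt : `|sint (fun t => Im (F l ((x + T n) +i* t))) (del n) (T n)| <=
      8 / T n ^+ 2 * (T n - del n).
    apply: sint_le; [lra|by apply: (rect_ver crF); rewrite lexx andbT ltW|].
    move=> t /andP[dt _]; rewrite (le_trans (normc_Im _))// far//=.
      exact: lt_le_trans dt.
    by left; rewrite addrAC subrr add0r ger0_norm// ltW.
  have e1 : 8 / T n ^+ 2 * ((x + T n) - (x - T n)) = 16 / T n.
    by field; rewrite gt_eqF.
  have e2 : 8 / T n ^+ 2 * (T n - del n) <= 8 / T n.
    have -> : 8 / T n = 8 / T n ^+ 2 * T n by field; rewrite gt_eqF.
    by rewrite ler_pM2l ?divr_gt0 ?exprn_gt0//; lra.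
  have e3 : 32 / T n = 16 / T n + 8 / T n + 8 / T n by field; rewrite gt_eqF.
  move: top; rewrite e1 => top.
  have {}lft := le_trans lft e2; have {}rgt := le_trans rgt e2.
  rewrite e3; move: top lft rgt; clear.
  rewrite !ler_norml => /andP[? ?] /andP[? ?] /andP[? ?] ?.
  by apply/andP; split; lra.
(* From [del n <= e / 2], both squared distances are at least a quarter of [(t - x) ^+ 2 + e ^+ 2];
   the 8 is 2 divided by this quarter. *)
have bot n (t : R) : `|G n t| <= 8 * q t.
  have dp := delpos n; have de := dele n.
  have -> : 8 * q t = 2 / (((t - x) ^+ 2 + e ^+ 2) / 4).
    by rewrite /q; field; rewrite gt_eqF.
  rewrite (le_trans (normc_Re _))//; apply: F_bound => //.
  - by rewrite divr_gt0.
  - rewrite sqr_normcE/=; have := sqr_ge0 (t + - x).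
    have : (e / 2) ^+ 2 <= (del n + - e) ^+ 2.
      rewrite -[leRHS]sqrrN ler_pXn2r ?nnegrE//; move: e0; lra.
    by rewrite expr_div_n; lra.
  - rewrite sqr_normcE/=; have := sqr_ge0 (t + - x).
    have : e ^+ 2 <= (del n + - - e) ^+ 2.
      rewrite ler_pXn2r ?nnegrE//; move: e0; lra.
    have := sqr_ge0 e; lra.
pose f t : \bar R := ((v t - Re (u z0)) * q t)%:E.
have := @dominated_convergence _ _ R mu setT measurableT f_ f
  (fun t => (8 * q t)%:E).
case.
- move=> n; apply/measurable_EFinP; apply/(measurable_restrictT _ _).1 => //.
    exact: measurable_itv.
  apply: measurable_funTS; apply: continuous_measurable_fun => t; exact: cG.
- apply/measurable_EFinP; apply: measurable_funM; last exact: measurable_cauchy.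
  by apply: measurable_funB => //; exact: measurable_cst.
- exists Z; split; first exact: countable_measurable.
    exact: countable_lebesgue_measure0.
  move=> t /= H; apply: contrapT => nZt; apply: H => _.
  have [cu uE] := hv _ nZt.
  apply/fine_cvgP; split; first by apply: nearW.
  have cFt : ccont (F l) t%:C by apply: F_ccont.
  rewrite (_ : (v t - Re (u z0)) * q t = Re (F l t%:C)); last first.
    by rewrite F_real uE.
  apply/cvgrPdist_lt => ep ep0; have [d d0 hd] := cFt _ ep0.
  have [N1 hN1] : exists N : nat, e / d < N%:R.
    exists (Num.truncn (e / d)).+1; exact: truncnS_gt.
  have [N2 hN2] : exists N : nat, `|t - x| < N%:R.
    exists (Num.truncn `|t - x|).+1; exact: truncnS_gt.
  exists (maxn N1 N2) => // n /=; rewrite geq_max => /andP[n1 n2].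
  have tI : t \in I n.
    rewrite inE /I /= in_itv/= -ler_distlC distrC; apply/ltW.
    rewrite (lt_le_trans hN2)// /T.
    have : N2%:R <= n%:R :> R by rewrite ler_nat.
    lra.
  rewrite /= /patch tI /G -raddfB (le_lt_trans (normc_Re _))// normcB.
  apply: hd.
  have -> : (t +i* del n) - t%:C = (del n)%:C * 'i.
    by apply/eqP; rewrite eq_complex/=; apply/andP; split; apply/eqP; ring.
  rewrite normcM normc_real /= expr0n/= add0r expr1n sqrtr1 mulr1.
  rewrite ger0_norm ?(ltW (delpos n))// /del ltr_pdivrMr//.
  move: hN1; rewrite ltr_pdivrMr// mulrC => /lt_le_trans; apply.
  by rewrite ler_pM2l// ler_nat (leq_trans n1)// ltnW.
- rewrite (_ : (fun t => _) = (fun t => 8%:E * (q t)%:E)%E); last first.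
    by apply/funext => t; rewrite EFinM.
  by apply: integrableZl => //; exact: integrable_cauchy.
- apply: aeW => t n _ /=.
  rewrite lee_fin /patch; case: ifPn => _; first exact: bot.
  by rewrite normr0 mulr_ge0// invr_ge0 ltW.
move=> fi _ cvgf; split => //.
have cvg0 : (fun n => \int[mu]_t f_ n t)%E @ \oo --> (0 : \bar R)%E.
  apply/fine_cvgP; split; first by apply: nearW => n /=; rewrite sumI.
  apply/cvgrPdist_lt => ep ep0.
  have [N hN] : exists N : nat, 32 / ep < N%:R.
    exists (Num.truncn (32 / ep)).+1; exact: truncnS_gt.
  exists N => // n /= Nn; rewrite sumI /= sub0r normrN.
  rewrite (le_lt_trans (bndI n))// ltr_pdivrMr//.
  move: hN; rewrite ltr_pdivrMr// mulrC => /lt_le_trans; apply.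
  rewrite ler_pM2l// /T; have : N%:R <= n%:R :> R by rewrite ler_nat.
  lra.
exact: (cvg_unique _ cvgf cvg0).
Qed.

End Poisson.

Section MeasurableInverse.
Context {R : realType}.

(** Because [0^-1 = 0], inversion is the extension by zero of its continuous restriction to the open
    set [[set~ 0]]. *)
Lemma measurable_invr : measurable_fun setT (fun x : R => x^-1).
Proof.
have -> : (fun x : R => x^-1) = (fun x => (x^-1 * (x != 0)%:R)).
  by apply/funext => x; case: eqVneq => [->|_]; rewrite ?invr0 ?mul0r ?mulr1.
have -> : (fun x : R => x^-1 * (x != 0)%:R) = ((fun x : R => x^-1 : R) \_ [set~ 0]).
  apply/funext => x; rewrite /patch; case: ifPn.
    by move=> /set_mem/= /eqP ->; rewrite mulr1.
  by rewrite notin_setE/= => /contrapT ->; rewrite eqxx mulr0.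
apply/(measurable_restrictT _ _).1.
  by apply: measurableC.
apply: open_continuous_measurable_fun; first by apply: closed_openC; exact: closed_eq.
by move=> x; rewrite inE/= => /eqP x0; apply: cvgV.
Qed.

Lemma measurable_funV d (T : measurableType d) (f : T -> R) :
  measurable_fun setT f -> measurable_fun setT (fun x => (f x)^-1).
Proof. by move=> mf; exact: measurableT_comp measurable_invr mf. Qed.

End MeasurableInverse.

(** * The de Branges kernel *)

Section DeBrangesKernel.
Context {R : realType}.
Notation mu := (@lebesgue_measure R).
Variable E : R[i] -> R[i].
Hypothesis dE : forall z, cderivable E z.
Hypothesis hE : forall z, 0 < Im z -> normc (sharp E z) < normc (E z).

Definition dB_re (t : R) : R := Re (E t%:C).
Local Notation a := dB_re.
Definition dB_im (t : R) : R := Im (E t%:C).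
Local Notation b := dB_im.
Definition dB_nrm (t : R) : R := a t ^+ 2 + b t ^+ 2.
Local Notation nrm := dB_nrm.
(** The imaginary part of [E s * conjc (E t)]; it measures the phase difference of [E] between the
    two points. *)
Definition dB_wronsk (s t : R) : R := b s * a t - a s * b t.
Local Notation w := dB_wronsk.
(** The squared modulus of the kernel off the diagonal. On the diagonal and at real zeros of [E] it
    is 0 by [0^-1 = 0]. *)
Definition dB_kap (s t : R) : R :=
  w s t ^+ 2 * (pi ^+ 2 * (s - t) ^+ 2 * (nrm s * nrm t))^-1.
Local Notation kap := dB_kap.

Lemma dB_E_upper_neq0 (z : R[i]) : 0 < Im z -> E z != 0.
Proof. by move=> /hE H; rewrite -normc_gt0 (le_lt_trans _ H)// normc_ge0. Qed.

Lemma dB_sharp_real (t : R) : sharp E t%:C = conjc (E t%:C).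
Proof. by rewrite /sharp conjc_real. Qed.

Lemma cderiv_sharp (z l : R[i]) : cderiv E (conjc z) l ->
  cderiv (sharp E) z (conjc l).
Proof.
move=> H e e0; have [d d0 hd] := H _ e0; exists d => // v vz.
have vz' : normc (conjc v - conjc z) < d by rewrite -rmorphB normc_conjc.
have := hd _ vz'; rewrite -rmorphB normc_conjc; apply: le_trans.
by rewrite -[leRHS]normc_conjc !rmorphB rmorphM /= !rmorphB/= !conjcK.
Qed.

Lemma cderivable_sharp (z : R[i]) : cderivable (sharp E) z.
Proof. by have [l hl] := dE (conjc z); exists (conjc l); exact: cderiv_sharp. Qed.

Lemma dB_EE (t : R) : E t%:C = a t +i* b t.
Proof. by rewrite /dB_re /dB_im; case: (E _). Qed.

Lemma dB_mul_conj (t : R) : E t%:C * conjc (E t%:C) = (nrm t)%:C.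
Proof. by rewrite dB_EE; apply/eqP; rewrite eq_complex/=; apply/andP; split; apply/eqP; rewrite /dB_nrm; ring. Qed.

Lemma dB_nrm_ge0 t : 0 <= nrm t. Proof. by rewrite addr_ge0 ?sqr_ge0. Qed.

Lemma dB_nrm_eq0 t : (nrm t == 0) = (E t%:C == 0).
Proof.
by rewrite /dB_nrm paddr_eq0 ?sqr_ge0// !sqrf_eq0 dB_EE eq_complex.
Qed.

Lemma dB_numE (x y : R) : E x%:C * conjc (E y%:C) - sharp E x%:C * conjc (sharp E y%:C)
  = 2 * 'i * (w x y)%:C.
Proof.
rewrite !dB_sharp_real !dB_EE; apply/eqP; rewrite eq_complex /dB_wronsk/=.
by apply/andP; split; apply/eqP; ring.
Qed.

(** This product is the only way in which off-diagonal values enter a determinant of order 2. Where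
    a denominator vanishes, both sides are 0. *)
Lemma dB_kap_PiE_off (x y : R) : PiE_off E x y * PiE_off E y x = (kap x y)%:C.
Proof.
rewrite /PiE_off !dB_numE mulf_div.
have -> : 2 * 'i * (w x y)%:C * (2 * 'i * (w y x)%:C) = (4 * w x y ^+ 2)%:C.
  rewrite (_ : w y x = - w x y); last by rewrite /dB_wronsk; ring.
  by apply/eqP; rewrite eq_complex/=; apply/andP; split; apply/eqP; ring.
have -> : - 2%:R * (pi : R)%:C * 'i * (x - y)%:C * E x%:C * (E y%:C)^* *
   (- 2%:R * (pi : R)%:C * 'i * (y - x)%:C * E y%:C * (E x%:C)^*) =
   (4 * (pi ^+ 2 * (x - y) ^+ 2 * (nrm x * nrm y)))%:C.
  have -> : (4 * (pi ^+ 2 * (x - y) ^+ 2 * (nrm x * nrm y)))%:C =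
      4 * (pi%:C * pi%:C * ((x - y)%:C * (x - y)%:C) *
      (E x%:C * conjc (E x%:C) * (E y%:C * conjc (E y%:C)))).
    rewrite !dB_mul_conj; apply/eqP; rewrite eq_complex/=.
    by apply/andP; split; apply/eqP; ring.
  rewrite (_ : (y - x)%:C = - (x - y)%:C); last by rewrite -rmorphN opprB.
  have aux (p q r s r' s' i : R[i]) : i * i = -1 ->
      - 2%:R * p * i * q * r * s' * (- 2%:R * p * i * - q * s * r') =
      4 * (p * p * (q * q) * (r * r' * (s * s'))).
    move=> ii.
    transitivity ((- 4) * (i * i) * (p * p * (q * q) * (r * r' * (s * s')))).
      ring.
    by rewrite ii; ring.
  by apply: aux; rewrite -expr2; exact: sqr_i.
rewrite -fmorphV -rmorphM/=; congr (_%:C); rewrite /dB_kap.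
move: (w x y ^+ 2) (pi ^+ 2 * (x - y) ^+ 2 * (nrm x * nrm y)) => p q.
by rewrite invfM mulrACA divff ?mul1r.
Qed.

Lemma dB_kap_ge0 x y : 0 <= kap x y.
Proof.
apply: mulr_ge0; first exact: sqr_ge0.
rewrite invr_ge0; apply: mulr_ge0; apply: mulr_ge0;
  by [exact: sqr_ge0|exact: dB_nrm_ge0].
Qed.

Lemma dB_kap_sym x y : kap x y = kap y x.
Proof.
rewrite /dB_kap; congr (_ * _^-1); first by rewrite /dB_wronsk; ring.
by rewrite [nrm x * _]mulrC -[(x - y) ^+ 2]sqrrN opprB.
Qed.

(** Lagrange's identity: [nrm x * nrm y] is the squared wronskian plus another square. *)
Lemma dB_kap_le x y : kap x y * (x - y) ^+ 2 <= (pi ^+ 2)^-1.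
Proof.
have p0 : 0 < pi ^+ 2 :> R by rewrite exprn_gt0// pi_gt0.
have [xy|xy] := eqVneq (x - y) 0.
  by rewrite xy expr0n/= mulr0 invr_ge0 ltW.
have [n0|n0] := eqVneq (nrm x * nrm y) 0.
  by rewrite /dB_kap n0 mulr0 invr0 mulr0 mul0r invr_ge0 ltW.
have -> : kap x y * (x - y) ^+ 2 = w x y ^+ 2 / (nrm x * nrm y) * (pi ^+ 2)^-1.
  have := @pi_gt0 R; rewrite /dB_kap.
  move: (w x y) (x - y) xy (nrm x * nrm y) n0 (pi : R) => W d d0 q q0 p ppos.
  by field; rewrite d0 q0 gt_eqF.
apply: ler_piMl; first by rewrite invr_ge0 ltW.
rewrite ler_pdivrMr; last by rewrite lt_def n0 mulr_ge0 ?dB_nrm_ge0.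
rewrite mul1r.
have -> : nrm x * nrm y = w x y ^+ 2 + (a x * a y + b x * b y) ^+ 2.
  by rewrite /dB_nrm /dB_wronsk; ring.
by rewrite lerDl sqr_ge0.
Qed.

Lemma dB_cEre (t : R) : {for t, continuous a}.
Proof. exact/ccont_re_hor/cderivable_ccont/dE. Qed.

Lemma dB_cEim (t : R) : {for t, continuous b}.
Proof.
rewrite /continuous_at.
have -> : b = (fun t => Re (- 'i * E (t +i* 0))).
  by apply/funext => s; rewrite /dB_im; case: (E _) => p q /=; ring.
apply: (@ccont_re_hor _ (fun z => - 'i * E z)).
apply/cderivable_ccont/cderivableM => //; exact: cderivable_cst.
Qed.

Lemma measurable_dB_re : measurable_fun setT a.
Proof. by apply: continuous_measurable_fun => t; exact: dB_cEre. Qed.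

Lemma measurable_dB_im : measurable_fun setT b.
Proof. by apply: continuous_measurable_fun => t; exact: dB_cEim. Qed.

Lemma dB_measurable_kap : measurable_fun setT (fun p : R * R => kap p.1 p.2).
Proof.
have ma1 : measurable_fun setT (fun p : R * R => a p.1) by exact: measurableT_comp measurable_dB_re _.
have ma2 : measurable_fun setT (fun p : R * R => a p.2) by exact: measurableT_comp measurable_dB_re _.
have mb1 : measurable_fun setT (fun p : R * R => b p.1) by exact: measurableT_comp measurable_dB_im _.
have mb2 : measurable_fun setT (fun p : R * R => b p.2) by exact: measurableT_comp measurable_dB_im _.
apply: measurable_funM.
  by apply: measurable_funX; apply: measurable_funB; apply: measurable_funM.
apply: measurable_funV; apply: measurable_funM.
  apply: measurable_funM; first exact: measurable_cst.
  by apply: measurable_funX; apply: measurable_funB.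
by apply: measurable_funM; apply: measurable_funD; apply: measurable_funX.
Qed.

End DeBrangesKernel.

(** * The diagonal value of the kernel *)

Section Diagonal.
Context {R : realType}.
Variable E : R[i] -> R[i].
Hypothesis dE : forall z, cderivable E z.
Hypothesis hE : forall z, 0 < Im z -> normc (sharp E z) < normc (E z).
Variable x : R.
Hypothesis Ex0 : E x%:C != 0.

Local Notation c0 := (E x%:C).
Local Notation cb := (conjc (E x%:C)).

Lemma cb_neq0 : cb != 0. Proof. by rewrite conjc_eq0. Qed.

Let N (z : R[i]) : R[i] := E z * cb - c0 * sharp E z.

Lemma nrmx_gt0 : 0 < dB_nrm E x.
Proof. by rewrite lt_def dB_nrm_ge0 dB_nrm_eq0 Ex0. Qed.

(** If [l] is the derivative of [E] at [x], this function has derivative [l * cb - conjc (l * cb)],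
    which is purely imaginary. The single real number [m] expresses both the diagonal value of the
    kernel and the integral of [dB_kap]. *)
Lemma wronsk_cderiv : exists m : R,
  cderiv (fun z => E z * cb - c0 * sharp E z) x%:C (m%:C * 'i).
Proof.
have [l hl] := dE x%:C.
have hl' : cderiv (sharp E) x%:C (conjc l).
  by apply: cderiv_sharp; rewrite conjc_real.
exists (Im (l * cb - c0 * conjc l)).
have -> : (Im (l * cb - c0 * conjc l))%:C * 'i = l * cb - c0 * conjc l.
  apply/eqP; rewrite eq_complex; case: (c0) (l) => [p q] [r s] /=.
  by apply/andP; split; apply/eqP; ring.
move=> e e0.
have n0 : 0 < normc c0 by rewrite normc_gt0.
have e'0 : 0 < e / (2 * normc c0) by rewrite divr_gt0// mulr_gt0.
have [d d0 hd] := hl _ e'0; have [d' d'0 hd'] := hl' _ e'0.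
exists (Num.min d d') => [|w]; first by rewrite lt_min d0.
rewrite lt_min => /andP[/hd H /hd' H'].
have -> : E w * cb - c0 * sharp E w - (E x%:C * cb - c0 * sharp E x%:C) -
    (l * cb - c0 * conjc l) * (w - x%:C) =
    (E w - E x%:C - l * (w - x%:C)) * cb -
    c0 * (sharp E w - sharp E x%:C - conjc l * (w - x%:C)) by ring.
rewrite (le_trans (normc_triangle _ _))//.
rewrite (_ : normc (- (c0 * _)) = normc (c0 * (sharp E w - sharp E x%:C - conjc l * (w - x%:C)))); last exact: normcN.
rewrite !normcM normc_conjc.
have -> : e * normc (w - x%:C) = e / (2 * normc c0) * normc (w - x%:C) * normc c0 +
    normc c0 * (e / (2 * normc c0) * normc (w - x%:C)) by field; rewrite gt_eqF.
by apply: lerD; [rewrite ler_pM2r|rewrite ler_pM2l].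
Qed.

Variable m : R.
Hypothesis hm : cderiv N x%:C (m%:C * 'i).

Let Nx : N x%:C = 0.
Proof. by rewrite /N dB_sharp_real subrr. Qed.

Let D z := diffquot N x%:C (m%:C * 'i) z.

Let cD : ccont D x%:C. Proof. exact: diffquot_ccont_at. Qed.

(** A complex extension of [PiE_off E x] that is continuous at [x]; the punctured limit defining
    [PiE E x x] becomes its value there. *)
Let P (z : R[i]) : R[i] := - 1 * D z * (2 * pi%:C * 'i * c0 * sharp E z)^-1.

Let pi0 : pi%:C != 0 :> R[i].
Proof. by rewrite eq_complex /= eqxx andbT gt_eqF ?pi_gt0. Qed.

Let i0 : 'i != 0 :> R[i].
Proof. by rewrite eq_complex /= oner_eq0 andbF. Qed.

Let cP : ccont P x%:C.
Proof.
apply: ccontM; first by apply: ccontM => //; apply/cderivable_ccont/cderivable_cst.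
apply/cderivable_ccont/cderivableV.
  rewrite dB_sharp_real !mulf_neq0// ?cb_neq0//.
by apply: cderivableM; [exact: cderivable_cst|exact: cderivable_sharp].
Qed.

Let P_PiE_off (y : R) : y != x -> PiE_off E x y = P y%:C.
Proof.
move=> yx; rewrite /P /D /diffquot.
rewrite (_ : (y%:C == x%:C) = false); last first.
  by apply/negbTE; apply: contra yx => /eqP[->].
rewrite Nx subr0 /PiE_off /N !dB_sharp_real conjcK.
have -> : (x - y)%:C = - (y%:C - x%:C) by rewrite rmorphB opprB.
have aux (a b e e' p d i : R[i]) :
    (a * e' - b * e) / (- 2%:R * p * i * - d * a * e') =
    - 1 * ((e * b - a * e') / d) * (2 * p * i * a * e')^-1.
  have -> : - 2%:R * p * i * - d * a * e' = d * (2 * p * i * a * e') by ring.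
  by rewrite invfM; ring.
exact: aux.
Qed.

Lemma PiE_diag : PiE E x x = (- m / (2 * pi * dB_nrm E x))%:C.
Proof.
have Px : P x%:C = (- m / (2 * pi * dB_nrm E x))%:C.
  rewrite /P /D /diffquot eqxx dB_sharp_real -[_ * c0 * cb]mulrA dB_mul_conj.
  rewrite rmorphM fmorphV !rmorphM rmorphN/= rmorph_nat.
  move: (pi%:C) pi0 ('i : R[i]) i0 (m%:C) => p p0 i ii mm.
  have : (dB_nrm E x)%:C != 0 :> R[i].
    by rewrite eq_complex/= eqxx andbT gt_eqF ?nrmx_gt0.
  by move: ((dB_nrm E x)%:C) => n nn; field; rewrite ?p0 ?ii ?nn.
rewrite /PiE eqxx /=; apply: (@cvg_lim R[i]^o).
  exact: norm_hausdorff.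
rewrite -Px => A /nbhs_normc[e e0 eA]; have [d d0 hd] := cP e0.
suff : nbhs x (fun y => y != x -> A (PiE_off E x y)) by [].
apply/nbhs_ballP; exists d => //= y; rewrite -ball_normE/= => xy yx.
apply: eA; rewrite P_PiE_off//; apply: hd.
by rewrite -rmorphB normc_real distrC.
Qed.

End Diagonal.

(** * The reproducing property from the Poisson formula *)

Section Reproducing.
Context {R : realType}.
Notation mu := (@lebesgue_measure R).
Variable E : R[i] -> R[i].
Hypothesis dE : forall z, cderivable E z.
Hypothesis hE : forall z, 0 < Im z -> normc (sharp E z) < normc (E z).
Variable x : R.
Hypothesis Ex0 : E x%:C != 0.

Local Notation c0 := (E x%:C).
Local Notation cb := (conjc (E x%:C)).

Let N (z : R[i]) : R[i] := E z * cb - c0 * sharp E z.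

Variable m : R.
Hypothesis hm : cderiv N x%:C (m%:C * 'i).

(* [u x = 1] and [1 - Re u = h] on the real line, where [dB_kap E x t] is
   [h t * (t - x) ^- 2 / (2 * pi ^+ 2)]. *)
Let u (z : R[i]) : R[i] := c0 * sharp E z * (cb * E z)^-1.
Let h (t : R) : R := 2 * dB_wronsk E x t ^+ 2 * (dB_nrm E x * dB_nrm E t)^-1.
(** In the upper half-plane this is [(1 - u z) / (z - x)]; it is continuous at [x], where its value
    carries the derivative [m]. *)
Let M (z : R[i]) : R[i] := diffquot N x%:C (m%:C * 'i) z * (E z * cb)^-1.

Let cb0 : cb != 0. Proof. by rewrite conjc_eq0. Qed.

Let du z : 0 < Im z -> cderivable u z.
Proof.
move=> z0; apply: cderivableM.
  by apply: cderivableM; [exact: cderivable_cst|exact: cderivable_sharp].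
apply: cderivableV; first by rewrite mulf_neq0// dB_E_upper_neq0.
by apply: cderivableM; [exact: cderivable_cst|exact: dE].
Qed.

Let u1 z : 0 < Im z -> normc (u z) <= 1.
Proof.
move=> z0; rewrite /u !normcM normcV normcM normc_conjc.
have Ez : 0 < normc (E z) by rewrite normc_gt0 dB_E_upper_neq0.
have n0 : 0 < normc c0 by rewrite normc_gt0.
rewrite ler_pdivrMr ?mulr_gt0// mul1r ler_pM2l//; exact/ltW/hE.
Qed.

Let h_ge0 t : 0 <= h t.
Proof.
apply: mulr_ge0; first by apply: mulr_ge0 => //; exact: sqr_ge0.
by rewrite invr_ge0 mulr_ge0 ?dB_nrm_ge0.
Qed.

Let measurable_h : measurable_fun setT h.
Proof.
have ma := measurable_dB_re dE; have mb := measurable_dB_im dE.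
apply: measurable_funM.
  apply: measurable_funM => //; apply: measurable_funX.
  by apply: measurable_funB; apply: measurable_funM.
apply: measurable_funV; apply: measurable_funM => //.
by apply: measurable_funD; apply: measurable_funX.
Qed.

(** On the real line [u] is the square of [c0 * conjc (E t)] over its squared modulus, so [1 - Re u]
    is twice the squared sine of the phase difference. *)
Let u_real t : E t%:C != 0 -> ccont u t%:C /\ Re (u t%:C) = 1 - h t.
Proof.
move=> Et0; split.
  apply: cderivable_ccont; apply: cderivableM.
    by apply: cderivableM; [exact: cderivable_cst|exact: cderivable_sharp].
  apply: cderivableV; first by rewrite mulf_neq0.
  by apply: cderivableM; [exact: cderivable_cst|exact: dE].
have nx : 0 < dB_nrm E x by exact: nrmx_gt0.
have nt : 0 < dB_nrm E t by exact: nrmx_gt0.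
have -> : u t%:C = (c0 * conjc (E t%:C)) ^+ 2 *
    ((dB_nrm E x * dB_nrm E t)^-1)%:C.
  rewrite /u dB_sharp_real (_ : ((_ * _)^-1)%:C =
    (c0 * cb * (E t%:C * conjc (E t%:C)))^-1); last first.
    by rewrite !dB_mul_conj -rmorphM fmorphV.
  have Et' : conjc (E t%:C) != 0 by rewrite conjc_eq0.
  have aux (a b p q : R[i]) : a != 0 -> b != 0 -> p != 0 -> q != 0 ->
      a * q * (b * p)^-1 = (a * q) ^+ 2 * (a * b * (p * q))^-1.
    by move=> a0 b0 p0 q0; field; rewrite a0 b0 p0 q0.
  exact: aux.
have Rer (z : R[i]) (r : R) : Re (z * r%:C) = Re z * r.
  by case: z => p q /=; ring.
rewrite Rer.
have -> : Re ((c0 * conjc (E t%:C)) ^+ 2) =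
    dB_nrm E x * dB_nrm E t - 2 * dB_wronsk E x t ^+ 2.
  rewrite expr2 /dB_nrm /dB_wronsk /dB_re /dB_im.
  by case: (c0) (E t%:C) => [p q] [r s] /=; ring.
rewrite /h; move: nx nt; move: (dB_nrm E x) (dB_nrm E t) => p q p0 q0.
by field; rewrite !gt_eqF.
Qed.

(** The left side is the Poisson integral of [h] up to the factor [pi]; the right side is continuous
    down to [e = 0]. *)
Let u_upper (e : R) : 0 < e -> (1 - Re (u (x +i* e))) / e = - Im (M (x +i* e)).
Proof.
move=> e0.
have Ez : E (x +i* e) != 0 by exact: dB_E_upper_neq0.
have zx : x +i* e - x%:C = e%:C * 'i.
  by apply/eqP; rewrite eq_complex/=; apply/andP; split; apply/eqP; ring.
have zx0 : x +i* e - x%:C != 0.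
  rewrite zx mulf_neq0//; first by rewrite eq_complex/= eqxx andbT gt_eqF.
  by rewrite eq_complex/= oner_eq0 andbF.
have H : 1 - u (x +i* e) = M (x +i* e) * (e%:C * 'i).
  have NE : N x%:C = 0 by rewrite /N dB_sharp_real subrr.
  rewrite /M /diffquot -subr_eq0 (negbTE zx0) NE subr0 -zx /u /N.
  have aux (a b p q s : R[i]) : b != 0 -> p != 0 -> q != 0 ->
      1 - a * s * (b * q)^-1 = (q * b - a * s) / p * (q * b)^-1 * p.
    by move=> b0 p0 q0; field; rewrite b0 p0 q0.
  exact: aux.
have -> : 1 - Re (u (x +i* e)) = Re (1 - u (x +i* e)) by rewrite raddfB.
rewrite H; case: (M _) => p q /=; field; rewrite gt_eqF//.
Qed.

Let cM : ccont M x%:C.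
Proof.
apply: ccontM; first exact: diffquot_ccont_at.
apply/cderivable_ccont/cderivableV; first by rewrite mulf_neq0.
by apply: cderivableM; [exact: dE|exact: cderivable_cst].
Qed.

Let Mx : - Im (M x%:C) = - m / dB_nrm E x.
Proof.
rewrite /M /diffquot eqxx dB_mul_conj -fmorphV.
by move: (dB_nrm E x)^-1 => r /=; ring.
Qed.

Let zeros := [set t : R | E t%:C = 0].

Let poisson_h (e : R) : 0 < e ->
  (\int[mu]_t ((h t) * ((t - x) ^+ 2 + e ^+ 2)^-1)%:E =
   (pi * - Im (M (x +i* e)))%:E)%E.
Proof.
move=> e0.
have cZ : countable zeros.
  by apply: entire_real_zeros_countable => // z; exact: dB_E_upper_neq0.
have mv : measurable_fun setT (fun t => 1 - h t) by exact: measurable_funB.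
have [|fi f0] := @poisson R u x e e0 du u1 _ zeros mv cZ.
  by move=> t /eqP Et; exact: u_real.
have qi := integrable_cauchy x e0.
transitivity (\int[mu]_t
    ((1 - Re (u (x +i* e)))%:E * (((t - x) ^+ 2 + e ^+ 2)^-1)%:E -
    ((1 - h t - Re (u (x +i* e))) * ((t - x) ^+ 2 + e ^+ 2)^-1)%:E))%E.
  by apply: eq_integral => t _; rewrite -EFinM -EFinB; congr EFin; ring.
rewrite integralB//; last exact: integrableZl.
rewrite f0 sube0 integralZl// integral_cauchy// -EFinM; congr EFin.
rewrite -u_upper//; ring.
Qed.

Lemma kap_integral :
  (\int[mu]_t (dB_kap E x t)%:E = (- m / (2 * pi * dB_nrm E x))%:E)%E.
Proof.
pose e n : R := n.+1%:R^-1.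
have e0 n : 0 < e n by rewrite invr_gt0.
pose g n (t : R) := ((h t) * ((t - x) ^+ 2 + e n ^+ 2)^-1)%:E.
have mg n : measurable_fun setT (g n).
  apply/measurable_EFinP; apply: measurable_funM => //; exact: measurable_cauchy.
have g0 n t : setT t -> (0 <= g n t)%E.
  by move=> _; rewrite lee_fin mulr_ge0// invr_ge0 addr_ge0 ?sqr_ge0.
have ndg t : setT t -> nondecreasing_seq (g ^~ t).
  move=> _ n n' nn'; rewrite lee_fin ler_wpM2l// lef_pV2 ?posrE ?ltr_wpDl ?sqr_ge0 ?exprn_gt0//.
  rewrite lerD2l ler_pXn2r ?nnegrE ?(ltW (e0 _))//.
  by rewrite lef_pV2 ?posrE// ler_nat.
(* The Cauchy densities increase to [(t - x) ^- 2] as [e] decreases. Monotone convergence yields the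
   finiteness of the limit integral along with its value. *)
have := @cvg_monotone_convergence _ _ _ mu setT measurableT g mg g0 ndg.
have e_to0 (d : R) : 0 < d -> \forall n \near \oo, e n < d.
  move=> d0; exists (Num.truncn d^-1) => // n /= nd.
  rewrite /e -[ltRHS]invrK ltf_pV2 ?posrE ?invr_gt0//.
  by rewrite (lt_le_trans (truncnS_gt _))// ler_nat ltnS.
have -> : (\int[mu]_t limn (g ^~ t) = \int[mu]_t (h t * ((t - x) ^+ 2)^-1)%:E)%E.
  apply: eq_integral => t _; apply/cvg_lim => //.
  have [->|tx] := eqVneq t x.
    (* At [t = x] the densities blow up, but [h x = 0] makes the whole sequence zero. *)
    have hx : h x = 0 by rewrite /h /dB_wronsk [X in X - _]mulrC subrr expr0n/= mulr0 mul0r.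
    rewrite /g hx; under eq_fun do rewrite mul0r.
    by rewrite mul0r; exact: cvg_cst.
  apply/fine_cvgP; split; first exact: nearW.
  apply: cvgM; first exact: cvg_cst.
  apply: cvgV; first by rewrite sqrf_eq0 subr_eq0.
  rewrite -[X in _ --> X]addr0; apply: cvgD; first exact: cvg_cst.
  have sq0 : (0 : R) = 0 ^+ 2 by rewrite expr0n.
  rewrite [X in _ --> X]sq0.
  apply: (@cvg_comp _ _ _ e (fun r => r ^+ 2) _ (nbhs (0 : R))).
    by apply/cvgr0Pnorm_lt => d d0; near do rewrite gtr0_norm//; exact: e_to0.
  exact: exprn_continuous.
move=> H.
have {H} Hint : (\int[mu]_t (h t * ((t - x) ^+ 2)^-1)%:E =
    (pi * - Im (M x%:C))%:E)%E.
  suff H2 : (fun n => \int[mu]_t g n t)%E @ \oo --> (pi * - Im (M x%:C))%:E.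
    exact: (cvg_unique _ H H2).
  apply/fine_cvgP; split; first by apply: nearW => n /=; rewrite poisson_h.
  apply/cvgrPdist_lt => d d0.
  have d1 : 0 < d / pi by rewrite divr_gt0// pi_gt0.
  have [d' d'0 hd'] := cM d1.
  near=> n; rewrite /= poisson_h//= -mulrBr normrM (gtr0_norm (pi_gt0 R)).
  rewrite -ltr_pdivlMl ?pi_gt0// mulrC opprK addrC -raddfB.
  rewrite (le_lt_trans (normc_Im _))//; apply: hd'.
  have -> : x +i* e n - x%:C = (e n)%:C * 'i.
    by apply/eqP; rewrite eq_complex/=; apply/andP; split; apply/eqP; ring.
  rewrite normcM normc_real /= expr0n/= add0r expr1n sqrtr1 mulr1.
  by rewrite gtr0_norm//; near: n; exact: e_to0.
have kE t : dB_kap E x t = (2 * pi ^+ 2)^-1 * (h t * ((t - x) ^+ 2)^-1).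
  rewrite /dB_kap /h -[(x - t) ^+ 2]sqrrN opprB.
  move: (dB_wronsk _ _ _ ^+ 2) ((t - x) ^+ 2) (dB_nrm _ _ * dB_nrm _ _) (pi ^+ 2).
  move=> W d q p; rewrite !invfM.
  transitivity (2^-1 * 2 * (W * (p^-1 * d^-1 * q^-1))); last by ring.
  by rewrite mulVf ?mul1r.
transitivity (\int[mu]_t
   (((2 * pi ^+ 2)^-1)%:E * (h t * ((t - x) ^+ 2)^-1)%:E))%E.
  by apply: eq_integral => t _; rewrite kE EFinM.
rewrite ge0_integralZl//; last 3 first.
- apply/measurable_EFinP; apply: measurable_funM => //; apply: measurable_funV.
  by apply: measurable_funX; apply: measurable_funB.
- by move=> t _; rewrite lee_fin mulr_ge0// invr_ge0 sqr_ge0.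
- by rewrite lee_fin invr_ge0 mulr_ge0// sqr_ge0.
rewrite Hint Mx -EFinM; congr EFin.
have := nrmx_gt0 Ex0; have := pi_gt0 R.
by move: (dB_nrm E x) (pi : R) => n p p0 n0; field; rewrite !gt_eqF.
Unshelve. all: by end_near. Qed.

End Reproducing.

(** Everything that the probabilistic argument uses about [E], in terms of two real functions. *)
Theorem de_branges_kernel (R : realType) (E : R[i] -> R[i]) : de_branges E ->
  exists (k : R -> R) (kap : R -> R -> R),
  [/\ (forall x, PiE E x x = (k x)%:C),
      (forall x y, x != y -> PiE E x y * PiE E y x = (kap x y)%:C),
      measurable_fun setT (fun p : R * R => kap p.1 p.2) &
      [/\ forall x y, 0 <= kap x y, forall x y, kap x y = kap y x,
          forall x y, kap x y * (x - y) ^+ 2 <= (pi ^+ 2)^-1 &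
          forall x, (\int[@lebesgue_measure R]_t (kap x t)%:E = (k x)%:E)%E]].
Proof.
move=> [entE hE0].
have dE z : cderivable E z by apply/cderivableP; exact: entE.
have hE z : 0 < Im z -> normc (sharp E z) < normc (E z).
  by move=> z0; have := hE0 z z0; rewrite !normr_normc ltcR.
have H x : exists k, PiE E x x = k%:C /\
    (\int[@lebesgue_measure R]_t (dB_kap E x t)%:E = k%:E)%E.
  (* At a real zero of [E], division by zero makes [PiE_off E x] and [dB_kap E x] identically 0, and
     [k = 0] fits both identities. *)
  have [Ex0|Ex0] := eqVneq (E x%:C) 0.
    exists 0; split.
      rewrite /PiE eqxx/=.
      rewrite (_ : PiE_off E x = fun=> 0); last first.
        by apply/funext => y; rewrite /PiE_off Ex0 mulr0 mul0r invr0 mulr0.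
      by apply: (@cvg_lim R[i]^o); [exact: norm_hausdorff|exact: cvg_cst].
    apply: integral0_eq => t _.
    by rewrite /dB_kap (eqP (_ : dB_nrm E x == 0)) ?dB_nrm_eq0 ?Ex0// mul0r mulr0 invr0 mulr0.
  have [m hm] := wronsk_cderiv dE Ex0.
  exists (- m / (2 * pi * dB_nrm E x)); split; first exact: PiE_diag.
  exact: kap_integral.
have [k hk] := choice H.
exists k, (dB_kap E); split => //.
- by move=> x; have [] := hk x.
- by move=> x y xy; rewrite /PiE xy eq_sym xy; exact: dB_kap_PiE_off.
- exact: dB_measurable_kap.
split.
- exact: dB_kap_ge0.
- exact: dB_kap_sym.
- exact: dB_kap_le.
- by move=> x; have [] := hk x.
Qed.

(** * Linear statistics of determinantal processes *)

Section DoubleIntegral.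
Context {R : realType}.
Notation mu := (@lebesgue_measure R).
Implicit Types h : R -> R -> R.

Definition measurable2 h := measurable_fun setT (fun p : R * R => h p.1 p.2).

(** Extended-valued, so that nonnegative integrands can be added and compared before anything is
    known to be finite. *)
Definition dint h : \bar R := (\int[mu]_t \int[mu]_s (h t s)%:E)%E.

Lemma measurable_section h t : measurable2 h -> measurable_fun setT (h t).
Proof.
move=> mh; have -> : h t = (fun p : R * R => h p.1 p.2) \o (pair t) by [].
by apply: measurableT_comp.
Qed.

Lemma measurable_marginal h : measurable2 h -> (forall x y, 0 <= h x y) ->
  measurable_fun setT (fun t => \int[mu]_s (h t s)%:E)%E.
Proof.
move=> mh h0.
have m1 : measurable_fun setT (fun p : R * R => (h p.1 p.2)%:E).
  exact/measurable_EFinP.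
have m2 (p : R * R) : (0 <= (h p.1 p.2)%:E)%E by rewrite lee_fin.
exact: (@measurable_fun_fubini_tonelli_F _ _ _ _ R mu
  (fun p : R * R => (h p.1 p.2)%:E) m1 m2).
Qed.

Lemma measurable2_fst (f : R -> R) : measurable_fun setT f ->
  measurable2 (fun t _ => f t).
Proof. by move=> mf; exact: measurableT_comp mf _. Qed.

Lemma measurable2_snd (f : R -> R) : measurable_fun setT f ->
  measurable2 (fun _ s => f s).
Proof. by move=> mf; exact: measurableT_comp mf _. Qed.

Lemma dintD h1 h2 : measurable2 h1 -> measurable2 h2 ->
  (forall x y, 0 <= h1 x y) -> (forall x y, 0 <= h2 x y) ->
  (dint (fun x y => (h1 x y + h2 x y)%R) = dint h1 + dint h2)%E.
Proof.
move=> m1 m2 h10 h20; rewrite /dint -ge0_integralD//.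
- apply: eq_integral => t _; rewrite -ge0_integralD//.
  + by move=> s _; rewrite lee_fin.
  + by apply/measurable_EFinP; exact: measurable_section.
  + by move=> s _; rewrite lee_fin.
  + by apply/measurable_EFinP; exact: measurable_section.
- by move=> t _; apply: integral_ge0 => s _; rewrite lee_fin.
- exact: measurable_marginal.
- by move=> t _; apply: integral_ge0 => s _; rewrite lee_fin.
- exact: measurable_marginal.
Qed.

Lemma dintZ c h : measurable2 h -> (forall x y, 0 <= h x y) -> 0 <= c ->
  (dint (fun x y => (c * h x y)%R) = c%:E * dint h)%E.
Proof.
move=> mh h0 c0; rewrite /dint -ge0_integralZl//; last 2 first.
- exact: measurable_marginal.
- by move=> t _; apply: integral_ge0 => s _; rewrite lee_fin.
apply: eq_integral => t _; under eq_integral do rewrite EFinM.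
rewrite ge0_integralZl//; last by move=> s _; rewrite lee_fin.
by apply/measurable_EFinP; exact: measurable_section.
Qed.

Lemma le_dint h1 h2 : measurable2 h1 -> measurable2 h2 ->
  (forall x y, 0 <= h1 x y) -> (forall x y, h1 x y <= h2 x y) ->
  (dint h1 <= dint h2)%E.
Proof.
move=> m1 m2 h10 h12.
have h20 x y : 0 <= h2 x y by exact: le_trans (h10 x y) (h12 x y).
apply: ge0_le_integral => //.
- by move=> t _; apply: integral_ge0 => s _; rewrite lee_fin.
- exact: measurable_marginal.
- exact: measurable_marginal.
move=> t _; apply: ge0_le_integral => //.
- by move=> s _; rewrite lee_fin.
- by apply/measurable_EFinP; exact: measurable_section.
- by apply/measurable_EFinP; exact: measurable_section.
- by move=> s _; rewrite lee_fin.
Qed.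

Lemma dint_swap h : measurable2 h -> (forall x y, 0 <= h x y) ->
  dint h = dint (fun x y => h y x).
Proof.
move=> mh h0.
have m1 : measurable_fun setT (fun p : R * R => (h p.1 p.2)%:E).
  exact/measurable_EFinP.
have m2 (p : R * R) : (0 <= (h p.1 p.2)%:E)%E by rewrite lee_fin.
exact: (@fubini_tonelli _ _ _ _ R mu mu (fun p : R * R => (h p.1 p.2)%:E) m1 m2).
Qed.

End DoubleIntegral.

Lemma bounded_setP (R : realType) (A : set R) :
  bounded_set A <-> exists M : R, forall x, A x -> `|x| <= M.
Proof.
split.
  move=> [M [_ hM]]; exists (M + 1) => x Ax; apply: (hM (M + 1)) => //.
  by rewrite ltrDl.
move=> [M hM]; exists M; split; first exact: num_real.
by move=> N MN x Ax /=; rewrite (le_trans (hM x Ax))// ltW.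
Qed.

Lemma bounded_setI (R : realType) (A B : set R) : bounded_set A -> bounded_set (A `&` B).
Proof.
by move=> /bounded_setP[M hM]; apply/bounded_setP; exists M => x [Ax _]; exact: hM.
Qed.

Import HBSimple HBNNSimple.

(** * Linear statistics of a configuration and their measurability *)

Section LinearStatistics.
Context {R : realType}.
Implicit Types (X : Conf R) (B C D : set R) (f : R -> R).

Notation SubConf C := (g_sigma_algebraType (@gen_F R C)).

(** A duplicate-free list of the points, for bounded [D]: sums and products over a configuration
    become big operators open to induction. *)
Definition pts D X : seq R := finmap.enum_fset (fset_set (conf_set X `&` D)).

Definition linstat f D X : R := \sum_(x <- pts D X) f x.

Lemma conf_fin X D : bounded_set D -> finite_set (conf_set X `&` D).
Proof. exact: (svalP X). Qed.

Lemma mem_pts X D x : bounded_set D -> (x \in pts D X) = (x \in conf_set X `&` D).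
Proof. by move=> bD; rewrite -in_fset_set//; exact: conf_fin. Qed.

Lemma pts_in X D x : bounded_set D -> x \in pts D X -> D x.
Proof. by move=> bD; rewrite mem_pts// => /set_mem[]. Qed.

Lemma uniq_pts X D : uniq (pts D X). Proof. exact: finmap.fset_uniq. Qed.

Lemma count_inE X D : bounded_set D -> count_in D X = (size (pts D X))%:R%:E.
Proof. by move=> bD; rewrite /count_in /counting asboolT//; exact: conf_fin. Qed.

Lemma mult_functionalE (g : R -> R[i]) D X : bounded_set D ->
  mult_functional g D X = \prod_(x <- pts D X) g x.
Proof. by move=> bD; rewrite /mult_functional fsbig_finite//; exact: conf_fin. Qed.

Lemma linstat_indic D A X : bounded_set D ->
  linstat \1_A D X = (size (pts (D `&` A) X))%:R.
Proof.
move=> bD.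
have bDA : bounded_set (D `&` A) by exact: bounded_setI.
rewrite /linstat (eq_bigr (fun x => if x \in A then 1 else 0)); last first.
  by move=> x _; rewrite indicE; case: ifP.
rewrite -big_mkcond/= -big_filter (perm_big (pts (D `&` A) X)).
  by rewrite big_const_seq count_predT iter_addr addr0.
apply: uniq_perm; [exact/filter_uniq/uniq_pts|exact: uniq_pts|move=> x].
rewrite mem_filter !mem_pts//.
apply/andP/idP => [[/set_mem xA /set_mem[Xx Dx]]|/set_mem[Xx [Dx xA]]].
  exact/mem_set.
by split; apply/mem_set.
Qed.

Lemma linstat_split f D B X : bounded_set D ->
  linstat f D X = linstat f (D `&` B) X + linstat f (D `&` ~` B) X.
Proof.
move=> bD; rewrite /linstat -big_cat/=; apply: perm_big.
have bB := @bounded_setI _ _ B bD; have bBc := @bounded_setI _ _ (~` B) bD.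
apply: uniq_perm; first exact: uniq_pts.
  rewrite cat_uniq !uniq_pts/= andbT; apply/hasPn => x.
  rewrite mem_pts// => /set_mem[_ [_ nBx]]; apply/negP => /=.
  by rewrite mem_pts// => /set_mem[_ [_ /nBx]].
move=> x; rewrite mem_cat !mem_pts//.
apply/idP/orP => [/set_mem[Xx Dx]|[|] /set_mem[Xx [Dx _]]].
- by have [Bx|Bx] := pselect (B x); [left|right]; apply/mem_set.
- exact/mem_set.
- exact/mem_set.
Qed.

Lemma measurable_count_in C B : measurable B -> bounded_set B -> B `<=` C ->
  measurable_fun setT (count_in B : SubConf C -> \bar R).
Proof.
move=> mB bB BC _ A mA; rewrite setTI.
by apply: sub_sigma_algebra; exists B, A.
Qed.

Lemma measurable_size_pts C B : measurable B -> bounded_set B -> B `<=` C ->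
  measurable_fun setT ((fun X => (size (pts B X))%:R) : SubConf C -> R).
Proof.
move=> mB bB BC; apply/measurable_EFinP.
rewrite (_ : EFin \o _ = count_in B); first exact: measurable_count_in.
by apply/funext => X /=; rewrite count_inE.
Qed.

(** The sigma-algebra only knows counts. For a simple function the statistic is a combination of the
    counts in its level sets; the general case is a pointwise limit. The set [C] records the region
    observed, later the complement of [B]. *)
Lemma measurable_linstat C D f : measurable D -> bounded_set D -> D `<=` C ->
  measurable_fun setT f -> (forall x, 0 <= f x) ->
  measurable_fun setT (linstat f D : SubConf C -> R).
Proof.
move=> mD bD DC mf f0.
have mf' : measurable_fun setT (EFin \o f) by exact/measurable_EFinP.
have [g [ndg gf]] := @approximation _ _ R setT measurableT (EFin \o f) mf'
  (fun t _ => f0 t).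
have gE n (X : SubConf C) : linstat (g n) D X =
    \sum_(r \in range (g n)) r * (size (pts (D `&` (g n @^-1` [set r])) X))%:R.
  have fin : finite_set (range (g n)) by [].
  rewrite /linstat (eq_bigr (fun x => \sum_(r \in range (g n))
      (r * \1_(g n @^-1` [set r]) x))); last by move=> x _; exact: fimfunE.
  rewrite fsbig_finite//=; under eq_bigr do rewrite fsbig_finite//=.
  rewrite exchange_big/=; apply: eq_bigr => r _.
  by rewrite -linstat_indic// /linstat mulr_sumr.
apply: (@measurable_fun_cvg _ (SubConf C) R setT
  (fun n => linstat (g n) D) (linstat f D)).
  move=> n; rewrite (_ : linstat (g n) D = fun X =>
    \sum_(r \in range (g n)) r * (size (pts (D `&` (g n @^-1` [set r])) X))%:R).
    under eq_fun do rewrite fsbig_finite//=.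
    apply: measurable_sum => r; apply: measurable_funM => //.
    apply: measurable_size_pts.
    - apply: measurableI => //; exact: measurable_sfunP.
    - exact: bounded_setI.
    - by move=> x [/DC].
  by apply/funext => X; exact: gE.
move=> X _; rewrite /linstat; apply: cvg_big; first exact: add_continuous.
move=> x _.
by have /fine_cvgP[_] := gf x I.
Qed.

End LinearStatistics.

(** * Expansion of the product functional to third order *)

Section ProductExpansion.
Context {R : realType}.
Implicit Types (s : seq R) (f : R -> R) (t : R).

(** The second elementary symmetric polynomial of the values of [f], written by Newton's identity
    through linear statistics of [f] and of its square. *)
Definition elem2 f s : R :=
  ((\sum_(x <- s) f x) ^+ 2 - \sum_(x <- s) f x ^+ 2) / 2.

Lemma elem2_cons f a s : elem2 f (a :: s) = elem2 f s + f a * \sum_(x <- s) f x.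
Proof. by rewrite /elem2 !big_cons; field. Qed.

(** The remainder is a sum over sublists of length [j >= 3] with factor [t ^+ j], and
    [t ^+ j <= t ^+ 3]. The three bounds are carried together because the induction multiplies one
    by another. *)
Lemma prod_expansion f s t : (forall x, 0 <= f x) -> 0 <= t <= 1 ->
  [/\ 0 <= elem2 f s,
   0 <= \prod_(x <- s) (1 + t * f x) - 1 - t * \sum_(x <- s) f x - t ^+ 2 * elem2 f s &
   \prod_(x <- s) (1 + t * f x) - 1 - t * \sum_(x <- s) f x - t ^+ 2 * elem2 f s <=
   t ^+ 3 * (\prod_(x <- s) (1 + f x) - 1 - \sum_(x <- s) f x - elem2 f s)].
Proof.
move=> f0 /andP[t0 t1]; elim: s => [|a s [e0 r0 rle]].
  by rewrite /elem2 !big_nil; split; lra.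
have S0 : 0 <= \sum_(x <- s) f x by exact: sumr_ge0.
rewrite elem2_cons !big_cons.
have fa := f0 a.
move: r0 rle; set r := (X in 0 <= X -> _ -> _); set P := \prod_(x <- s) (1 + t * f x).
set Q := \prod_(x <- s) (1 + f x); set S := \sum_(x <- s) f x in S0 *.
set e := elem2 f s in e0 *; set b := f a in fa *.
rewrite -/(r) => r0 rle.
have rE : P = 1 + t * S + t ^+ 2 * e + r by rewrite /r /P /S /e; ring.
have -> : (1 + t * b) * P - 1 - t * (b + S) - t ^+ 2 * (e + b * S) =
    r + t ^+ 3 * (b * e) + (t * b) * r by rewrite rE; ring.
have -> : (1 + b) * Q - 1 - (b + S) - (e + b * S) =
   (Q - 1 - S - e) + b * e + b * (Q - 1 - S - e) by ring.
set q := Q - 1 - S - e in rle *.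
have t3 : 0 <= t ^+ 3 by rewrite exprn_ge0.
have be : 0 <= b * e by rewrite mulr_ge0.
have h1 : 0 <= t ^+ 3 * (b * e) by rewrite mulr_ge0.
have h2 : 0 <= t * b * r by rewrite !mulr_ge0.
split; [by rewrite addr_ge0// mulr_ge0|lra|].
have h3 : t * b * r <= t ^+ 3 * (b * q).
  have : t * b * r <= b * r by rewrite -[leRHS]mul1r -mulrA ler_wpM2r// mulr_ge0.
  have : b * r <= b * (t ^+ 3 * q) by rewrite ler_wpM2l.
  have -> : b * (t ^+ 3 * q) = t ^+ 3 * (b * q) by ring.
  lra.
have -> : t ^+ 3 * (q + b * e + b * q) = t ^+ 3 * q + t ^+ 3 * (b * e) + t ^+ 3 * (b * q).
  ring.
lra.
Qed.

Lemma prod_expansion_le f s t : (forall x, 0 <= f x) -> 0 <= t <= 1 ->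
  `|\prod_(x <- s) (1 + t * f x) - 1 - t * \sum_(x <- s) f x - t ^+ 2 * elem2 f s|
    <= t ^+ 3 * \prod_(x <- s) (1 + f x).
Proof.
move=> f0 t01; have [e0 r0 rle] := prod_expansion s f0 t01.
have S0 : 0 <= \sum_(x <- s) f x by exact: sumr_ge0.
rewrite ger0_norm// (le_trans rle)// ler_wpM2l//; last lra.
by rewrite exprn_ge0//; case/andP: t01.
Qed.

Lemma sum_le_prod f s : (forall x, 0 <= f x) ->
  \sum_(x <- s) f x + elem2 f s <= \prod_(x <- s) (1 + f x).
Proof.
move=> f0; have [//|_ + _] := @prod_expansion f s 1 f0; first by rewrite ler01 lexx.
by under eq_bigr do rewrite mul1r; lra.
Qed.

End ProductExpansion.

(** * Reading off the first coefficients of a power series *)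

Section PowerSeries.
Context {R : realType}.

(** Convergence at [t = 1] bounds the coefficients, and for [t <= 1 / 2] the tail is dominated by a
    geometric series. *)
Lemma power_series_order3 (b : R^nat) (phi : R -> R) :
  (forall t, 0 < t <= 1 -> series (fun n => t ^+ n * b n) @ \oo --> phi t) ->
  exists C, forall t, 0 < t <= 1 / 2 ->
    `|phi t - b 0%N - t * b 1%N - t ^+ 2 * b 2%N| <= C * t ^+ 3.
Proof.
move=> H.
have [M [_ hM]] : bounded_fun b.
  apply: cvg_series_bounded; apply/cvg_ex; exists (phi 1).
  have := H 1; rewrite ltr01 lexx => /(_ isT).
  by under eq_fun do rewrite expr1n mul1r.
have {}hM n : `|b n| <= M + 1 by apply: (hM (M + 1)) => //; rewrite ltrDl.
have M0 : 0 <= M + 1 by rewrite (le_trans _ (hM 0%N)).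
exists (2 * (M + 1)) => t /andP[t0 th].
have t3 : 0 < t ^+ 3 by rewrite exprn_gt0.
(* The subtracted term closes the induction: it shrinks at least by half at each step, which pays
   for the new summand. *)
have part k : `|series (fun n => t ^+ n * b n) (k + 3)%N -
    (b 0%N + t * b 1%N + t ^+ 2 * b 2%N)| <=
    2 * (M + 1) * t ^+ 3 - 2 * (M + 1) * t ^+ (k + 3).
  elim: k => [|k IH].
    rewrite add0n subrr /series/= !big_nat_recr//= big_geq// expr0 expr1 mul1r add0r.
    by rewrite subrr normr0.
  rewrite addSn seriesS -addrA (le_trans (ler_normD _ _))//.
  have : `|t ^+ (k + 3) * b (k + 3)%N| <= t ^+ (k + 3) * (M + 1).
    by rewrite normrM ger0_norm ?exprn_ge0 ?(ltW t0)// ler_wpM2l ?exprn_ge0 ?(ltW t0).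
  have tk : 0 < t ^+ (k + 3) by rewrite exprn_gt0.
  have : t ^+ (k + 3).+1 * (M + 1) <= t ^+ (k + 3) / 2 * (M + 1).
    by rewrite ler_wpM2r// exprS mulrC ler_pM2l//; lra.
  lra.
have th1 : 0 < t <= 1 by rewrite t0/=; lra.
have cv := H t th1.
have cv' : `|series (fun n => t ^+ n * b n) n -
    (b 0%N + t * b 1%N + t ^+ 2 * b 2%N)| @[n --> \oo] -->
    `|phi t - (b 0%N + t * b 1%N + t ^+ 2 * b 2%N)|.
  by apply: cvg_norm; apply: cvgB => //; exact: cvg_cst.
have -> : phi t - b 0%N - t * b 1%N - t ^+ 2 * b 2%N =
    phi t - (b 0%N + t * b 1%N + t ^+ 2 * b 2%N) by ring.
apply: (cvgr_to_le cv').
exists 3 => // n /= n3; have {1}-> : n = (n - 3 + 3)%N by rewrite subnK.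
rewrite (le_trans (part _))// gerBl.
by rewrite !mulr_ge0 ?exprn_ge0 ?(ltW t0).
Qed.

Lemma order3_eq0 (a b C : R) :
  (forall t, 0 < t <= 1 / 2 -> `|t * a + t ^+ 2 * b| <= C * t ^+ 3) ->
  a = 0 /\ b = 0.
Proof.
move=> H.
have hh : 0 < (1 / 2 : R) <= 1 / 2 by lra.
have C0 : 0 <= C.
  have := le_trans (normr_ge0 _) (H _ hh).
  by rewrite pmulr_lge0// exprn_gt0// divr_gt0.
have small (x k : R) : (forall t, 0 < t <= 1 / 2 -> `|x| <= k * t) -> x = 0.
  move=> hx; apply/eqP; rewrite -normr_le0 leNgt; apply/negP => x0.
  have k0 : 0 < k.
    have := lt_le_trans x0 (hx _ hh).
    by rewrite pmulr_lgt0// divr_gt0.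
  have h1 : 0 < Num.min (1 / 2) (`|x| / (2 * k)).
    by rewrite lt_min !divr_gt0// mulr_gt0.
  have := hx (Num.min (1 / 2) (`|x| / (2 * k))); rewrite h1 ge_min lexx => /(_ isT).
  apply/negP; rewrite -ltNge.
  have : k * Num.min (1 / 2) (`|x| / (2 * k)) <= k * (`|x| / (2 * k)).
    by rewrite ler_pM2l// ge_min lexx orbT.
  have -> : k * (`|x| / (2 * k)) = `|x| / 2 by field; rewrite gt_eqF.
  lra.
have a0 : a = 0.
  apply: (small a (`|b| + C)) => t tt; have := H t tt; move: tt => /andP[t0 th].
  have -> : t * a + t ^+ 2 * b = t * (a + t * b) by ring.
  rewrite normrM gtr0_norm// (_ : C * t ^+ 3 = t * (C * t ^+ 2)); last by ring.
  rewrite ler_pM2l// => h.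
  have : `|a| <= `|a + t * b| + `|t * b|.
    by rewrite -{1}(addrK (t * b) a) ler_normB.
  rewrite normrM (gtr0_norm t0).
  have : C * t ^+ 2 <= C * t by rewrite ler_wpM2l// expr2 ler_piMl; lra.
  lra.
split=> //; apply: (small b C) => t tt; have := H t tt; move: tt => /andP[t0 th].
rewrite a0 mulr0 add0r normrM gtr0_norm ?exprn_gt0//.
rewrite (_ : C * t ^+ 3 = t ^+ 2 * (C * t)); last by ring.
by rewrite ler_pM2l ?exprn_gt0.
Qed.

End PowerSeries.

(** * Homogeneity of the Fredholm terms *)

Section Scaling.
Context {R : realType}.

(** Scaling by [r] sends simple functions below [f] to simple functions below [r f]. Applied again
    with [r^-1], the same inequality gives equality. *)
Lemma ge0_integral_scale_le d (T : measurableType d)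
    (mu : {measure set T -> \bar R}) (f : T -> \bar R) (r : R) :
  0 < r -> (forall x, 0 <= f x)%E ->
  (r%:E * \int[mu]_x f x <= \int[mu]_x (r%:E * f x))%E.
Proof.
move=> r0 f0.
have rf0 x : (0 <= r%:E * f x)%E by rewrite mule_ge0// lee_fin ltW.
rewrite (ge0_integralTE _ f0) (ge0_integralTE _ rf0) -lee_pdivlMl//.
apply: ge_ereal_sup => _ [h hf <-]; rewrite lee_pdivlMl// -sintegralrM.
apply: ereal_sup_ubound; exists (scale_nnsfun h (ltW r0)) => // x /=.
by rewrite EFinM lee_pmul2l ?lte_fin.
Qed.

(* Unlike [ge0_integralZl], no measurability is required: the terms of a
   Fredholm series are only known as iterated integrals of arbitrary functions. *)
Lemma integral_scale d (T : measurableType d)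
    (mu : {measure set T -> \bar R}) (f : T -> \bar R) (r : R) :
  0 < r -> (\int[mu]_x (r%:E * f x) = r%:E * \int[mu]_x f x)%E.
Proof.
move=> r0.
have ge0 (g : T -> \bar R) : (forall x, 0 <= g x)%E ->
    (\int[mu]_x (r%:E * g x) = r%:E * \int[mu]_x g x)%E.
  move=> g0; apply/eqP; rewrite eq_le ge0_integral_scale_le// andbT.
  rewrite -lee_pdivrMl//; apply: le_trans (ge0_integral_scale_le _ _ _) _.
  - by rewrite invr_gt0.
  - by move=> x; rewrite mule_ge0// lee_fin ltW.
  by under eq_integral do rewrite muleA -EFinM mulVf ?gt_eqF// mul1e.
rewrite integralE [in RHS]integralE.
have r0' := ltW r0.
rewrite ge0_funeposM// ge0_funenegM// !ge0//.
have : (0 <= \int[mu]_x (f^\+)%E x)%E by exact: integral_ge0.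
have : (0 <= \int[mu]_x (f^\-)%E x)%E by exact: integral_ge0.
case: (integral mu _ (f^\-)%E) => [b||]//; case: (integral mu _ (f^\+)%E) => [a||]//= _ _.
- by rewrite -!EFinM -EFinB -mulrBr.
- by rewrite /= gt0_muley ?lte_fin// addye.
- by rewrite /= gt0_muley ?lte_fin//= gt0_muleNy ?lte_fin.
- by rewrite /= gt0_muley ?lte_fin//= gt0_muleNy ?lte_fin.
Qed.

Lemma fine_scale (r : R) (x : \bar R) : 0 < r -> fine (r%:E * x)%E = r * fine x.
Proof.
move=> r0; case: x => [x||] //=.
- by rewrite gt0_muley ?lte_fin//= mulr0.
- by rewrite gt0_muleNy ?lte_fin//= mulr0.
Qed.

Lemma Rintegral_scale (f : R -> R) (r : R) : 0 < r ->
  \int[@lebesgue_measure R]_x (r * f x) = r * \int[@lebesgue_measure R]_x f x.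
Proof. by move=> r0; rewrite /Rintegral -fine_scale// -integral_scale. Qed.

Lemma Re_scale (r : R) z : Re (r%:C * z) = r * Re z.
Proof. by case: z => a b /=; ring. Qed.

Lemma Im_scale (r : R) z : Im (r%:C * z) = r * Im z.
Proof. by case: z => a b /=; ring. Qed.

Lemma cint_scale (f : R -> R[i]) (r : R) : 0 < r ->
  cint (fun x => r%:C * f x) = r%:C * cint f.
Proof.
move=> r0; rewrite /cint.
have -> : (fun x => Re (r%:C * f x)) = (fun x => r * Re (f x)).
  by apply/funext => x; exact: Re_scale.
have -> : (fun x => Im (r%:C * f x)) = (fun x => r * Im (f x)).
  by apply/funext => x; exact: Im_scale.
by rewrite !Rintegral_scale// !rmorphM/=; ring.
Qed.

Lemma iint_scale n (F : (nat -> R) -> R[i]) (r : R) : 0 < r ->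
  iint n (fun x => r%:C * F x) = r%:C * iint n F.
Proof.
move=> r0; elim: n F => [//|n IH] F /=.
rewrite -cint_scale//; congr cint; apply/funext => t; exact: IH.
Qed.

(** A determinant of size [n] is homogeneous of degree [n], so the Fredholm series of [t * A] is a
    power series in [t]. *)
Lemma fredholm_term_scale (A : R -> R -> R[i]) n (t : R) : 0 < t ->
  fredholm_term (fun x y => t%:C * A x y) n = (t ^+ n)%:C * fredholm_term A n.
Proof.
move=> t0; rewrite /fredholm_term mulrA -iint_scale ?exprn_gt0//.
congr (_ / _); congr (iint n _); apply/funext => x.
rewrite rmorphXn /= -detZ; congr (\det _); apply/matrixP => i j.
by rewrite !mxE.
Qed.

Lemma series_Re (u : nat -> R[i]) (d : R[i]) :
  (series u : nat -> R[i]^o) @ \oo --> (d : R[i]^o) ->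
  series (fun n => Re (u n)) @ \oo --> Re d.
Proof.
move=> H; apply/cvgrPdist_lt => e e0.
have /H[N _ hN] : nbhs (d : R[i]^o) [set z | ComplexField.Normc.normc (z - d) < e].
  by apply/nbhs_normc; exists e.
exists N => // n /= Nn.
have -> : series (fun n => Re (u n)) n = Re (series u n).
  by rewrite /series /= raddf_sum.
rewrite -raddfB (le_lt_trans (normc_Re _))// normcB; exact: hN.
Qed.

End Scaling.

(** * Moments of linear statistics from the generating function *)

Section Moments.
Context {R : realType}.
Variables (K : R -> R -> R[i]) (P : probability (ConfSpace R) R).
Hypothesis DPP : is_DPP K P.
Variables (D : set R) (f : R -> R) (M : R).
Hypothesis mD : measurable D.
Hypothesis bD : bounded_set D.
Hypothesis mf : measurable_fun setT f.
Hypothesis f0 : forall x, 0 <= f x.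
Hypothesis fM : forall x, f x <= M.
Hypothesis fD : forall x, ~ D x -> f x = 0.

Local Notation A := (fun x y : R => (f x)%:C * K x y * (\1_D y)%:C).

Definition gen_prod (t : R) (X : Conf R) : R := \prod_(x <- pts D X) (1 + t * f x).
Local Notation Phi := gen_prod.

Lemma DPP_generating (t : R) : 0 < t ->
  P.-integrable setT (fun X => (Phi t X)%:E) /\
  series (fun n => t ^+ n * Re (fredholm_term A n)) @ \oo --> \int[P]_X Phi t X.
Proof.
move=> t0.
pose g x : R[i] := (1 + t * f x)%:C.
have ReP X : Re (mult_functional g D X) = Phi t X.
  by rewrite mult_functionalE// /g -rmorph_prod.
have [||||H _] := DPP mD bD (g := g).
- by apply: measurable_funD => //; exact: measurable_funM.
- exact: measurable_cst.
- exists (1 + t * M) => x; rewrite /g normr_normc lecR normc_real.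
  by rewrite ger0_norm ?addr_ge0 ?mulr_ge0 ?(ltW t0)// lerD2l ler_pM2l.
- by move=> x /fD fx; rewrite /g fx mulr0 addr0.
move=> /series_Re; rewrite (_ : Re (_ + 'i * _) =
    \int[P]_X Re (mult_functional g D X)); last by rewrite /=; ring.
have -> : (fun x y => (g x - 1) * K x y * (\1_D y)%:C) = (fun x y => t%:C * A x y).
  apply/funext => x; apply/funext => y; rewrite /g rmorphD rmorphM/= addrAC subrr add0r.
  by rewrite !mulrA.
have -> : (fun n => Re (fredholm_term (fun x y => t%:C * A x y) n)) =
    (fun n => t ^+ n * Re (fredholm_term A n)).
  by apply/funext => n; rewrite fredholm_term_scale// Re_scale.
move=> cv; split.
  by rewrite (_ : (fun X => _) = (fun X => (Re (mult_functional g D X))%:E))//;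
     apply/funext => X; rewrite ReP.
by under eq_Rintegral do rewrite -ReP.
Qed.

Lemma Phi_ge0 t X : 0 <= t -> 0 <= Phi t X.
Proof. by move=> t0; apply: prodr_ge0 => x _; rewrite addr_ge0// mulr_ge0. Qed.

Lemma measurable_statistic :
  [/\ measurable_fun setT (linstat f D : ConfSpace R -> R) &
   measurable_fun setT ((fun X => elem2 f (pts D X)) : ConfSpace R -> R)].
Proof.
have m1 : measurable_fun setT (linstat f D : ConfSpace R -> R).
  exact: measurable_linstat.
split => //.
have m2 : measurable_fun setT (linstat (fun x => f x ^+ 2) D : ConfSpace R -> R).
  apply: measurable_linstat => //; first exact: measurable_funX.
  by move=> x; exact: sqr_ge0.
apply: measurable_funM => //; apply: measurable_funB => //.
exact: (measurable_funX 2 m1).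
Qed.

(* The coefficients of order 1 and 2 in [t] of the generating function, whose
   remainders are of order 3 on both sides. *)
Lemma DPP_moments :
  [/\ P.-integrable setT (fun X => (linstat f D X)%:E),
      P.-integrable setT (fun X => (elem2 f (pts D X))%:E),
      \int[P]_X linstat f D X = Re (fredholm_term A 1) &
      \int[P]_X elem2 f (pts D X) = Re (fredholm_term A 2)].
Proof.
have [m1 m2] := measurable_statistic.
have [iPhi _] := DPP_generating ltr01.
have PhiE X : Phi 1 X = \prod_(x <- pts D X) (1 + f x).
  by apply: eq_bigr => x _; rewrite mul1r.
have S0 X : 0 <= linstat f D X by exact: sumr_ge0.
have e0 X : 0 <= elem2 f (pts D X).
  have [|//] := @prod_expansion R f (pts D X) 0 f0; by rewrite lexx ler01.
(* Domination by [Phi 1], whose integrability is part of [is_DPP], makes both moments finite. *)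
have Sle X : linstat f D X + elem2 f (pts D X) <= Phi 1 X.
  by rewrite PhiE; exact: sum_le_prod.
have i1 : P.-integrable setT (fun X => (linstat f D X)%:E).
  apply: le_integrable iPhi => //; first exact/measurable_EFinP.
  move=> X _ /=; rewrite lee_fin !ger0_norm ?Phi_ge0//.
  by have := Sle X; have := e0 X; lra.
have i2 : P.-integrable setT (fun X => (elem2 f (pts D X))%:E).
  apply: le_integrable iPhi => //; first exact/measurable_EFinP.
  move=> X _ /=; rewrite lee_fin !ger0_norm ?Phi_ge0//.
  by have := Sle X; have := S0 X; lra.
suff [h1 h2] : \int[P]_X linstat f D X - Re (fredholm_term A 1) = 0 /\
    \int[P]_X elem2 f (pts D X) - Re (fredholm_term A 2) = 0.
  by split => //; apply/eqP; rewrite -subr_eq0; apply/eqP.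
have b0 : Re (fredholm_term A 0) = 1.
  by rewrite /fredholm_term /= det_mx00 fact0 divr1.
have [C hC] : exists C, forall t, 0 < t <= 1 / 2 ->
    `|\int[P]_X Phi t X - 1 - t * Re (fredholm_term A 1) -
      t ^+ 2 * Re (fredholm_term A 2)| <= C * t ^+ 3.
  have [|C hC] := @power_series_order3 R (fun n => Re (fredholm_term A n))
    (fun t => \int[P]_X Phi t X).
    by move=> t /andP[t0 _]; have [] := DPP_generating t0.
  by exists C => t /hC; rewrite b0.
(* The two remainder constants add up: [C] from the Fredholm series and the mean of [Phi 1] from
   [prod_expansion_le]. *)
apply: (@order3_eq0 R _ _ (C + \int[P]_X Phi 1 X)) => t tt.
have {}hC := hC t tt; move: tt => /andP[t0 th].
have [it _] := DPP_generating t0.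
have ic1 : P.-integrable setT (fun _ => (1 : R)%:E).
  exact: finite_measure_integrable_cst.
have itS : P.-integrable setT (fun X => (t * linstat f D X)%:E).
  by under eq_fun do rewrite EFinM; exact: integrableZl.
have ite : P.-integrable setT (fun X => (t ^+ 2 * elem2 f (pts D X))%:E).
  by under eq_fun do rewrite EFinM; exact: integrableZl.
have i3 : P.-integrable setT (fun X => (Phi t X - 1)%:E).
  by under eq_fun do rewrite EFinB; exact: integrableB.
have i4 : P.-integrable setT (fun X => (Phi t X - 1 - t * linstat f D X)%:E).
  by under eq_fun do rewrite EFinB; exact: integrableB.
have i5 : P.-integrable setT
  (fun X => (Phi t X - 1 - t * linstat f D X - t ^+ 2 * elem2 f (pts D X))%:E).
  by under eq_fun do rewrite EFinB; exact: integrableB.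
have i6 : P.-integrable setT (fun X => (t ^+ 3 * Phi 1 X)%:E).
  by under eq_fun do rewrite EFinM; exact: integrableZl.
have H : `|\int[P]_X (Phi t X - 1 - t * linstat f D X - t ^+ 2 * elem2 f (pts D X))|
    <= t ^+ 3 * \int[P]_X Phi 1 X.
  rewrite -RintegralZl// (le_trans (le_normr_Rintegral _ i5))//.
  apply: le_Rintegral => //; first exact: (integrable_norm i5).
  move=> X _ /=; rewrite PhiE; apply: prod_expansion_le => //.
  by rewrite (ltW t0)/=; lra.
have E1 : \int[P]_X (Phi t X - 1 - t * linstat f D X - t ^+ 2 * elem2 f (pts D X))
    = \int[P]_X Phi t X - 1 - t * \int[P]_X linstat f D X -
      t ^+ 2 * \int[P]_X elem2 f (pts D X).
  rewrite RintegralB// RintegralB// RintegralB// Rintegral_cst//.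
  by rewrite !RintegralZl// (_ : fine (P setT) = 1) ?mulr1// probability_setT.
rewrite E1 in H; move: H hC.
rewrite mulrDl [\int[P]_X Phi 1 X * _]mulrC.
move: (\int[P]_X Phi 1 X) (\int[P]_X Phi t X) (\int[P]_X linstat f D X)
  (\int[P]_X elem2 f (pts D X)) (Re _) (Re _) => p1 pt S e b1 b2.
rewrite !ler_norml => /andP[h1 h2] /andP[h3 h4]; apply/andP; split; lra.
Qed.

End Moments.

(** * The first two moments in terms of [k] and [kap] *)

Section DeterminantalKernel.
Context {R : realType}.
Notation mu := (@lebesgue_measure R).

Lemma cint_real (phi : R -> R) :
  cint (fun t => (phi t)%:C) = (\int[mu]_t phi t)%:C.
Proof.
rewrite /cint /= (_ : \int[mu]_t _ = \int[mu]_t phi t)//.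
rewrite (_ : \int[mu]_t 0 = 0) ?mulr0 ?addr0//.
by rewrite Rintegral_cst// mul0r.
Qed.

(** At [s = t] the determinant of order 2 has equal rows and vanishes, whereas [kap t t] is
    unconstrained by [Koff]; the discrepancy sits on a null set. *)
Lemma Rintegral_off_point (f g : R -> R) t : measurable_fun setT g ->
  (forall s, s != t -> f s = g s) -> \int[mu]_s f s = \int[mu]_s g s.
Proof.
move=> mg fg; rewrite /Rintegral; congr fine.
have mT : measurable ([set: R] `\ t).
  by apply: measurableD.
have mg' : measurable_fun ([set: R] `\ t) (EFin \o g).
  by apply: measurable_funTS; exact/measurable_EFinP.
have mf' : measurable_fun ([set: R] `\ t) (EFin \o f).
  apply: eq_measurable_fun mg' => s /set_mem[_ /= /eqP st].
  by rewrite fg.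
rewrite -(integral_setD1 mT mf') -(integral_setD1 mT mg').
by apply: eq_integral => s /set_mem[_ /= /eqP st]; rewrite fg.
Qed.

Lemma bounded_set_measure (D : set R) : measurable D -> bounded_set D ->
  (mu D < +oo)%E.
Proof.
move=> mD /bounded_setP[M hM].
have DM : D `<=` [set` `[- M, M]] by move=> x /hM; rewrite /= in_itv/= ler_norml.
have H : (mu D <= mu [set` `[(- M)%R, M]])%E by apply: le_measure; rewrite ?inE.
apply: (le_lt_trans H).
by rewrite /= lebesgue_measure_itv/=; case: ifP => // _; rewrite -EFinB ltry.
Qed.

Variables (K : R -> R -> R[i]) (k : R -> R) (kap : R -> R -> R).
Hypothesis Kdiag : forall x, K x x = (k x)%:C.
Hypothesis Koff : forall x y, x != y -> K x y * K y x = (kap x y)%:C.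
Hypothesis mkap : measurable2 kap.
Hypothesis kap0 : forall x y, 0 <= kap x y.
Hypothesis kapE : forall x, (\int[mu]_t (kap x t)%:E = (k x)%:E)%E.

Lemma k_ge0 x : 0 <= k x.
Proof.
by rewrite -lee_fin -kapE; apply: integral_ge0 => t _; rewrite lee_fin.
Qed.

Lemma measurable_k : measurable_fun setT k.
Proof.
apply/measurable_EFinP.
have H := measurable_marginal mkap kap0.
by apply: eq_measurable_fun H => t _; rewrite kapE.
Qed.

Lemma integrable_section t : mu.-integrable setT (fun s => (kap t s)%:E).
Proof.
apply/integrableP; split; first by apply/measurable_EFinP; exact: measurable_section.
under eq_integral => s _ do rewrite gee0_abs ?lee_fin//.
by rewrite kapE ltry.
Qed.

Section TestFunction.
Variables (P : probability (ConfSpace R) R).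
Hypothesis DPP : is_DPP K P.
Variables (D : set R) (f : R -> R) (M : R).
Hypothesis mD : measurable D.
Hypothesis bD : bounded_set D.
Hypothesis mf : measurable_fun setT f.
Hypothesis f0 : forall x, 0 <= f x.
Hypothesis fM : forall x, f x <= M.
Hypothesis fD : forall x, ~ D x -> f x = 0.

Let A := (fun x y : R => (f x)%:C * K x y * (\1_D y)%:C).

Lemma f_indic x : f x * \1_D x = f x.
Proof.
rewrite indicE; case: (boolP (x \in D)) => xD; first by rewrite mulr1.
by rewrite fD ?mul0r// => /mem_set; apply/negP.
Qed.

Lemma Adiag x : A x x = (f x * k x)%:C.
Proof.
rewrite /A Kdiag -!rmorphM; congr (_%:C).
by rewrite mulrAC f_indic.
Qed.

Lemma expected_linstat : \int[P]_X linstat f D X = \int[mu]_x (f x * k x).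
Proof.
have [_ _ -> _] := DPP_moments DPP mD bD mf f0 fM fD.
have -> : fredholm_term (fun x y : R => (f x)%:C * K x y * (\1_D y)%:C) 1 =
    (\int[mu]_x (f x * k x))%:C.
  rewrite /fredholm_term (_ : (1`!)%:R = 1)// divr1 -cint_real /=.
  by congr cint; apply/funext => t; rewrite det_mx11 mxE/= -/(A t t) Adiag.
by [].
Qed.

Lemma expected_elem2 : \int[P]_X elem2 f (pts D X) =
  (\int[mu]_t \int[mu]_s (f t * f s * (k t * k s - kap t s))) / 2.
Proof.
have [_ _ _ ->] := DPP_moments DPP mD bD mf f0 fM fD.
rewrite /fredholm_term -/A.
have detE (a b c d : R[i]) (B : 'M[R[i]]_2) : B ord0 ord0 = a -> B ord0 ord_max = b ->
    B ord_max ord0 = c -> B ord_max ord_max = d -> \det B = a * d - b * c.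
  move=> Ba Bb Bc Bd; rewrite (expand_det_row _ ord0) !big_ord_recl big_ord0.
  rewrite /cofactor !det_mx11 !mxE /=.
  have -> : lift ord0 (ord0 : 'I_1) = ord_max :> 'I_2 by apply/val_inj.
  have -> : lift ord_max (ord0 : 'I_1) = ord0 :> 'I_2 by apply/val_inj.
  by rewrite Ba Bb Bc Bd /=; ring.
have -> : iint 2 (fun x => \det (\matrix_(i < 2, j < 2) A (x i) (x j))) =
    (\int[mu]_t \int[mu]_s (f t * f s * (k t * k s - kap t s)))%:C.
  rewrite -cint_real /=; congr cint; apply/funext => t.
  pose psi s := if s == t then 0 else f t * f s * (k t * k s - kap t s).
  rewrite -(@Rintegral_off_point psi _ t); last 2 first.
  - apply: measurable_funM; first exact: measurable_funM.
    apply: measurable_funB; last exact: measurable_section.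
    by apply: measurable_funM => //; exact: measurable_k.
  - by move=> s st; rewrite /psi (negbTE st).
  rewrite -cint_real; congr cint; apply/funext => s.
  rewrite (@detE (A t t) (A t s) (A s t) (A s s)) ?mxE//.
  rewrite /psi; case: eqVneq => [->|st]; first by rewrite subrr.
  rewrite !Adiag /A.
  transitivity ((f t * k t)%:C * (f s * k s)%:C -
     (f t * \1_D t)%:C * (f s * \1_D s)%:C * (K t s * K s t)).
    by rewrite !rmorphM/=; ring.
  rewrite !f_indic Koff 1?eq_sym// -!rmorphM -rmorphB; congr (_%:C); ring.
have -> : (2`!)%:R = (2 : R)%:C :> R[i] by rewrite rmorph_nat.
by rewrite -fmorphV -rmorphM.
Qed.

End TestFunction.
End DeterminantalKernel.

(** * Local integrability of the intensity *)

Section Intensity.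
Context {R : realType}.
Notation mu := (@lebesgue_measure R).

Variables (K : R -> R -> R[i]) (k : R -> R) (kap : R -> R -> R).
Hypothesis Kdiag : forall x, K x x = (k x)%:C.
Hypothesis mkap : measurable2 kap.
Hypothesis kap0 : forall x y, 0 <= kap x y.
Hypothesis kapE : forall x, (\int[mu]_t (kap x t)%:E = (k x)%:E)%E.
Variables (P : probability (ConfSpace R) R).
Hypothesis DPP : is_DPP K P.
Let mk : measurable_fun setT k. Proof. exact: measurable_k mkap kap0 kapE. Qed.
Let k0 x : 0 <= k x. Proof. exact: k_ge0 kap0 kapE x. Qed.

Variable D : set R.
Hypothesis mD : measurable D.
Hypothesis bD : bounded_set D.

Let Dm (m : nat) : set R := D `&` [set x | k x <= m%:R].

Let mDm m : measurable (Dm m).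
Proof.
rewrite /Dm (_ : [set x | k x <= m%:R] = setT `&` k @^-1` [set` `]-oo, m%:R]]).
  by apply: measurableI => //; exact: mk.
by rewrite setTI; apply/seteqP; split => x /=; rewrite in_itv.
Qed.

Let integrable_indic_D : mu.-integrable setT (fun x => (\1_D x)%:E).
Proof.
apply/integrableP; split; first by apply/measurable_EFinP; exact: measurable_indic.
under eq_integral => x _ do rewrite gee0_abs ?lee_fin//.
by rewrite integral_indic// setIT; exact: bounded_set_measure.
Qed.

Let mono m x : (\1_(Dm m) x : R) <= \1_D x.
Proof.
rewrite !indicE; case: (boolP (x \in Dm m)) => // /set_mem[Dx _].
by rewrite (mem_set Dx).
Qed.

Let int_Dm_k m : mu.-integrable setT (fun x => (\1_(Dm m) x * k x)%:E).
Proof.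
have iH : mu.-integrable setT (fun x => (m%:R * \1_D x)%:E).
  by under eq_fun do rewrite EFinM; exact: integrableZl.
apply: le_integrable iH => //.
  by apply/measurable_EFinP; apply: measurable_funM; [exact: measurable_indic (mDm m)|exact: mk].
move=> x _ /=; rewrite lee_fin !ger0_norm ?mulr_ge0//.
have [xD|xD] := boolP (x \in Dm m); last first.
  by rewrite [\1_(Dm m) x]indicE (negbTE xD) mul0r mulr_ge0.
have [Dx kx] := set_mem xD.
by rewrite !indicE xD (mem_set Dx) mul1r mulr1.
Qed.

(** The first-moment formula cannot be applied to [D] itself, since an infinite integral would be
    read as 0. On the part of [D] where [k <= m] the integral is finite and equals a mean count,
    hence is at most the mean count of [D]; then [m] tends to infinity. *)
Lemma integrable_intensity : mu.-integrable setT (fun x => (\1_D x * k x)%:E).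
Proof.
have meas1 m : measurable_fun setT (\1_(Dm m) : R -> R) by exact: measurable_indic (mDm m).
have le1 (B : set R) x : (\1_B x : R) <= 1 by rewrite indicE; case: (_ \in _).
have offD (B : set R) x : B `<=` D -> ~ D x -> (\1_B x : R) = 0.
  by move=> BD Dx; rewrite indicE; case: (boolP (x \in B)) => // /set_mem /BD.
have DmD m : Dm m `<=` D by move=> x [].
have mom (B : set R) : measurable B -> B `<=` D ->
    P.-integrable setT (fun X => (linstat \1_B D X)%:E).
  move=> mB BD; have [||||//] := @DPP_moments R K P DPP D \1_B 1 mD bD.
  - exact: measurable_indic.
  - by move=> x; rewrite indicE.
  - by move=> x; exact: (le1 B).
  - by move=> x; exact: offD.
pose c := \int[P]_X linstat \1_D D X.
have bound m : (\int[mu]_x (\1_(Dm m) x * k x)%:E <= c%:E)%E.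
  have := @expected_linstat R K k Kdiag P DPP D \1_(Dm m) 1 mD bD
    (measurable_indic (mDm m)) _ (le1 _) (fun x => @offD _ x (DmD m)).
  rewrite /Rintegral => H.
  rewrite -[leLHS]fineK; last exact: integrable_fin_num.
  rewrite -H// lee_fin -/(Rintegral _ _ _); apply: le_Rintegral => //.
  - exact: mom.
  - exact: mom.
  - by move=> X _; apply: ler_sum => x _; exact: mono.
pose g m x := (\1_(Dm m) x * k x)%:E.
have mg m : measurable_fun setT (g m).
  apply/measurable_EFinP; apply: measurable_funM; [exact: measurable_indic (mDm m)|exact: mk].
have g0 m x : setT x -> (0 <= g m x)%E by move=> _; rewrite lee_fin mulr_ge0.
have ndg x : setT x -> nondecreasing_seq (g ^~ x).
  move=> _ n m nm; rewrite lee_fin ler_wpM2r// !indicE.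
  case: (boolP (x \in Dm n)) => // /set_mem[Dx kx].
  rewrite mem_set//; split=> //=; rewrite (le_trans kx)// ler_nat//.
have := @cvg_monotone_convergence _ _ _ mu setT measurableT g mg g0 ndg.
have -> : (\int[mu]_x limn (g ^~ x) = \int[mu]_x (\1_D x * k x)%:E)%E.
  apply: eq_integral => x _; apply/cvg_lim => //.
  apply: cvg_near_cst; exists (Num.truncn (k x)).+1 => // m /= km.
  rewrite /g !indicE; case: (boolP (x \in D)) => [/set_mem Dx|xD].
    rewrite mem_set//; split=> //=.
    by rewrite (le_trans (ltW (truncnS_gt _)))// ler_nat.
  case: (boolP (x \in Dm m)) => // /set_mem[/mem_set].
  by rewrite (negbTE xD).
move=> cv; apply/integrableP; split.
  by apply/measurable_EFinP; apply: measurable_funM; [exact: measurable_indic|exact: mk].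
under eq_integral => x _ do rewrite gee0_abs ?lee_fin ?mulr_ge0//.
have : (\int[mu]_x (\1_D x * k x)%:E <= c%:E)%E.
  apply: (@cvge_to_le _ _ _ _ _ _ _ cv); exact: nearW.
by move/le_lt_trans; apply; rewrite ltry.
Qed.

End Intensity.

(** * The variance as a double integral *)

Section VarianceFormula.
Context {R : realType}.
Notation mu := (@lebesgue_measure R).

Variables (K : R -> R -> R[i]) (k : R -> R) (kap : R -> R -> R).
Hypothesis Kdiag : forall x, K x x = (k x)%:C.
Hypothesis Koff : forall x y, x != y -> K x y * K y x = (kap x y)%:C.
Hypothesis mkap : measurable2 kap.
Hypothesis kap0 : forall x y, 0 <= kap x y.
Hypothesis kapE : forall x, (\int[mu]_t (kap x t)%:E = (k x)%:E)%E.
Hypothesis kap_sym : forall x y, kap x y = kap y x.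
Variables (P : probability (ConfSpace R) R).
Hypothesis DPP : is_DPP K P.
Variables (D : set R) (f : R -> R) (M : R).
Hypothesis mD : measurable D.
Hypothesis bD : bounded_set D.
Hypothesis mf : measurable_fun setT f.
Hypothesis f0 : forall x, 0 <= f x.
Hypothesis fM : forall x, f x <= M.
Hypothesis fD : forall x, ~ D x -> f x = 0.

Let mk : measurable_fun setT k. Proof. exact: measurable_k mkap kap0 kapE. Qed.
Let k0 x : 0 <= k x. Proof. exact: k_ge0 kap0 kapE x. Qed.
Let M0 : 0 <= M. Proof. exact: le_trans (f0 0) (fM 0). Qed.

Let f2M x : f x ^+ 2 <= M ^+ 2.
Proof. by rewrite ler_pXn2r ?nnegrE. Qed.

Let f2D x : ~ D x -> f x ^+ 2 = 0.
Proof. by move=> /fD ->; rewrite expr0n. Qed.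

Let mf2 : measurable_fun setT (fun x => f x ^+ 2).
Proof. exact: measurable_funX. Qed.

Let int_hk (h : R -> R) (N : R) : measurable_fun setT h -> (forall x, 0 <= h x) ->
  (forall x, h x <= N) -> (forall x, ~ D x -> h x = 0) ->
  mu.-integrable setT (fun x => (h x * k x)%:E).
Proof.
move=> mh h0 hN hD.
have iH : mu.-integrable setT (fun x => (N * (\1_D x * k x))%:E).
  under eq_fun do rewrite EFinM; apply: integrableZl => //.
  exact: (integrable_intensity Kdiag mkap kap0 kapE DPP mD bD).
apply: le_integrable iH => //.
  by apply/measurable_EFinP; exact: measurable_funM.
move=> x _ /=; have N0 : 0 <= N by exact: le_trans (h0 0) (hN 0).
rewrite lee_fin !ger0_norm ?mulr_ge0// indicE.
have [xD|xD] := boolP (x \in D).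
  by rewrite mul1r ler_wpM2r.
by rewrite hD ?mul0r ?mulr0// => /mem_set; apply/negP.
Qed.

Let L t := \int[mu]_s (f s * kap t s).

Let int_fkap t : mu.-integrable setT (fun s => (f s * kap t s)%:E).
Proof.
have iH : mu.-integrable setT (fun s => (M * kap t s)%:E).
  under eq_fun do rewrite EFinM; apply: integrableZl => //.
  exact: (integrable_section mkap kap0 kapE).
apply: le_integrable iH => //.
  by apply/measurable_EFinP; apply: measurable_funM => //; exact: measurable_section t mkap.
by move=> x _ /=; rewrite lee_fin !ger0_norm ?mulr_ge0// ler_wpM2r.
Qed.

Let LE t : (\int[mu]_s (f s * kap t s)%:E = (L t)%:E)%E.
Proof. by rewrite /L /Rintegral fineK//; exact: integrable_fin_num. Qed.

Let L0 t : 0 <= L t.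
Proof. by apply: Rintegral_ge0 => s _; rewrite mulr_ge0. Qed.

Let Lle t : L t <= M * k t.
Proof.
rewrite -lee_fin -LE EFinM -kapE -ge0_integralZl//; last 2 first.
- by apply/measurable_EFinP; exact: measurable_section t mkap.
- by move=> s _; rewrite lee_fin.
apply: ge0_le_integral => //.
- by move=> s _; rewrite lee_fin mulr_ge0.
- by apply/measurable_EFinP; apply: measurable_funM => //; exact: measurable_section t mkap.
- under eq_fun do rewrite -EFinM; apply/measurable_EFinP.
  by apply: measurable_funM => //; exact: measurable_section t mkap.
- by move=> s _; rewrite -EFinM lee_fin ler_wpM2r.
Qed.

Let mf1 := measurable2_fst mf.
Let mf2' := measurable2_snd mf.

Let J_f1 : dint (fun t s => f t ^+ 2 * kap t s) = (\int[mu]_t (f t ^+ 2 * k t)%:E)%E.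
Proof.
apply: eq_integral => t _; under eq_integral do rewrite EFinM.
rewrite ge0_integralZl//; first by rewrite kapE.
- by apply/measurable_EFinP; exact: measurable_section.
- by move=> s _; rewrite lee_fin.
- by rewrite lee_fin sqr_ge0.
Qed.

Let J_f2 : dint (fun t s => f s ^+ 2 * kap t s) = (\int[mu]_t (f t ^+ 2 * k t)%:E)%E.
Proof.
rewrite -J_f1 dint_swap.
- by congr dint; apply/funext => t; apply/funext => s; rewrite kap_sym.
- by apply: measurable_funM => //; exact: measurable_funX.
- by move=> x y; rewrite mulr_ge0 ?sqr_ge0.
Qed.

Let int_fL : mu.-integrable setT (fun t => (f t * L t)%:E).
Proof.
have iH : mu.-integrable setT (fun t => (M * (f t * k t))%:E).
  under eq_fun do rewrite EFinM; apply: integrableZl => //; exact: (int_hk mf f0 fM fD).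
apply: le_integrable iH => //.
  apply/measurable_EFinP; apply: measurable_funM => //; apply/measurable_EFinP.
  have : measurable_fun setT (fun t => \int[mu]_s (f s * kap t s)%:E)%E.
    apply: (@measurable_marginal R (fun t s => f s * kap t s)).
      exact: measurable_funM mf2' mkap.
    by move=> x y; rewrite mulr_ge0.
  by apply: eq_measurable_fun => t _; rewrite LE.
move=> x _ /=; rewrite lee_fin !ger0_norm ?mulr_ge0//.
by rewrite mulrCA ler_wpM2l.
Qed.

Let J_cross : dint (fun t s => 2 * (f t * f s * kap t s)) =
  (2 * \int[mu]_t (f t * L t))%:E.
Proof.
rewrite EFinM /Rintegral fineK; last exact: integrable_fin_num.
rewrite -ge0_integralZl//; last 2 first.
- by have /integrableP[] := int_fL.
- by move=> t _; rewrite lee_fin mulr_ge0.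
apply: eq_integral => t _.
rewrite [in RHS]EFinM -LE muleA -EFinM -ge0_integralZl//.
- by apply: eq_integral => s _; rewrite -EFinM; congr EFin; ring.
- by apply/measurable_EFinP; apply: measurable_funM => //; exact: measurable_section.
- by move=> s _; rewrite lee_fin mulr_ge0.
- by rewrite lee_fin mulr_ge0.
Qed.

(** The two moments give the variance as the integral of [f ^+ 2 * k] minus that of
    [f t * f s * kap t s]. By [kapE] and symmetry the first one is the double integral of
    [f t ^+ 2 * kap t s] and also of [f s ^+ 2 * kap t s], which completes the square. *)
Lemma linstat_variance :
  P.-integrable setT
    (fun X => ((linstat f D X - \int[P]_Y linstat f D Y) ^+ 2)%:E) /\
  ((2 * \int[P]_X (linstat f D X - \int[P]_Y linstat f D Y) ^+ 2)%:E =
    \int[mu]_t \int[mu]_s ((f t - f s) ^+ 2 * kap t s)%:E)%E.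
Proof.
set e := \int[P]_Y linstat f D Y.
have [iS iE _ _] := DPP_moments DPP mD bD mf f0 fM fD.
have [iQ _ _ _] := DPP_moments DPP mD bD mf2 (fun x => sqr_ge0 (f x)) f2M f2D.
have sqE X : (linstat f D X - e) ^+ 2 = 2 * elem2 f (pts D X) +
    linstat (fun x => f x ^+ 2) D X - 2 * e * linstat f D X + e ^+ 2.
  by rewrite /elem2 /linstat; field.
have i1 : P.-integrable setT (fun X => (2 * elem2 f (pts D X))%:E).
  by under eq_fun do rewrite EFinM; exact: integrableZl.
have i2 : P.-integrable setT
    (fun X => (2 * elem2 f (pts D X) + linstat (fun x => f x ^+ 2) D X)%:E).
  by under eq_fun do rewrite EFinD; exact: integrableD.
have i3 : P.-integrable setT (fun X => (2 * e * linstat f D X)%:E).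
  by under eq_fun do rewrite EFinM; exact: integrableZl.
have i4 : P.-integrable setT
    (fun X => (2 * elem2 f (pts D X) + linstat (fun x => f x ^+ 2) D X -
      2 * e * linstat f D X)%:E).
  by under eq_fun do rewrite EFinB; exact: integrableB.
have i5 : P.-integrable setT (fun _ => (e ^+ 2)%:E).
  exact: finite_measure_integrable_cst.
have i6 : P.-integrable setT (fun X => ((linstat f D X - e) ^+ 2)%:E).
  under eq_fun do rewrite sqE EFinD.
  exact: integrableD.
split => //.
have eE : e = \int[mu]_x (f x * k x).
  exact: (expected_linstat Kdiag DPP mD bD mf f0 fM fD).
have QE : \int[P]_X linstat (fun x => f x ^+ 2) D X = \int[mu]_x (f x ^+ 2 * k x).
  exact: (expected_linstat Kdiag DPP mD bD mf2 (fun x => sqr_ge0 (f x)) f2M f2D).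
have E2 : 2 * \int[P]_X elem2 f (pts D X) = e ^+ 2 - \int[mu]_t (f t * L t).
  rewrite (expected_elem2 Kdiag Koff mkap kap0 kapE DPP mD bD mf f0 fM fD).
  rewrite mulrC divfK// expr2 {1}eE -RintegralZr//; last exact: (int_hk mf f0 fM fD).
  have j1 : mu.-integrable setT (fun t => (f t * k t * e)%:E).
    under eq_fun do rewrite EFinM; apply: integrableZr => //.
    exact: (int_hk mf f0 fM fD).
  rewrite -RintegralB//.
  apply: eq_Rintegral => t _.
  have ik : mu.-integrable setT (fun s => (f t * k t * (f s * k s))%:E).
    under eq_fun do rewrite EFinM; apply: integrableZl => //.
    exact: (int_hk mf f0 fM fD).
  have ik2 : mu.-integrable setT (fun s => (f t * (f s * kap t s))%:E).
    by under eq_fun do rewrite EFinM; apply: integrableZl.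
  have h1 : f t * k t * e = \int[mu]_s (f t * k t * (f s * k s)).
    by rewrite eE RintegralZl//; exact: (int_hk mf f0 fM fD).
  have h2 : f t * L t = \int[mu]_s (f t * (f s * kap t s)).
    by rewrite RintegralZl//; exact: int_fkap.
  rewrite h1 h2 -RintegralB//.
  by apply: eq_Rintegral => s _; ring.
have VE : \int[P]_X (linstat f D X - e) ^+ 2 =
    \int[mu]_x (f x ^+ 2 * k x) - \int[mu]_t (f t * L t).
  rewrite (_ : \int[P]_X _ = \int[P]_X (2 * elem2 f (pts D X) +
    linstat (fun x => f x ^+ 2) D X - 2 * e * linstat f D X + e ^+ 2)); last first.
    by apply: eq_Rintegral => X _; exact: sqE.
  rewrite RintegralD// RintegralB// RintegralD// RintegralZl// RintegralZl//.
  rewrite Rintegral_cst// (_ : fine (P setT) = 1) ?mulr1; last by rewrite probability_setT.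
  by rewrite E2 QE -/e; ring.
pose a := \int[mu]_x (f x ^+ 2 * k x).
have aE : (\int[mu]_t (f t ^+ 2 * k t)%:E = a%:E)%E.
  rewrite /a /Rintegral fineK//; apply: integrable_fin_num => //.
  exact: (int_hk mf2 (fun x => sqr_ge0 (f x)) f2M f2D).
have mm (g : R * R -> R) : measurable_fun setT g ->
    measurable_fun setT (fun p : R * R => g p * kap p.1 p.2).
  by move=> mg; exact: measurable_funM.
(* The square is expanded with the cross term moved to the left, so that only nonnegative integrands
   are added; the finite right side then forces the left one to be finite. *)
have Jsum : (dint (fun t s => ((f t - f s) ^+ 2 * kap t s)%R) +
    dint (fun t s => (2 * (f t * f s * kap t s))%R) =
    dint (fun t s => (f t ^+ 2 * kap t s)%R) + dint (fun t s => (f s ^+ 2 * kap t s)%R))%E.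
  rewrite -!dintD.
  - by congr dint; apply/funext => t; apply/funext => s; ring.
  - by apply: (mm (fun p => f p.1 ^+ 2)); exact: measurable_funX.
  - by apply: (mm (fun p => f p.2 ^+ 2)); exact: measurable_funX.
  - by move=> x y; rewrite mulr_ge0 ?sqr_ge0.
  - by move=> x y; rewrite mulr_ge0 ?sqr_ge0.
  - apply: (mm (fun p => (f p.1 - f p.2) ^+ 2)); apply: measurable_funX.
    exact: measurable_funB.
  - apply: measurable_funM => //; apply: (mm (fun p => f p.1 * f p.2)).
    exact: measurable_funM.
  - by move=> x y; rewrite mulr_ge0 ?sqr_ge0.
  - by move=> x y; rewrite !mulr_ge0.
rewrite VE -/a; move: Jsum; rewrite J_cross J_f1 J_f2 aE -EFinD.
rewrite -/(dint _); case: (dint _) => [j||]//=; rewrite -EFinD => -[H].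
by congr EFin; lra.
Qed.

End VarianceFormula.

(** * Functions of small energy and rigidity *)

Section TestFunctions.
Context {R : realType}.
Notation mu := (@lebesgue_measure R).

Definition energy (F : R -> R) : \bar R :=
  dint (fun t s => (F t - F s) ^+ 2 * ((t - s) ^+ 2)^-1).

Definition tent (r x : R) : R := Num.max 0 (Num.min 1 (2 - `|x| / r)).

Definition ind (r x : R) : R := \1_[set` `[- r, r]] x.

Lemma indP (r x : R) : ind r x = if `|x| <= r then 1 else 0.
Proof.
rewrite /ind indicE; case: ifPn => [xr|/negP xr].
  by rewrite mem_set//= in_itv/= -ler_norml.
case: (boolP (_ \in _)) => // /set_mem/=; rewrite in_itv/= -ler_norml.
by move/xr.
Qed.

Lemma tent_ge0 r x : 0 <= tent r x.
Proof. by rewrite /tent le_max lexx. Qed.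

Lemma tent_le1 r x : tent r x <= 1.
Proof. by rewrite /tent ge_max ler01 ge_min lexx. Qed.

Lemma tent_in r x : 0 < r -> `|x| <= r -> tent r x = 1.
Proof.
move=> r0 xr; have : `|x| / r <= 1 by rewrite ler_pdivrMr// mul1r.
move=> h; rewrite /tent min_l; last by lra.
by rewrite max_r.
Qed.

Lemma tent_out r x : 0 < r -> 2 * r <= `|x| -> tent r x = 0.
Proof.
move=> r0 xr; have : 2 <= `|x| / r by rewrite ler_pdivlMr.
move=> h; rewrite /tent max_l// ge_min; apply/orP; right; lra.
Qed.

Lemma tent_lip r x y : 0 < r -> `|tent r x - tent r y| <= `|x - y| / r.
Proof.
move=> r0.
have clip (u v : R) : `|Num.max 0 (Num.min 1 u) - Num.max 0 (Num.min 1 v)| <= `|u - v|.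
  rewrite /Num.max /Num.min.
  case: (ltP 1 u) => ?; case: (ltP 1 v) => ?;
    repeat (case: ifP => ?); rewrite ler_norml; apply/andP; split;
    have := ler_norm (u - v); have := ler_norm (v - u); rewrite distrC; lra.
apply: le_trans (clip _ _) _.
have -> : 2 - `|x| / r - (2 - `|y| / r) = (`|y| - `|x|) / r by ring.
rewrite normrM (gtr0_norm (_ : 0 < r^-1)) ?invr_gt0// ler_pM2r ?invr_gt0//.
by rewrite (le_trans (ler_dist_dist _ _))// distrC.
Qed.

Lemma measurable_tent r : measurable_fun setT (tent r).
Proof.
apply: measurable_maxr => //; apply: measurable_minr => //.
by apply: measurable_funB => //; apply: measurable_funM.
Qed.

(** An explicit majorant for energy densities when one of the points is within [rho] of the origin.
    The Cauchy density caps the singular kernel at scale [r]; each of the two strips has width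
    [2 * rho] and contributes [2 * rho * (pi / r)]. *)
Definition strip (rho r t s : R) : R :=
  (ind rho t + ind rho s) * ((s - t) ^+ 2 + r ^+ 2)^-1.

Lemma measurable_cauchy2 r :
  measurable2 (fun t s : R => ((s - t) ^+ 2 + r ^+ 2)^-1).
Proof.
apply: measurable_funV; apply: measurable_funD => //; apply: measurable_funX.
exact: measurable_funB.
Qed.

Lemma measurable_ind rho : measurable_fun setT (ind rho).
Proof. exact: measurable_indic. Qed.

Lemma ind_ge0 rho x : 0 <= ind rho x.
Proof. by rewrite indP; case: ifP. Qed.

Lemma measurable_strip rho r : measurable2 (strip rho r).
Proof.
apply: measurable_funM; last exact: measurable_cauchy2.
by apply: measurable_funD; [apply: measurable2_fst|apply: measurable2_snd];
   exact: measurable_ind.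
Qed.

Lemma strip_ge0 rho r t s : 0 <= strip rho r t s.
Proof.
by rewrite mulr_ge0 ?addr_ge0 ?ind_ge0// invr_ge0 addr_ge0 ?sqr_ge0.
Qed.

Lemma dint_strip rho r : 0 < rho -> 0 < r ->
  dint (strip rho r) = (4 * rho * (pi / r))%:E.
Proof.
move=> rho0 r0.
pose q t s : R := ((s - t) ^+ 2 + r ^+ 2)^-1.
have q0 t s : 0 <= q t s by rewrite invr_ge0 addr_ge0 ?sqr_ge0.
have mq : measurable2 q by exact: measurable_cauchy2.
have m1 : measurable2 (fun t s => ind rho t * q t s).
  by apply: measurable_funM => //; apply: measurable2_fst; exact: measurable_ind.
have m2 : measurable2 (fun t s => ind rho s * q t s).
  by apply: measurable_funM => //; apply: measurable2_snd; exact: measurable_ind.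
have p1 t s : 0 <= ind rho t * q t s by rewrite mulr_ge0 ?ind_ge0.
have p2 t s : 0 <= ind rho s * q t s by rewrite mulr_ge0 ?ind_ge0.
have d1 : dint (fun t s => ind rho t * q t s) = (2 * rho * (pi / r))%:E.
  rewrite /dint.
  transitivity (\int[mu]_t ((pi / r)%:E * (ind rho t)%:E))%E.
    apply: eq_integral => t _; under eq_integral do rewrite EFinM.
    rewrite ge0_integralZl//.
    - by rewrite integral_cauchy// muleC.
    - by apply/measurable_EFinP; exact: measurable_section.
    - by move=> s _; rewrite lee_fin.
    - by rewrite lee_fin ind_ge0.
  rewrite ge0_integralZl//.
  - rewrite (_ : \int[mu]_t (ind rho t)%:E = (2 * rho)%:E)%E.
      by rewrite -EFinM; congr EFin; ring.
    rewrite /ind integral_indic// setIT.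
    transitivity (mu [set` `[(- rho)%R, rho]]) => //.
    rewrite lebesgue_measure_itv/= lte_fin (_ : - rho < rho); last by lra.
    by rewrite -EFinB; congr EFin; ring.
  - by apply/measurable_EFinP; exact: measurable_ind.
  - by move=> t _; rewrite lee_fin ind_ge0.
  - by rewrite lee_fin divr_ge0 ?pi_ge0 ?ltW.
have -> : dint (strip rho r) =
    dint (fun t s => ind rho t * q t s + ind rho s * q t s).
  by congr dint; apply/funext => t; apply/funext => s; rewrite /strip mulrDl.
rewrite dintD// d1 (dint_swap m2 p2).
have -> : dint (fun x y => ind rho x * q y x) = dint (fun t s => ind rho t * q t s).
  congr dint; apply/funext => t; apply/funext => s.
  by rewrite /q -[(t - s) ^+ 2]sqrrN opprB.
by rewrite d1 -EFinD; congr EFin; ring.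
Qed.

(** The increment [b] is bounded by 1 and by [|t - s| / r]. With [d = (t - s) ^+ 2] this gives
    [b ^+ 2 * (d + r ^+ 2) <= 2 * d], and [b] vanishes when both points are beyond [2 * r]. *)
Lemma tent_sq_le r t s : 0 < r ->
  (tent r t - tent r s) ^+ 2 * ((t - s) ^+ 2)^-1 <= 2 * strip (2 * r) r t s.
Proof.
move=> r0; have [->|ts] := eqVneq t s.
  by rewrite !subrr expr0n/= mul0r mulr_ge0// strip_ge0.
have d0 : 0 < (t - s) ^+ 2 by rewrite exprn_even_gt0//= subr_eq0.
have r20 : 0 < r ^+ 2 by rewrite exprn_gt0.
set b := tent r t - tent r s; set d := (t - s) ^+ 2 in d0 *.
have b1 : b ^+ 2 <= 1.
  have := tent_ge0 r t; have := tent_ge0 r s; have := tent_le1 r t.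
  have := tent_le1 r s; rewrite /b; nra.
have bd : b ^+ 2 * r ^+ 2 <= d.
  rewrite -exprMn /d -[leRHS]real_normK ?num_real// -[leLHS]real_normK ?num_real//.
  rewrite ler_pXn2r ?nnegrE// normrM (gtr0_norm r0) -ler_pdivlMr//.
  exact: tent_lip.
have key : b ^+ 2 * d^-1 <= 2 * (d + r ^+ 2)^-1.
  rewrite ler_pdivrMr// mulrAC ler_pdivlMr ?addr_gt0//.
  have : b ^+ 2 * d <= 1 * d by rewrite ler_pM2r.
  lra.
have dr0 : 0 < (d + r ^+ 2)^-1 by rewrite invr_gt0 addr_gt0.
rewrite /strip -[(s - t) ^+ 2]sqrrN opprB -/d !indP.
case: (leP `|t| (2 * r)) => tr; case: (leP `|s| (2 * r)) => sr;
  rewrite ?addr0 ?add0r ?mul1r ?mul0r ?mulr0//; first by lra.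
by rewrite /b !tent_out ?(ltW tr) ?(ltW sr)// subrr expr0n/= mul0r.
Qed.

(* The left-hand side vanishes unless one of the points is within [rho] of the
   origin and the other one beyond [r]. *)
Lemma cross_le (F : R -> R) (n rho r t s : R) : 0 < rho -> 4 * rho <= r ->
  (forall x, 0 <= F x <= n) -> (forall x, rho < `|x| -> F x = 0) ->
  2 * (F t - F s) * (tent r t - tent r s) * ((t - s) ^+ 2)^-1 <=
    10 * n * strip rho r t s.
Proof.
move=> rho0 rr F0 Frho.
have r0 : 0 < r by lra.
have n0 : 0 <= n by have /andP[] := F0 0; exact: le_trans.
have pos : 0 <= 10 * n * strip rho r t s by apply: mulr_ge0; [rewrite ?mulr_ge0|exact: strip_ge0].
(* The points are at least [r / 2] apart, so [r ^+ 2] is at most four times the squared distance: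
   hence the 5, and the 10 as [2 * 5]. *)
have far (x y : R) : `|x| <= rho -> r < `|y| ->
    ((x - y) ^+ 2)^-1 <= 5 * ((x - y) ^+ 2 + r ^+ 2)^-1.
  move=> xr yr.
  have h1 : `|y| - `|x| <= `|x - y| by rewrite distrC; exact: lerB_dist.
  have h2 : r / 2 <= `|x - y| by lra.
  have h3 : (r / 2) ^+ 2 <= (x - y) ^+ 2.
    rewrite -[leRHS]real_normK ?num_real// ler_pXn2r ?nnegrE//.
    by rewrite divr_ge0// ltW.
  have r20 : 0 < r ^+ 2 by rewrite exprn_gt0.
  rewrite expr_div_n in h3.
  have d0 : 0 < (x - y) ^+ 2 by apply: lt_le_trans h3; rewrite divr_gt0.
  rewrite -[leLHS]mul1r ler_pdivrMr// mulrAC ler_pdivlMr ?addr_gt0// mul1r.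
  lra.
have fin (x y : R) : `|x| <= rho -> r < `|y| -> 2 * (F x - F y) *
    (tent r x - tent r y) * ((x - y) ^+ 2)^-1 <= 10 * n * ((x - y) ^+ 2 + r ^+ 2)^-1.
  move=> xr yr; have H := far x y xr yr.
  have -> : 10 * n * ((x - y) ^+ 2 + r ^+ 2)^-1 =
    2 * n * (5 * ((x - y) ^+ 2 + r ^+ 2)^-1) by ring.
  have d0 : 0 <= ((x - y) ^+ 2)^-1 by rewrite invr_ge0 sqr_ge0.
  have a1 : 2 * (F x - F y) * (tent r x - tent r y) <= 2 * n.
    rewrite (Frho y); last by lra.
    rewrite subr0 (tent_in r0); last by lra.
    have /andP[f0 fn] := F0 x; have := tent_ge0 r y; have := tent_le1 r y; nra.
  apply: le_trans (ler_wpM2r d0 a1) _.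
  by rewrite ler_wpM2l// mulr_ge0.
have [tr|tr] := leP `|t| rho; have [sr|sr] := leP `|s| rho.
- by rewrite !tent_in ?subrr ?mulr0 ?mul0r//; lra.
- have [sr'|sr'] := leP `|s| r.
    by rewrite !tent_in ?subrr ?mulr0 ?mul0r//; lra.
  apply: le_trans (fin t s tr sr') _.
  by rewrite /strip !indP tr [`|s| <= rho]leNgt sr /= addr0 mul1r -[(s - t) ^+ 2]sqrrN opprB.
- have [tr'|tr'] := leP `|t| r.
    by rewrite !tent_in ?subrr ?mulr0 ?mul0r//; lra.
  have := fin s t sr tr'.
  rewrite /strip !indP sr [`|t| <= rho]leNgt tr /= add0r mul1r.
  rewrite -[(t - s) ^+ 2]sqrrN opprB; congr (_ <= _); ring.
- by rewrite !Frho// subrr mulr0 !mul0r.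
Qed.

(** [F] is the sum of the [n] tents rather than their average, which makes the induction additive.
    Its energy grows linearly, so that of [F / n] is of order [1 / n]. *)
Definition good_test (A : R) (n : nat) (F : R -> R) (rho : R) :=
  [/\ measurable_fun setT F, (forall x, 0 <= F x <= n%:R),
      (forall x, `|x| <= A -> F x = n%:R), (forall x, rho < `|x| -> F x = 0) &
      [/\ A <= rho, 0 < rho & (energy F <= (26 * pi * n%:R)%:E)%E]].

Lemma test_function (A : R) (n : nat) : 0 < A -> exists F rho, good_test A n F rho.
Proof.
move=> A0; elim: n => [|n [F [rho [mF F0 FA Frho [Arho rho0 EF]]]]].
  exists (fun=> 0), A; split => //; [by move=> x; rewrite lexx|split=> //].
  rewrite mulr0 /energy /dint integral0_eq// => t _.
  by rewrite integral0_eq// => s _; rewrite subrr expr0n/= mul0r.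
(* The factor [n.+1] compensates the height [n] of [F]: the cross term costs
   [10 * pi * n / (n + 1)], the new tent alone costs [16 * pi], together at most [26 * pi]. *)
pose r := 4 * n.+1%:R * rho.
have n0 : 0 < n.+1%:R :> R by [].
have n1 : 1 <= n.+1%:R :> R by rewrite ler1n.
have rr : 4 * rho <= r by rewrite /r -mulrA ler_pM2l// ler_pMl.
have r0 : 0 < r by rewrite /r !mulr_gt0.
exists (fun x => F x + tent r x), (2 * r); split.
- by apply: measurable_funD => //; exact: measurable_tent.
- move=> x; have := F0 x; have := tent_ge0 r x; have := tent_le1 r x.
  by rewrite -natr1; lra.
- by move=> x xA; rewrite FA// tent_in// ?natr1//; lra.
- by move=> x xr; rewrite Frho ?tent_out ?addr0//; [exact: ltW|lra].
split; [lra|by rewrite mulr_gt0|].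
have m1 : measurable2 (fun t s : R => ((t - s) ^+ 2)^-1).
  by apply: measurable_funV; apply: measurable_funX; exact: measurable_funB.
have mE (G : R -> R) : measurable_fun setT G ->
    measurable2 (fun t s => (G t - G s) ^+ 2 * ((t - s) ^+ 2)^-1).
  move=> mG; apply: measurable_funM => //; apply: measurable_funX.
  by apply: measurable_funB; [exact: measurable2_fst|exact: measurable2_snd].
have E0 (G : R -> R) t s : 0 <= (G t - G s) ^+ 2 * ((t - s) ^+ 2)^-1.
  by rewrite mulr_ge0 ?sqr_ge0// invr_ge0 sqr_ge0.
have ms1 : measurable2 (fun t s => 10 * n%:R * strip rho r t s).
  by apply: measurable_funM => //; exact: measurable_strip.
have ms2 : measurable2 (fun t s => 2 * strip (2 * r) r t s).
  by apply: measurable_funM => //; exact: measurable_strip.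
have s1 t s : 0 <= 10 * n%:R * strip rho r t s by apply: mulr_ge0; [rewrite ?mulr_ge0|exact: strip_ge0].
have s2 t s : 0 <= 2 * strip (2 * r) r t s by apply: mulr_ge0; [rewrite ?mulr_ge0|exact: strip_ge0].
have bnd t s : (F t + tent r t - (F s + tent r s)) ^+ 2 * ((t - s) ^+ 2)^-1 <=
    (F t - F s) ^+ 2 * ((t - s) ^+ 2)^-1 +
    (10 * n%:R * strip rho r t s + 2 * strip (2 * r) r t s).
  have H1 := tent_sq_le t s r0; have H2 := cross_le t s rho0 rr F0 Frho.
  have -> : (F t + tent r t - (F s + tent r s)) ^+ 2 * ((t - s) ^+ 2)^-1 =
    (F t - F s) ^+ 2 * ((t - s) ^+ 2)^-1 +
    2 * (F t - F s) * (tent r t - tent r s) * ((t - s) ^+ 2)^-1 +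
    (tent r t - tent r s) ^+ 2 * ((t - s) ^+ 2)^-1 by ring.
  lra.
rewrite /energy; apply: le_trans (le_dint _ _ _ bnd) _.
- by apply: mE; apply: measurable_funD => //; exact: measurable_tent.
- by apply: measurable_funD; [exact: mE|exact: measurable_funD].
- by move=> x y; exact: (E0 (fun x => F x + tent r x)).
rewrite dintD//; last 3 first.
- exact: mE.
- exact: measurable_funD.
- by move=> x y; rewrite addr_ge0.
rewrite dintD// dintZ ?mulr_ge0//; last 2 first.
- exact: measurable_strip.
- exact: strip_ge0.
rewrite dintZ//; last 2 first.
- exact: measurable_strip.
- exact: strip_ge0.
rewrite !dint_strip ?mulr_gt0//.
have -> : 4 * (2 * r) * (pi / r) = 8 * pi by field; rewrite gt_eqF.
have -> : 4 * rho * (pi / r) = pi / n.+1%:R.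
  by rewrite /r; field; rewrite !gt_eqF//.
have H : (10 * n%:R * (pi / n.+1%:R) + 2 * (8 * pi) <= 26 * pi :> R)%R.
  have h : n%:R / n.+1%:R <= 1 :> R by rewrite ler_pdivrMr// mul1r ler_nat.
  have -> : 10 * n%:R * (pi / n.+1%:R) = 10 * pi * (n%:R / n.+1%:R) :> R by ring.
  move: (pi_gt0 R) (n%:R / n.+1%:R) h; move: (pi : R) => p p0 x x1.
  by nra.
rewrite -!EFinM -EFinD; apply: le_trans (leeD EF (lexx _)) _.
rewrite -EFinD lee_fin.
have -> : 26 * pi * n.+1%:R = 26 * pi * n%:R + 26 * pi :> R.
  by rewrite -natr1; ring.
by rewrite lerD2l.
Qed.

End TestFunctions.

(** * From small variance to rigidity *)

Section Rigidity.
Context {R : realType}.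
Notation mu := (@lebesgue_measure R).

Variables (K : R -> R -> R[i]) (k : R -> R) (kap : R -> R -> R) (c : R).
Hypothesis Kdiag : forall x, K x x = (k x)%:C.
Hypothesis Koff : forall x y, x != y -> K x y * K y x = (kap x y)%:C.
Hypothesis mkap : measurable2 kap.
Hypothesis kap0 : forall x y, 0 <= kap x y.
Hypothesis kapE : forall x, (\int[mu]_t (kap x t)%:E = (k x)%:E)%E.
Hypothesis kap_sym : forall x y, kap x y = kap y x.
Hypothesis kap_le : forall x y, kap x y * (x - y) ^+ 2 <= c.
Variables (P : probability (ConfSpace R) R).
Hypothesis DPP : is_DPP K P.

Let c0 : 0 <= c.
Proof. by have := kap_le 0 0; rewrite subrr expr0n/= mulr0. Qed.

(** The bound [kap_le] says nothing on the diagonal; there the increment [h] of the test function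
    vanishes. *)
Let sqkap_le (h x y : R) : (x != y \/ h = 0) ->
  h ^+ 2 * kap x y <= c * (h ^+ 2 * ((x - y) ^+ 2)^-1).
Proof.
have [-> _|h0] := eqVneq h 0; first by rewrite expr0n/= !mul0r mulr0.
move=> [xy|/eqP]; last by rewrite (negbTE h0).
have d0 : 0 < (x - y) ^+ 2 by rewrite exprn_even_gt0//= subr_eq0.
rewrite mulrCA ler_wpM2l ?sqr_ge0// -[leRHS]/(c / _) ler_pdivlMr//.
Qed.

Lemma small_variance (A eps : R) : 0 < A -> 0 < eps ->
  exists (f : R -> R) (rho : R),
  [/\ measurable_fun setT f, (forall x, 0 <= f x <= 1),
    (forall x, `|x| <= A -> f x = 1), A <= rho &
    P.-integrable setT (fun X => ((linstat f [set` `[- rho, rho]] X -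
      \int[P]_Y linstat f [set` `[- rho, rho]] Y) ^+ 2)%:E) /\
    \int[P]_X (linstat f [set` `[- rho, rho]] X -
      \int[P]_Y linstat f [set` `[- rho, rho]] Y) ^+ 2 <= eps].
Proof.
move=> A0 eps0.
(* Twice the variance is at most [c / n ^ 2] times the energy bound [26 * pi * n]. *)
pose n := (Num.truncn (c * (26 * pi) / eps)).+1.
have nE : c * (26 * pi) / n%:R <= eps.
  have : c * (26 * pi) / eps < n%:R by exact: truncnS_gt.
  rewrite ltr_pdivrMr// => h.
  by rewrite ler_pdivrMr ?ltr0n// [leRHS]mulrC ltW.
have n0 : 0 < n%:R :> R by rewrite ltr0n.
have [F [rho [mF F01 FA Frho [Arho rho0 EF]]]] := test_function n A0.
pose f x := n%:R^-1 * F x.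
exists f, rho.
have f01 x : 0 <= f x <= 1.
  have /andP[h1 h2] := F01 x; rewrite /f mulr_ge0 ?invr_ge0 ?(ltW n0)//=.
  by rewrite mulrC ler_pdivrMr// mul1r.
have mf : measurable_fun setT f by exact: measurable_funM.
set D := [set` `[- rho, rho]].
have mD : measurable D by exact: measurable_itv.
have bD : bounded_set D.
  by apply/bounded_setP; exists rho => x; rewrite /D/= in_itv/= ler_norml.
have fD x : ~ D x -> f x = 0.
  move=> Dx; rewrite /f Frho ?mulr0// ltNge; apply/negP => xr; apply: Dx.
  by rewrite /D/= in_itv/= -ler_norml.
have f0 x : 0 <= f x by have /andP[] := f01 x.
have f1 x : f x <= 1 by have /andP[] := f01 x.
split=> //; first by move=> x /FA fx; rewrite /f fx mulVf ?gt_eqF.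
have [iV VE] := linstat_variance Kdiag Koff mkap kap0 kapE kap_sym DPP mD bD mf f0 f1 fD.
split => //.
set V := \int[P]_X _ in VE *.
have V0 : 0 <= V by apply: Rintegral_ge0 => X _; exact: sqr_ge0.
suff : ((2 * V)%:E <= (c * (26 * pi) / n%:R)%:E)%E.
  rewrite lee_fin; lra.
rewrite VE -/(dint (fun t s => (f t - f s) ^+ 2 * kap t s)).
have m1 : measurable2 (fun t s : R => ((t - s) ^+ 2)^-1).
  by apply: measurable_funV; apply: measurable_funX; exact: measurable_funB.
have mE (G : R -> R) : measurable_fun setT G ->
    measurable2 (fun t s => (G t - G s) ^+ 2).
  move=> mG; apply: measurable_funX.
  by apply: measurable_funB; [exact: measurable2_fst|exact: measurable2_snd].
have cn0 : 0 <= c / n%:R ^+ 2 by rewrite divr_ge0// exprn_ge0.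
have mEF : measurable2 (fun t s => (F t - F s) ^+ 2 * ((t - s) ^+ 2)^-1).
  by apply: measurable_funM => //; exact: mE.
have EF0 t s : 0 <= (F t - F s) ^+ 2 * ((t - s) ^+ 2)^-1.
  by rewrite mulr_ge0 ?sqr_ge0// invr_ge0 sqr_ge0.
have le1 t s : (f t - f s) ^+ 2 * kap t s <=
    c / n%:R ^+ 2 * ((F t - F s) ^+ 2 * ((t - s) ^+ 2)^-1).
  have -> : c / n%:R ^+ 2 * ((F t - F s) ^+ 2 * ((t - s) ^+ 2)^-1) =
      c * ((f t - f s) ^+ 2 * ((t - s) ^+ 2)^-1).
    rewrite /f -mulrBr exprMn -exprVn; ring.
  apply: sqkap_le; have [->|] := eqVneq t s; last by left.
  by right; rewrite subrr.
apply: le_trans (le_dint _ _ _ le1) _.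
- by apply: measurable_funM => //; exact: mE.
- by apply: measurable_funM.
- by move=> x y; rewrite mulr_ge0 ?sqr_ge0.
rewrite dintZ//; apply: le_trans (lee_wpmul2l _ EF) _; first by rewrite lee_fin.
rewrite -EFinM lee_fin le_eqVlt; apply/orP; left; apply/eqP.
by move: (pi : R) => p; field; rewrite gt_eqF.
Qed.

(** Since [f j = 1] on [B], the count in [B] is [T_ j], which looks only outside [B], plus the
    centred statistic [dev j]. The mean squares of [dev j] are summable, so the sum of the squares
    is almost surely finite and [dev j] tends to 0. *)
Lemma rigid_of_kernel : rigid P.
Proof.
move=> B mB bB A mA.
have [M hM] := (bounded_setP B).1 bB.
pose A0 := `|M| + 1.
have A00 : 0 < A0 by rewrite ltr_wpDl.
have BA x : B x -> `|x| <= A0.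
  by move=> /hM H; rewrite (le_trans H)// /A0; have := ler_norm M; lra.
(* The bounds sum to at most 1, so almost sure convergence holds along the whole sequence. *)
pose eps j : R := 1 / (2 ^ j.+1)%:R.
have eps0 j : 0 < eps j by rewrite divr_gt0// ltr0n expn_gt0.
have [f hf] := choice (fun j => small_variance A00 (eps0 j)).
have [rho hrho] := choice hf.
pose D j : set R := [set` `[- rho j, rho j]].
pose e j := \int[P]_Y linstat (f j) (D j) Y.
pose dev j X := linstat (f j) (D j) X - e j.
pose T_ j X := e j - linstat (f j) (D j `&` ~` B) X.
have mD j : measurable (D j) by exact: measurable_itv.
have bD j : bounded_set (D j).
  by apply/bounded_setP; exists (rho j) => x; rewrite /D/= in_itv/= ler_norml.
have devE j X : dev j X = (size (pts B X))%:R - T_ j X.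
  have [_ _ f1 Arho _] := hrho j.
  rewrite /dev /T_ (linstat_split (f j) B X (bD j)).
  have -> : D j `&` B = B.
    apply/seteqP; split => [x []//|x Bx]; split => //.
    rewrite /D/= in_itv/= -ler_norml; exact: le_trans (BA x Bx) Arho.
  have -> : linstat (f j) B X = (size (pts B X))%:R.
    rewrite /linstat big_seq (eq_bigr (fun=> 1)).
      by rewrite -big_seq big_const_seq count_predT iter_addr addr0.
    by move=> x xB; apply: f1; apply: BA; exact: pts_in xB.
  by ring.
have mT j : measurable_fun setT (T_ j : g_sigma_algebraType (gen_F (~` B)) -> R).
  have [mfj f01 _ _ _] := hrho j.
  apply: measurable_funB => //; apply: measurable_linstat => //.
  - by apply: measurableI => //; exact: measurableC.
  - exact: bounded_setI.
  - by move=> x; have /andP[] := f01 x.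
(* An upper limit is defined and measurable for the outer sigma-algebra at every configuration,
   including those where [T_ j] diverges. *)
pose T X : \bar R := limn_esup (fun j => (T_ j X)%:E).
have mTT : measurable_fun setT (T : g_sigma_algebraType (gen_F (~` B)) -> \bar R).
  apply: (@measurable_fun_limn_esup _ (g_sigma_algebraType (gen_F (~` B))) R setT
    (fun j X => (T_ j X)%:E)) => j.
  exact/measurable_EFinP.
have iV j : P.-integrable setT (fun X => (dev j X ^+ 2)%:E).
  by have [_ _ _ _ []] := hrho j.
have Vle j : (\int[P]_X (dev j X ^+ 2)%:E <= (eps j)%:E)%E.
  have [_ _ _ _ [_ H]] := hrho j.
  rewrite -[leLHS]fineK; last exact: integrable_fin_num.
  by rewrite lee_fin.
have msum : measurable_fun setT ((fun X => \sum_(j <oo) (dev j X ^+ 2)%:E)%E : ConfSpace R -> \bar R).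
  apply: ge0_emeasurable_sum => //.
    by move=> j X _ _; rewrite lee_fin sqr_ge0.
  by move=> j _; have /integrableP[] := iV j.
have isum : P.-integrable setT ((fun X => \sum_(j <oo) (dev j X ^+ 2)%:E)%E : ConfSpace R -> \bar R).
  apply/integrableP; split => //.
  under eq_integral => X _.
    rewrite gee0_abs; last by apply: nneseries_ge0 => j _ _; rewrite lee_fin sqr_ge0.
    over.
  rewrite integral_nneseries//; last 2 first.
  - by move=> j; have /integrableP[] := iV j.
  - by move=> j X _; rewrite lee_fin sqr_ge0.
  apply: le_lt_trans (lee_nneseries _ (fun j _ => Vle j)) _.
    by move=> j *; apply: integral_ge0 => X _; rewrite lee_fin sqr_ge0.
  by apply: le_lt_trans (epsilon_trick0 _ ler01) _; rewrite ltry.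
(* [N] contains the configurations with infinite sum of squares. It belongs to the sigma-algebra of
   the whole line, as [completion_F] asks of a null set. *)
have [N [mN PN subN]] := integrable_ae measurableT isum.
exists (T @^-1` A), N; split => //.
- by have := mTT measurableT _ mA; rewrite setTI.
suff TE X : ~ N X -> T X = count_in B X.
  by move=> X [[/= h1 h2]|[/= h1 h2]]; apply: contrapT => /TE E; rewrite E in h1 h2.
move=> NX.
have fin : (\sum_(j <oo) (dev j X ^+ 2)%:E)%E \is a fin_num.
  by apply: contrapT => H; apply: NX; apply: subN => /=; move=> /(_ I).
have dev_cvg : (fun j => dev j X ^+ 2) @ \oo --> 0.
  have H0 j : xpredT j -> (0 <= (dev j X ^+ 2)%:E)%E by rewrite lee_fin sqr_ge0.
  have := @nneseries_tail_cvg R (fun j => (dev j X ^+ 2)%:E) xpredT _ H0.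
  rewrite -ge0_fin_numE; last by apply: nneseries_ge0 => i _ _; exact: H0.
  move=> /(_ fin) cv.
  (* Each term is squeezed between 0 and the tail of the convergent series that it starts. *)
  have : (fun j => (dev j X ^+ 2)%:E) @ \oo --> (0 : \bar R)%E.
    apply: (squeeze_cvge _ (cvg_cst _) cv); apply: nearW => j.
    rewrite H0//=; have := @nneseries_lim_ge R (fun j => (dev j X ^+ 2)%:E) xpredT j j.+1.
    by rewrite big_nat1; apply => i _ _; exact: H0.
  by move=> /fine_cvgP[].
have dev_cvg0 : (fun j => dev j X) @ \oo --> 0.
  apply/cvgr0Pnorm_lt => d d0.
  have d20 : 0 < d ^+ 2 by rewrite exprn_gt0.
  have /cvgr0Pnorm_lt /(_ _ d20) := dev_cvg.
  by apply: filterS => j; rewrite normrX ltr_pXn2r ?nnegrE// ltW.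
have T_cvg : (fun j => (T_ j X)%:E) @ \oo --> count_in B X.
  rewrite count_inE//; apply/fine_cvgP; split; first exact: nearW.
  have -> : fine \o (fun j => (T_ j X)%:E) = (fun j => (size (pts B X))%:R - dev j X).
    by apply/funext => j /=; rewrite devE; ring.
  rewrite -[X in _ --> X]subr0; apply: cvgB => //; exact: cvg_cst.
rewrite /T is_cvg_limn_esupE; last by apply/cvg_ex; exists (count_in B X).
exact/cvg_lim.
Qed.

End Rigidity.

Theorem mainTheorem1 (R : realType) (E : R[i] -> R[i])
  (P : probability (ConfSpace R) R) :
  de_branges E -> is_DPP (PiE E) P -> rigid P.
Proof.
move=> /de_branges_kernel[k [kap [kd ko mk [k0 ks kle kE]]]] DPP.
exact: (rigid_of_kernel kd ko mk k0 kE ks kle DPP).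
Qed.
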